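(* Let $N\ge2$, $K\in\mathcal K^{ss}_{(o)}$ and $a,b\in\mathbb R$. The inequality $$\Big(\int_{\mathbb R^N}\frac{|\mathcal R_K(u)|^2}{\|x\|_K^{2b}}dx\Big)^{\frac12}\Big(\int_{\mathbb R^N}\frac{u^2}{\|x\|_K^{2a}}dx\Big)^{\frac12}\ \ge\ \widetilde C(N,a,b)\int_{\mathbb R^N}\frac{u^2}{\|x\|_K^{a+b+1}}dx$$ holds for all $u\in C_c^\infty(\mathbb R^N\setminus\{o\})$ (the zero function giving only a trivial equality case), with the following sharp constants $\widetilde C(N,a,b)$. (i) If $(a,b)\in\mathcal A=\mathcal A_1\cup\mathcal A_2$, the sharp constant is $\widetilde C(N,a,b)=\big|\frac{N-a-b-1}{2}\big|$, and it is achieved in $\mathcal C_{K,a,b}$ by the nonzero functions $$u(x)=\Phi(\sigma_K(x))\,\exp\Big(\frac{t}{b+1-a}\|x\|_K^{\,b+1-a}\Big),$$ where $t<0$ if $(a,b)\in\mathcal A_1$, $t>0$ if $(a,b)\in\mathcal A_2$, and $0\not\equiv\Phi\in L^2(\partial K,d\mu_K)$. (ii) If $(a,b)\in\mathcal B=\mathcal B_1\cup\mathcal B_2$, the sharp constant is $\widetilde C(N,a,b)=\big|\frac{N-3b+a-3}{2}\big|$, and it is achieved in $\mathcal C_{K,a,b}$ by the nonzero functions $$u(x)=\Phi(\sigma_K(x))\,\|x\|_K^{2b+2-N}\exp\Big(\frac{t}{b+1-a}\|x\|_K^{\,b+1-a}\Big),$$ where $t>0$ if $(a,b)\in\mathcal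 B_1$, $t<0$ if $(a,b)\in\mathcal B_2$, and $0\not\equiv\Phi\in L^2(\partial K,d\mu_K)$. (iii) If $a=b+1$, the sharp constant is $\widetilde C(N,b+1,b)=\frac{|N-2(b+1)|}{2}$, and it cannot be achieved by nonzero functions in $\mathcal C_{K,b+1,b}$.
   Context: $o$ is the origin of $\mathbb R^N$. A convex body is a compact convex subset of $\mathbb R^N$ with non-empty interior. $\mathcal K^{ss}_{(o)}$ is the set of convex bodies $K\subset\mathbb R^N$ that contain $o$ in their interior, are smooth (each boundary point has a unique outer unit normal vector) and strictly convex ($\partial K$ contains no line segment). $K$ is not assumed origin-symmetric. The Minkowski functional of $K$ is $\|x\|_K=\inf\{\lambda\ge0:x\in\lambda K\}$. For $x\ne o$, $\sigma_K(x)=x/\|x\|_K\in\partial K$, and the anisotropic radial derivative is $\mathcal R_K(u)(x)=\nabla u(x)\cdot\sigma_K(x)=\frac{x\cdot\nabla u(x)}{\|x\|_K}$. $\mu_K$ is the finite Borel measure on $\partial K$ determined by the polar formula $\int_{\mathbb R^N}u\,dx=\int_0^\infty\int_{\partial K}u(r\sigma)r^{N-1}d\mu_K(\sigma)dr$ for all non-negative measurable $u$. $\mathcal C_{K,a,b}$ is the completion of $C_c^\infty(\mathbb R^N\setminus\{o\})$ under the norm $$\|u\|_{\mathcal C_{K,a,b}}=\Big(\int_{\mathbb R^N}\frac{|\mathcal R_K(u)|^2}{\|x\|_K^{2b}}dx+\int_{\mathbb R^N}\frac{u^2}{\|x\|_K^{2a}}dx\Big)^{\frac12}.$$ ''Sharp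 constant'' means the largest constant for which the inequality holds for all $u\in C_c^\infty(\mathbb R^N\setminus\{o\})$; ''achieved in $\mathcal C_{K,a,b}$'' by a function means that the function belongs to $\mathcal C_{K,a,b}$ and gives equality. Parameter regions in the $(a,b)$-plane: $\mathcal A_1=\{b>a-1,\ b\le\frac{N-2}2\}$, $\mathcal A_2=\{b<a-1,\ b\ge\frac{N-2}2\}$, $\mathcal B_1=\{b<a-1,\ b<\frac{N-2}2\}$, $\mathcal B_2=\{b>a-1,\ b>\frac{N-2}2\}$. *)

(* Defs.v *)
From HB Require Import structures.
From mathcomp Require Import all_boot all_order all_algebra.
From mathcomp Require Import all_classical all_reals all_analysis measurable_realfun.
Import Order.TTheory GRing.Theory Num.Theory.
Import numFieldNormedType.Exports.

Set Implicit Arguments.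
Unset Strict Implicit.
Unset Printing Implicit Defensive.

Local Open Scope classical_set_scope.
Local Open Scope ring_scope.

Section borel_matrix.
Context {R : realType} {m n : nat}.

HB.instance Definition _ := @isMeasurable.Build
  (sigma_display (@open 'M[R]_(m, n))) 'M[R]_(m, n) <<s @open 'M[R]_(m, n) >>
  (@sigma_algebra0 _ setT _) (@sigma_algebraC _ _)
  (@sigma_algebra_bigcup _ setT _).

End borel_matrix.

Section borel_coordinates.
Context {R : realType}.

Lemma open_measurable_mx {m n} (A : set 'M[R]_(m, n)) : open A -> measurable A.
Proof. by move=> oA; exact: sub_sigma_algebra. Qed.

Lemma measurable_coord {n} (i : 'I_n) :
  measurable_fun [set: 'rV[R]_n] (fun x : 'rV[R]_n => x ord0 i).
Proof.
apply: (measurability _ (RGenOpens.measurableE R)) => _ [_ [a [b ->]] <-].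
rewrite setTI; apply: open_measurable_mx; apply: open_comp.
  by move=> x _; exact: coord_continuous.
exact: interval_open.
Qed.

Lemma measurable_fun_rV d (T : measurableType d) n (f : T -> 'rV[R]_n) :
  (forall i, measurable_fun [set: T] (fun t => f t ord0 i)) ->
  measurable_fun [set: T] f.
Proof.
move=> mf; apply: (measurability (@open 'rV[R]_n)) => // _ [U oU <-].
rewrite setTI.
pose B (c : 'rV[rat]_n * rat) : set 'rV[R]_n :=
  [set x | forall i, ball (ratr (c.1 ord0 i) : R) (ratr c.2) (x ord0 i)].
pose F (c : 'rV[rat]_n * rat) : set T :=
  if `[< B c `<=` U >] then f @^-1` (B c) else set0.
have -> : f @^-1` U = \bigcup_c F c.
  apply/seteqP; split=> [t /= Uft|t [c _]]; last first.
    by rewrite /F; case: asboolP => //= BU Bft; exact: (BU _ Bft).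
  have : nbhs (f t) U by exact: open_nbhs_nbhs.
  move=> /nbhs_ballP[e /= e0 eU].
  have [r /andP[r0 re]] : exists q : rat, 0 < (ratr q : R) < e / 2.
    have /rat_in_itvoo[q] : (0 : R) < e / 2 by exact: divr_gt0.
    by rewrite in_itv/= => ?; exists q.
  have qP i : exists q : rat, ball (ratr q : R) (ratr r) (f t ord0 i).
    have /rat_in_itvoo[q] : f t ord0 i - ratr r < f t ord0 i + ratr r.
      by rewrite ltrBlDr -addrA ltrDl addr_gt0.
    rewrite in_itv/= => qr; exists q.
    by rewrite /ball/= ltr_distl; move: qr; rewrite ltrBlDr andbC -ltrBlDr.
  pose c : 'rV[rat]_n * rat := (\row_i sval (cid (qP i)), r).
  exists c => //; rewrite /F; case: asboolP => [_ i|nBU]/=.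
    by rewrite mxE; exact: svalP (cid (qP i)).
  exfalso; apply: nBU => y Bcy; apply: eU; split => // i j.
  rewrite (ord1 i).
  have := Bcy j; rewrite /= mxE => yj.
  have tj := svalP (cid (qP j)).
  rewrite [e]splitr; apply: (ball_triangle (y := ratr (sval (cid (qP j))) : R)).
    by apply: ball_sym; apply: le_ball tj; exact: ltW.
  by apply: le_ball yj; exact: ltW.
apply: countable_bigcupT_measurable => [|c]; first exact: countableP.
rewrite /F; case: ifP => // _.
have -> : f @^-1` B c = \bigcap_(i in [set: 'I_n])
    ((fun t => f t ord0 i) @^-1` ball (ratr (c.1 ord0 i) : R) (ratr c.2)).
  by apply/seteqP; split=> t /= ft i; [move=> _|]; exact: ft.
apply: fin_bigcap_measurable => // i _.
rewrite -[X in measurable X]setTI; apply: mf => //.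
by apply: open_measurable; exact: ball_open.
Qed.

End borel_coordinates.

Section lebesgue_rV.
Context {R : realType}.

Definition consV n (p : R * 'rV[R]_n) : 'rV[R]_n.+1 :=
  row_mx (p.1%:M : 'rV_1) p.2.

Definition unconsV n (x : 'rV[R]_n.+1) : R * 'rV[R]_n :=
  (x ord0 ord0, rsubmx (x : 'rV_(1 + n))).

Lemma consVK n : cancel (@consV n) (@unconsV n).
Proof.
case=> t v; rewrite /unconsV /consV /=; congr pair; last by rewrite row_mxKr.
have -> : (ord0 : 'I_n.+1) = lshift n (ord0 : 'I_1) by exact/val_inj.
by rewrite (@row_mxEl _ 1 1 n) mxE eqxx.
Qed.

Lemma unconsVK n : cancel (@unconsV n) (@consV n).
Proof.
move=> x; rewrite /consV /unconsV /=.
rewrite -[RHS](@hsubmxK _ 1 1 n x).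
suff -> : ((x ord0 ord0)%:M : 'rV[R]_1) = @lsubmx _ 1 1 n x by [].
apply/rowP => i; rewrite !mxE (ord1 i) eqxx mulr1n.
by congr (x _ _); exact/val_inj.
Qed.

Lemma measurable_consV n : measurable_fun [set: R * 'rV[R]_n] (@consV n).
Proof.
apply: measurable_fun_rV => i; rewrite -(@splitK 1 n i).
case: (@fintype.split 1 n i) => j /=.
- rewrite (_ : (fun _ => _) = fst); first exact: measurable_fst.
  apply/funext => -[t v].
  by rewrite /consV/= (@row_mxEl _ 1 1 n) mxE (ord1 j) eqxx.
- rewrite (_ : (fun _ => _) = (fun x : 'rV[R]_n => x ord0 j) \o snd).
    by apply: measurableT_comp; [exact: measurable_coord|exact: measurable_snd].
  by apply/funext => -[t v]; rewrite /consV/= (@row_mxEr _ 1 1 n).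
Qed.

Lemma measurable_unconsV n : measurable_fun [set: 'rV[R]_n.+1] (@unconsV n).
Proof.
apply/measurable_fun_pairP; split; first exact: measurable_coord.
apply: measurable_fun_rV => i.
rewrite (_ : (fun _ => _) = (fun x : 'rV[R]_n.+1 => x ord0 (rshift 1 i))).
  exact: measurable_coord.
by apply/funext => x; rewrite /= mxE.
Qed.

Section step.
Variables (n : nat) (nu : {sigma_finite_measure set 'rV[R]_n -> \bar R}).

Definition lebesgue_step : set 'rV[R]_n.+1 -> \bar R :=
  pushforward (@lebesgue_measure R \x nu)%E (@consV n).

Let step0 : lebesgue_step set0 = 0%E.
Proof. by rewrite /lebesgue_step /pushforward preimage_set0 measure0. Qed.

Let step_ge0 A : (0 <= lebesgue_step A)%E.
Proof. by rewrite /lebesgue_step /pushforward measure_ge0. Qed.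

Let step_sigma_additive : semi_sigma_additive lebesgue_step.
Proof.
move=> F mF tF mUF; rewrite /lebesgue_step /pushforward preimage_bigcup.
apply: measure_semi_sigma_additive.
- by move=> k; rewrite -[X in measurable X]setTI; exact: measurable_consV.
- apply/trivIsetP => /= i j _ _ ij; rewrite -preimage_setI.
  by move/trivIsetP : tF => /(_ _ _ _ _ ij) ->//; rewrite preimage_set0.
- by rewrite -preimage_bigcup -[X in measurable X]setTI; exact: measurable_consV.
Qed.

HB.instance Definition _ := isMeasure.Build _ _ _ lebesgue_step
  step0 step_ge0 step_sigma_additive.

Let step_sigma_finite : sigma_finite setT lebesgue_step.
Proof.
have /sigma_finiteP[F [TF ndF Foo]] := sigma_finiteT (@lebesgue_measure R).
have /sigma_finiteP[G [TG ndG Goo]] := sigma_finiteT nu.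
exists (fun k => @unconsV n @^-1` (F k `*` G k)).
  rewrite -preimage_bigcup (_ : \bigcup_k _ = setT) ?preimage_setT//.
  apply/seteqP; split=> // -[x y] _.
  have [k _ Fx] : (\bigcup_k F k) x by rewrite -TF.
  have [l _ Gy] : (\bigcup_k G k) y by rewrite -TG.
  exists (maxn k l) => //; split => /=.
  - by move: x Fx; exact/subsetPset/ndF/leq_maxl.
  - by move: y Gy; exact/subsetPset/ndG/leq_maxr.
move=> k; have [mF Fk] := Foo k; have [mG Gk] := Goo k; split.
  rewrite -[X in measurable X]setTI; apply: measurable_unconsV => //.
  exact: measurableX.
rewrite /lebesgue_step /pushforward.
rewrite (_ : _ @^-1` _ = F k `*` G k).
  by rewrite product_measure1E// lte_mul_pinfty// ge0_fin_numE.
by rewrite -comp_preimage (_ : _ \o _ = id)//; apply/funext/consVK.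
Qed.

HB.instance Definition _ := Measure_isSigmaFinite.Build _ _ _ lebesgue_step
  step_sigma_finite.

End step.

(** Lebesgue measure on [R^n], as the iterated product of the one-dimensional
    one; the one-point space [R^0] gets mass [1]. *)
Fixpoint lebesgue_rV n : {sigma_finite_measure set 'rV[R]_n -> \bar R} :=
  if n is k.+1 then lebesgue_step (lebesgue_rV k) else \d_ (0 : 'rV[R]_0).

End lebesgue_rV.

Section convex_bodies.
Context {R : realType} {N : nat}.
Implicit Types (K : set 'rV[R]_N) (x y v : 'rV[R]_N).

(** The library norm on ['rV[R]_N] is the sup norm; unit normals are taken
    for the Euclidean inner product. *)
Definition dotv x y : R := \sum_i x ord0 i * y ord0 i.

Definition bdry K : set 'rV[R]_N := closure K `\` K°.

Definition convex_body K : Prop :=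
  [/\ compact K, convex_set (K : set (convex_lmodType 'rV[R]_N)) & K° !=set0].

Definition outer_unit_normal K x v : Prop :=
  dotv v v = 1 /\ forall y, K y -> dotv (y - x) v <= 0.

Definition smooth_body K : Prop :=
  forall x, bdry K x -> exists! v, outer_unit_normal K x v.

Definition strictly_convex_body K : Prop :=
  forall x y, x != y ->
    ~ (forall t : R, 0 <= t <= 1 -> bdry K ((1 - t) *: x + t *: y)).

Definition Kss_o K : Prop :=
  [/\ convex_body K, K° 0, smooth_body K & strictly_convex_body K].

Definition normK K x : R :=
  inf [set l : R | 0 <= l /\ exists2 y, K y & x = l *: y].

Definition sigmaK K x : 'rV[R]_N := (normK K x)^-1 *: x.

(** [mu] is the finite Borel measure on the boundary of [K] determined by the
    polar formula; it is seen as a measure on [R^N] carried by that boundary. *)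
Definition polar_measure K
    (mu : {finite_measure set 'rV[R]_N -> \bar R}) : Prop :=
  mu (~` bdry K) = 0%E /\
  forall u : 'rV[R]_N -> \bar R,
    measurable_fun setT u -> (forall x, (0 <= u x)%E) ->
    (\int[lebesgue_rV N]_x u x =
     \int[lebesgue_measure]_(r in `[0%R, +oo[)
       \int[mu]_(s in bdry K) (u (r *: s) * (r ^+ N.-1)%:E))%E.

Definition L2_bdry K (mu : {finite_measure set 'rV[R]_N -> \bar R})
    (Phi : 'rV[R]_N -> R) : Prop :=
  measurable_fun (bdry K) Phi /\
  (\int[mu]_(s in bdry K) ((Phi s) ^+ 2)%:E < +oo)%E.

Definition nonzero_bdry K (mu : {finite_measure set 'rV[R]_N -> \bar R})
    (Phi : 'rV[R]_N -> R) : Prop :=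
  ~ {ae mu, forall s, bdry K s -> Phi s = 0}.

End convex_bodies.

Section function_spaces.
Context {R : realType} {N : nat}.
Implicit Types (K : set 'rV[R]_N) (u g : 'rV[R]_N -> R).

Definition partial (i : 'I_N) u : 'rV[R]_N -> R :=
  fun x => 'D_(delta_mx ord0 i) u x.

Definition gradient u : 'rV[R]_N -> 'rV[R]_N :=
  fun x => \row_i partial i u x.

Fixpoint Ck (k : nat) u : Prop :=
  if k is j.+1 then
    (forall i x, derivable u x (delta_mx ord0 i)) /\
    (forall i, Ck j (partial i u))
  else continuous u.

Definition supp u : set 'rV[R]_N := closure [set x | u x != 0].

(** [C_c^oo(R^N \ {o})], each function being extended by [0] at the origin. *)
Definition test_fun u : Prop :=
  [/\ forall k, Ck k u, compact (supp u) & ~ supp u 0].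

Definition radial_deriv K u : 'rV[R]_N -> R :=
  fun x => dotv (gradient u x) (sigmaK K x).

Definition wint K (c : R) u : \bar R :=
  (\int[lebesgue_rV N]_x ((u x) ^+ 2 / normK K x `^ c)%:E)%E.

(** The norm of [C_{K,a,b}], with [g] in the role of the radial derivative
    of [u]. *)
Definition C_norm K (a b : R) u g : \bar R :=
  ((wint K (2 * b) g + wint K (2 * a) u) `^ 2^-1)%E.

(** The map [phi |-> (phi, radial_deriv K phi)] is an isometry from the test
    functions with the norm of [C_{K,a,b}] to a product of two complete
    weighted [L^2] spaces, so the completion is the closure of its range.
    [in_completion K a b u g] says that [(u, g)] belongs to this closure: [u]
    is an element of the completion and [g] is its radial derivative, which is
    unique almost everywhere. *)
Definition in_completion K (a b : R) u g : Prop :=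
  [/\ measurable_fun setT u, measurable_fun setT g &
    exists2 phi : nat -> 'rV[R]_N -> R, (forall n, test_fun (phi n)) &
      C_norm K a b (phi n \- u) (radial_deriv K (phi n) \- g) @[n --> \oo]
        --> 0%E].

Definition hup_lhs K (a b : R) u g : \bar R :=
  (wint K (2 * b) g `^ 2^-1 * wint K (2 * a) u `^ 2^-1)%E.

Definition hup_inequality K (a b C : R) : Prop :=
  forall u, test_fun u ->
    (C%:E * wint K (a + b + 1) u <= hup_lhs K a b u (radial_deriv K u))%E.

Definition sharp_constant K (a b C : R) : Prop :=
  hup_inequality K a b C /\ forall C', hup_inequality K a b C' -> C' <= C.

Definition achieved_by K (a b C : R) u : Prop :=
  exists2 g, in_completion K a b u g &
    (hup_lhs K a b u g = C%:E * wint K (a + b + 1) u)%E.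

Definition nonzero_fun u : Prop := ~ {ae lebesgue_rV N, forall x, u x = 0}.

End function_spaces.

Section regions.
Context {R : realType} (N : nat) (a b : R).

Definition regionA1 : bool := (b > a - 1) && (b <= (N%:R - 2) / 2).
Definition regionA2 : bool := (b < a - 1) && (b >= (N%:R - 2) / 2).
Definition regionB1 : bool := (b < a - 1) && (b < (N%:R - 2) / 2).
Definition regionB2 : bool := (b > a - 1) && (b > (N%:R - 2) / 2).

End regions.

(* Main.v *)
Require Import Defs.
From HB Require Import structures.
From mathcomp Require Import all_boot all_order all_algebra.
From mathcomp Require Import all_classical all_reals all_analysis measurable_realfun.
From mathcomp Require Import ring lra.
Import Order.TTheory GRing.Theory Num.Theory.
Import numFieldNormedType.Exports.

Set Implicit Arguments.
Unset Strict Implicit.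
Unset Printing Implicit Defensive.

Local Open Scope classical_set_scope.
Local Open Scope ring_scope.

(** Let [r = normK K] be the gauge of [K], [N] the dimension, and [R u] the radial
    derivative of [u].

    The inequality. For a test function [u], integration by parts along the rays
    gives [2 \int u (R u) r^-c = (c + 1 - N) \int u^2 r^-(c+1)]
    ([test_fun_IBP_pow]). With [c = a + b] and the Cauchy-Schwarz inequality this
    is the inequality with the constant [|N - a - b - 1| / 2]. The same argument
    applies to [R u + l u / r] instead of [R u]. For [l = N - 2 b - 2] its weighted
    norm is the one of [R u] ([test_fun_shift]), and the constant becomes
    [|N - 3 b + a - 3| / 2] ([test_fun_ineq]). Both inequalities hold for all
    [a] and [b], and extend to the completion ([hup_approximable]).

    Equality. In the Cauchy-Schwarz inequality it means that [R u] is
    proportional to [u r^(b-a)] in the first case, and so is [R u + l u / r] in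
    the second one: along each ray this is a linear differential equation, whose
    solutions are the functions of the statement. That they give equality is a
    computation with the fundamental theorem of calculus in the variable [ln r]
    ([extremal]). A constant which is attained by one nonzero element of the
    completion is sharp ([sharp_constant_achieved]).

    Membership in the completion is the longest part, since the density [Phi] is
    only square integrable, the gauge is only Lipschitz, and the profile has no
    compact support. One starts from the test functions [A(x) H(ln |x| + d)],
    where [|x|] is the Euclidean norm, [A] is smooth and homogeneous of degree [0]
    and [H] has compact support ([test_fun_ang_rad]). Dynkin's theorem replaces [A]
    by the indicator of a Borel set of directions ([in_completion_borel]). As
    [ln r - ln |x|] is a bounded function of the direction, hence a limit of simple
    functions, one may replace [ln |x| + d] by [ln r] ([in_completion_gauge]), and
    then the indicator by a square integrable function ([in_completion_angular]).
    Cutoffs in the variable [ln r] give the general profiles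
    ([in_completion_profile]). Finiteness of the norms is read in polar
    coordinates ([wint_polar]); a polar measure exists, given by the volumes of
    the cones over the sets of directions ([polar_measure_exists]).

    For [a = b + 1] both constants are [|N - 2 b - 2| / 2] and the extremal
    differential equation has the solutions [r^((2 b + 2 - N) / 2)] only, which
    have infinite norms. Slowly decaying perturbations of them show that the
    constant is sharp ([hardy_sharp]). Completing the square with
    [l = (N - 2 b - 2) / 2] expresses the deficit in the inequality, and this
    deficit controls the norm of [u] for the positive weight
    [r^-(2 b + 2) r / (1 + r)^2] ([test_fun_hardy_ineq]). This survives in the
    completion, where equality thus forces [u = 0] ([hardy_not_achieved]). *)

(** * The gauge of a convex body *)

Lemma measurable_inv {R : realType} : measurable_fun setT (fun x : R => x^-1).
Proof.
rewrite (_ : (fun _ => _) = (fun x : R => x * (x ^+ 2) `^ (-1))); last first.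
  apply/funext => x; rewrite powR_inv1 ?sqr_ge0//.
  have [->|x0] := eqVneq x 0; first by rewrite invr0 mul0r.
  by rewrite expr2 invfM mulrA divff// mul1r.
apply: measurable_funM => //.
apply: (measurableT_comp (f := fun x : R => x `^ (-1))); first exact: measurable_powR.
exact: measurable_funX.
Qed.

Section gauge.
Context {R : realType} {N : nat} (K : set 'rV[R]_N) (hK : Kss_o K).
Implicit Types (x y : 'rV[R]_N) (l t : R).

Lemma body_convex x y t : K x -> K y -> 0 <= t <= 1 ->
  K (t *: x + (1 - t) *: y).
Proof.
case: hK => -[_ vK _] _ _ _ Kx Ky t01.
have /(_ x y (Itv01 (andP t01).1 (andP t01).2)) := vK.
by rewrite !inE => /(_ Kx Ky).
Qed.

Lemma body_closed : closed K.
Proof. by case: hK => -[cK _ _] _ _ _; exact: compact_closed. Qed.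

Lemma body_bounded : exists2 M : R, 0 < M & forall x, K x -> `|x| <= M.
Proof.
case: hK => -[/compact_bounded[M [Mr KM]] _ _] _ _ _.
exists (`|M| + 1); first by rewrite ltr_pwDr.
by apply: KM; rewrite (le_lt_trans (ler_norm M)) ?ltrDl.
Qed.

Lemma body_ball : exists2 e : R, 0 < e & forall x, `|x| < e -> K x.
Proof.
case: hK => _ /nbhs_ballP[e /= e0 eK] _ _; exists e => // x xe.
by apply: eK; rewrite -ball_normE /= sub0r normrN.
Qed.

Lemma body_star x t : K x -> 0 <= t <= 1 -> K (t *: x).
Proof.
move=> Kx t01; have [e e0 eK] := body_ball.
have K0 : K 0 by apply: eK; rewrite normr0.
by have := body_convex Kx K0 t01; rewrite scaler0 addr0.
Qed.

Let G x := [set l : R | 0 <= l /\ exists2 y, K y & x = l *: y].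

Let G_lb x : has_lbound (G x). Proof. by exists 0 => l []. Qed.

Let G_gt0 x l : 0 < l -> G x l <-> K (l^-1 *: x).
Proof.
move=> l0; split=> [[_ [y Ky ->]]|Kx].
  by rewrite scalerA mulVf ?scale1r// gt_eqF.
by split; [exact: ltW|exists (l^-1 *: x) => //; rewrite scalerA divff ?scale1r ?gt_eqF].
Qed.

Let G_neq0 x : G x !=set0.
Proof.
have [e e0 eK] := body_ball.
pose l := (`|x| + 1) / e; have l0 : 0 < l by rewrite divr_gt0// ltr_pwDr.
exists l; apply/G_gt0 => //; apply: eK.
rewrite normrZ gtr0_norm ?invr_gt0// mulrC ltr_pdivrMr//.
by rewrite /l mulrCA divff ?gt_eqF// mulr1 ltrDl.
Qed.

Lemma normK_ge0 x : 0 <= normK K x.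
Proof. by apply: (lb_le_inf (G_neq0 x)) => l []. Qed.

(** The infimum which defines the gauge is attained, [K] being closed and
    star-shaped about the origin. *)
Lemma normK_leP x l : 0 < l -> normK K x <= l <-> K (l^-1 *: x).
Proof.
move=> l0; split=> [xl|/(G_gt0 _ l0) Gl]; last exact: (ge_inf (G_lb x)).
have H l' : l < l' -> K (l'^-1 *: x).
  move=> ll'; have l'0 : 0 < l' by exact: lt_trans ll'.
  have [m [m0 [y Ky xE]] ml'] := inf_adherent (eps := l' - l) (E := G x)
    (ltac:(by rewrite subr_gt0)) (conj (G_neq0 x) (G_lb x)).
  rewrite xE scalerA; apply: body_star => //; apply/andP; split.
    by rewrite mulr_ge0// invr_ge0 ltW.
  rewrite ler_pdivrMl// mulr1 ltW// (lt_le_trans ml')//.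
  have {}xl : inf (G x) <= l := xl; lra.
pose f n := (l + n.+1%:R^-1)^-1 *: x.
have fK : f @ \oo --> l^-1 *: x.
  apply: cvgZr_tmp; apply: cvgV; first by rewrite gt_eqF.
  rewrite -[X in _ --> X]addr0; apply: cvgD; first exact: cvg_cst.
  exact: cvg_harmonic.
apply: (@closed_cvg _ _ _ _ f (fun y => K y) body_closed _ _ fK).
by apply: nearW => n; apply: H; rewrite ltrDl invr_gt0.
Qed.

Lemma normKZ x t : 0 <= t -> normK K (t *: x) = t * normK K x.
Proof.
have H y s : 0 < s -> normK K (s *: y) <= s * normK K y.
  move=> s0; apply/ler_addgt0Pr => e e0.
  have l0 : 0 < normK K y + e / s by rewrite ltr_wpDl ?normK_ge0// divr_gt0.
  have -> : s * normK K y + e = s * (normK K y + e / s).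
    by rewrite mulrDr mulrCA divff ?mulr1// gt_eqF.
  apply/normK_leP; first by rewrite mulr_gt0.
  rewrite scalerA invfM mulrAC mulVf ?gt_eqF// mul1r.
  by apply/normK_leP => //; rewrite lerDl ltW// divr_gt0.
rewrite le_eqVlt => /predU1P[<-|t0].
  rewrite scale0r mul0r; apply/eqP; rewrite eq_le normK_ge0 andbT.
  apply: (ge_inf (G_lb _)); split => //; have [e e0 eK] := body_ball.
  by exists 0; [apply: eK; rewrite normr0|rewrite scaler0].
apply/eqP; rewrite eq_le H//=.
have := H (t *: x) t^-1; rewrite invr_gt0 => /(_ t0).
by rewrite scalerA mulVf ?gt_eqF// scale1r ler_pdivlMl.
Qed.

Lemma normK0 : normK K 0 = 0.
Proof. by rewrite -[0](scale0r 0) normKZ// mul0r. Qed.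

Lemma normK_le_norm : exists2 M : R, 0 < M & forall x, normK K x <= M * `|x|.
Proof.
have [e e0 eK] := body_ball; exists (e / 2)^-1.
  by rewrite invr_gt0 divr_gt0.
move=> x; have [->|x0] := eqVneq x 0; first by rewrite normK0 normr0 mulr0.
have nx : 0 < `|x| by rewrite normr_gt0.
apply/normK_leP; first by rewrite mulr_gt0// invr_gt0 divr_gt0.
apply: eK; rewrite normrZ gtr0_norm ?invr_gt0 ?mulr_gt0 ?invr_gt0 ?divr_gt0//.
rewrite invfM invrK -mulrA mulVf ?gt_eqF// mulr1.
by rewrite ltr_pdivrMr// mulr_natr mulr2n ltrDl.
Qed.

Lemma norm_le_normK : exists2 M : R, 0 < M & forall x, `|x| <= M * normK K x.
Proof.
have [M M0 KM] := body_bounded; exists M => // x.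
apply/ler_addgt0Pr => e e0.
have l0 : 0 < normK K x + e / M by rewrite ltr_wpDl ?normK_ge0// divr_gt0.
have -> : M * normK K x + e = M * (normK K x + e / M).
  by rewrite mulrDr mulrCA divff ?mulr1// gt_eqF.
have /KM : K ((normK K x + e / M)^-1 *: x).
  by apply/normK_leP => //; rewrite lerDl ltW// divr_gt0.
by rewrite normrZ gtr0_norm ?invr_gt0// ler_pdivrMl// mulrC.
Qed.

Lemma normK_gt0 x : x != 0 -> 0 < normK K x.
Proof.
move=> x0; have [M M0 KM] := norm_le_normK.
have := KM x; have : 0 < `|x| by rewrite normr_gt0.
by move=> /lt_le_trans /[apply]; rewrite pmulr_rgt0.
Qed.

Lemma normK_eq0 x : (normK K x == 0) = (x == 0).
Proof.
have [->|x0] := eqVneq x 0; first by rewrite normK0 eqxx.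
by rewrite gt_eqF// normK_gt0.
Qed.

Lemma bdryP x : bdry K x <-> normK K x = 1.
Proof.
have cl := body_closed; rewrite /bdry -[closure _]((closure_id K).1 cl).
have K1 y : K y <-> normK K y <= 1.
  by split=> [Ky|/normK_leP]; [apply/normK_leP|]; rewrite ?invr1 ?scale1r//; exact.
split=> [[Kx iKx]|x1].
- apply/eqP; rewrite eq_le; move/K1 : (Kx) => -> /=; rewrite leNgt.
  apply/negP => x1; apply: iKx.
  pose l := normK K x; have [e e0 eK] := body_ball.
  have l1 : 0 < 1 - l by rewrite subr_gt0.
  apply/nbhs_ballP; exists ((1 - l) * e); first exact: mulr_gt0.
  move=> y; rewrite -ball_normE /= => xy.
  have Kz : K ((1 - l)^-1 *: (y - x)).
    apply: eK; rewrite normrZ gtr0_norm ?invr_gt0// ltr_pdivrMl//.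
    by rewrite distrC.
  have -> : y = x + (1 - l) *: ((1 - l)^-1 *: (y - x)).
    by rewrite scalerA divff ?gt_eqF// scale1r addrC subrK.
  have [x0|x0] := eqVneq x 0.
    by rewrite {1}x0 add0r; apply: body_star => //; rewrite gerBl normK_ge0 ltW.
  have l0 : 0 < l by exact: normK_gt0.
  have {1}-> : x = l *: (l^-1 *: x) by rewrite scalerA divff ?scale1r ?gt_eqF.
  by apply: body_convex => //; [apply/normK_leP|rewrite !ltW].
- split; first by apply/K1; rewrite x1.
  move=> /nbhs_ballP[e /= e0 eK].
  have x0 : x != 0 by rewrite -normK_eq0 x1 oner_neq0.
  have nx : 0 < `|x| by rewrite normr_gt0.
  pose d := e / 2 / `|x|; have d0 : 0 < d by rewrite !divr_gt0.
  have /K1 : K ((1 + d) *: x).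
    apply: eK; rewrite -ball_normE /= scalerDl scale1r opprD addNKr normrN.
    rewrite normrZ gtr0_norm// /d mulfVK ?gt_eqF//.
    by rewrite ltr_pdivrMr// mulr_natr mulr2n ltrDl.
  rewrite normKZ; last by rewrite addr_ge0// ltW.
  by rewrite x1 mulr1 gerDl leNgt d0.
Qed.

Lemma normK_sigmaK x : x != 0 -> normK K (sigmaK K x) = 1.
Proof.
move=> x0; rewrite normKZ ?invr_ge0 ?normK_ge0// mulVf//.
by rewrite normK_eq0.
Qed.

Lemma sigmaKZ x t : 0 < t -> sigmaK K (t *: x) = sigmaK K x.
Proof.
move=> t0; rewrite /sigmaK normKZ ?ltW// scalerA invfM mulrC mulrA divff ?mul1r//.
by rewrite gt_eqF.
Qed.

Lemma sigmaK_bdry x : bdry K x -> sigmaK K x = x.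
Proof. by move=> /bdryP x1; rewrite /sigmaK x1 invr1 scale1r. Qed.

Lemma normK_sigma_decomp x : normK K x *: sigmaK K x = x.
Proof.
have [->|x0] := eqVneq x 0; first by rewrite normK0 scale0r.
by rewrite scalerA divff ?scale1r// normK_eq0.
Qed.

Lemma bdry_neq0 x : bdry K x -> x != 0.
Proof. by move=> /bdryP x1; rewrite -normK_eq0 x1 oner_neq0. Qed.

(** The sublevel sets are dilates of [K], hence closed. *)
Lemma measurable_normK : measurable_fun setT (normK K).
Proof.
apply: (measurability _ (RGenOInfty.measurableE R)) => _ [_ [a ->] <-].
rewrite setTI; have [a0|a0] := ltP a 0.
  rewrite (_ : _ @^-1` _ = setT)//; apply/seteqP; split=> // x _ /=.
  by rewrite in_itv/= andbT (lt_le_trans a0)// normK_ge0.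
rewrite -[X in measurable X]setCK; apply: measurableC.
have [a_eq0|aneq0] := eqVneq a 0.
  rewrite (_ : ~` _ = [set 0]); last first.
    apply/seteqP; split=> x /=; rewrite in_itv/= andbT a_eq0 => H.
      apply/eqP; rewrite -normK_eq0 eq_le normK_ge0 andbT leNgt; exact/negP.
    by rewrite H normK0 ltxx.
  rewrite -[X in measurable X]setCK; apply: measurableC; apply: open_measurable_mx.
  apply: closed_openC; by apply: accessible_closed_set1; exact: hausdorff_accessible.
have {a0 aneq0}a0 : 0 < a by rewrite lt_neqAle eq_sym aneq0.
rewrite (_ : ~` _ = (fun x => a^-1 *: x) @^-1` K); last first.
  apply/seteqP; split=> x /=; rewrite in_itv/= andbT => H.
    by apply/normK_leP => //; rewrite leNgt; exact/negP.
  by apply/negP; rewrite -leNgt; apply/normK_leP.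
rewrite -[X in measurable X]setCK; apply: measurableC; apply: open_measurable_mx.
apply: closed_openC; apply: preimage_closed; last exact: body_closed.
by move=> x _; exact: scaler_continuous.
Qed.

Lemma continuous_measurable_rVR (f : 'rV[R]_N -> R) :
  continuous f -> measurable_fun setT f.
Proof.
move=> cf; apply: (measurability _ (RGenOpens.measurableE R)) => _ [_ [a [b ->]] <-].
rewrite setTI; apply: open_measurable_mx; apply: open_comp => //.
Qed.

Lemma measurable_scale_rV d (T : measurableType d) (f : T -> R)
    (g : T -> 'rV[R]_N) : measurable_fun setT f -> measurable_fun setT g ->
  measurable_fun setT (fun z => f z *: g z).
Proof.
move=> mf mg; apply: measurable_fun_rV => i.
rewrite (_ : (fun _ => _) = (fun z => f z * g z ord0 i)); last first.
  by apply/funext => z; rewrite mxE.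
apply: measurable_funM => //.
by apply: (measurableT_comp (f := fun x : 'rV[R]_N => x ord0 i)) => //; exact: measurable_coord.
Qed.

Lemma measurable_sigmaK : measurable_fun setT (sigmaK K).
Proof.
apply: measurable_scale_rV => //.
apply: (measurableT_comp (f := fun x : R => x^-1)); last exact: measurable_normK.
exact: measurable_inv.
Qed.

End gauge.

(** * Dilations and Lebesgue measure *)

Section lebesgue_scaling.
Context {R : realType}.
Local Open Scope ereal_scope.
Local Notation leb := (@lebesgue_measure R).

Lemma lebesgue_measure_scale (t : R) (t0 : (0 < t)%R) (A : set R) : measurable A ->
  pushforward leb ( *%R t : R -> measurableTypeR R) A = (t^-1)%:E * leb A.
Proof.
move=> mA; have tn0 : t != 0%R by rewrite gt_eqF.
have mt : measurable_fun [set: R] ( *%R t : R -> measurableTypeR R).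
  exact: mulrl_measurable.
pose m1 : {measure set (measurableTypeR R) -> \bar R} :=
  mscale (NngNum (ltW t0)) (pushforward leb ( *%R t : R -> measurableTypeR R)).
suff : leb A = m1 mt A.
  move=> ->; rewrite /mscale /= muleA -EFinM mulVf// mul1e //.
apply: lebesgue_measure_unique => // _ [[a b]] _ <-.
have tab : ( *%R t @^-1` `]a, b] = `](t^-1 * a)%R, (t^-1 * b)%R])%classic.
  apply/seteqP; split => x /=; rewrite !in_itv/= ltr_pdivrMl// ler_pdivlMl//.
rewrite /m1 /mscale /pushforward [X in _ = _ * leb X]tab.
rewrite !lebesgue_measure_itv/= !lte_fin ltr_pM2l ?invr_gt0//.
case: ifPn => // _; last by rewrite mule0.
by rewrite -EFinB -EFinB -EFinM -mulrBr mulrA divff// mul1r.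
Qed.

Lemma ge0_integral_scale (t : R) (f : R -> \bar R) : (0 < t)%R ->
  measurable_fun setT f -> (forall x, 0 <= f x) ->
  \int[leb]_x f (t * x)%R = (t^-1)%:E * \int[leb]_x f x.
Proof.
move=> t0 mf f0; have ti0 : (0 <= t^-1)%R by rewrite invr_ge0 ltW.
have mt : measurable_fun [set: R] ( *%R t : R -> measurableTypeR R).
  exact: mulrl_measurable.
rewrite -(@ge0_integral_mscale _ _ _ leb setT measurableT (NngNum ti0))//.
transitivity (\int[pushforward leb ( *%R t : R -> measurableTypeR R)]_x f x).
  by rewrite ge0_integral_pushforward.
by apply: eq_measure_integral => A mA _; exact: lebesgue_measure_scale.
Qed.

(** Lebesgue measure on [R^n.+1], being an iterated product, integrates one
    coordinate after the others; all its properties below are inductions on the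
    dimension through this formula. *)
Lemma ge0_integral_lebesgue_rVS n (f : 'rV[R]_n.+1 -> \bar R) :
  measurable_fun setT f -> (forall x, 0 <= f x) ->
  \int[lebesgue_rV n.+1]_x f x =
  \int[leb]_t \int[lebesgue_rV n]_v f (consV (t, v)).
Proof.
move=> mf f0.
transitivity (\int[(leb \x lebesgue_rV n)%E]_p f (consV p)).
  have mc : measurable_fun [set: measurableTypeR R * 'rV[R]_n] (@consV R n).
    exact: measurable_consV.
  exact: (ge0_integral_pushforward mc (leb \x lebesgue_rV n)%E measurableT mf (fun x _ => f0 x)).
rewrite fubini_tonelli1//; apply: measurableT_comp => //.
exact: measurable_consV.
Qed.

Lemma measurable_scaleV n (t : R) :
  measurable_fun setT (fun x : 'rV[R]_n => t *: x).
Proof. by apply: measurable_scale_rV. Qed.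

Lemma ge0_integral_scaleV n (t : R) (f : 'rV[R]_n -> \bar R) : (0 < t)%R ->
  measurable_fun setT f -> (forall x, 0 <= f x) ->
  \int[lebesgue_rV n]_x f (t *: x) = (t^-n)%:E * \int[lebesgue_rV n]_x f x.
Proof.
move=> t0; elim: n f => [f mf f0|n IH f mf f0].
  rewrite /= !integral_dirac//; last first.
    by apply: measurableT_comp => //; exact: measurable_scaleV.
  by rewrite diracT !mul1e scaler0 expr0 invr1 mul1e.
have mfc : measurable_fun setT (fun p : R * 'rV[R]_n => f (consV p)).
  by apply: measurableT_comp => //; exact: measurable_consV.
rewrite ge0_integral_lebesgue_rVS//; last first.
  by apply: measurableT_comp => //; exact: measurable_scaleV.
transitivity (\int[leb]_s ((t^-n)%:E * \int[lebesgue_rV n]_v f (consV ((t * s)%R, v)))).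
  apply: eq_integral => s _.
  rewrite -(IH (fun v => f (consV ((t * s)%R, v))))//; last first.
    by apply: (measurableT_comp mfc); exact: measurable_pair1.
  apply: eq_integral => v _; congr f.
  rewrite /consV/=; apply/rowP => i; rewrite mxE -(@splitK 1 n i).
  case: (@fintype.split 1 n i) => j /=.
    by rewrite !(@row_mxEl _ 1 1 n) !mxE (ord1 j) eqxx !mulr1n.
  by rewrite !(@row_mxEr _ 1 1 n) mxE.
pose g s := \int[lebesgue_rV n]_v f (consV (s, v)).
have mg : measurable_fun setT g.
  exact: (measurable_fun_fubini_tonelli_F (fun p => f (consV p))).
have g0 s : 0 <= g s by exact: integral_ge0.
rewrite ge0_integralZl//; last 2 first.
- by move=> s _; exact: (g0 (t * s)%R).
- by rewrite lee_fin invr_ge0 exprn_ge0// ltW.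
- rewrite (ge0_integral_scale t0 mg g0) -ge0_integral_lebesgue_rVS//.
  by rewrite muleA -EFinM exprSr invfM mulrC.
by have : measurable_fun [set: R] (g \o ( *%R t)) by exact: measurableT_comp.
Qed.

Lemma measurable_cube n (M : R) :
  measurable [set x : 'rV[R]_n | forall i, `|x ord0 i| <= M]%R.
Proof.
rewrite (_ : [set _ | _] = \bigcap_(i in [set: 'I_n])
  ((fun x : 'rV[R]_n => x ord0 i) @^-1` `[(- M)%R, M])); last first.
  apply/seteqP; split=> x /= H i.
    by move=> _; rewrite /= in_itv/= -ler_norml.
  by have := H i I; rewrite /= in_itv/= -ler_norml.
apply: fin_bigcap_measurable => // i _; rewrite -[X in measurable X]setTI.
by apply: measurable_coord => //; exact: measurable_itv.
Qed.

Lemma lebesgue_rV_cube n (M : R) :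
  lebesgue_rV n [set x | forall i, `|x ord0 i| <= M]%R < +oo.
Proof.
elim: n => [|n IH].
  by rewrite [lebesgue_rV 0]/= /dirac ltry.
suff -> : lebesgue_rV n.+1 [set x | forall i, `|x ord0 i| <= M]%R =
  (leb \x lebesgue_rV n)%E (`[(- M)%R, M]%classic `*`
     [set x : 'rV[R]_n | forall i, `|x ord0 i| <= M]%R).
  rewrite (product_measure1E leb (lebesgue_rV n) (measurable_itv _) (@measurable_cube n M)).
  apply: lte_mul_pinfty => //; rewrite ge0_fin_numE//= lebesgue_measure_itv/=.
  by case: ifPn => // _; rewrite -EFinB ltry.
rewrite [LHS]/= /lebesgue_step /pushforward; congr ((_ \x _)%E _).
apply/seteqP; split=> -[t v] /=.
    move=> H; split.
      have := H (lshift n (ord0 : 'I_1)).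
      by rewrite /consV (@row_mxEl _ 1 1 n) mxE eqxx mulr1n/= in_itv/= ler_norml.
    move=> i; have := H (rshift 1 i).
    by rewrite /consV (@row_mxEr _ 1 1 n).
  move=> [tM vM] i; rewrite -(@splitK 1 n i).
  case: (@fintype.split 1 n i) => j /=.
    by rewrite /consV (@row_mxEl _ 1 1 n) mxE (ord1 j) eqxx mulr1n ler_norml.
  by rewrite /consV (@row_mxEr _ 1 1 n).
Qed.

Lemma lebesgue_rVT_gt0 n : 0 < lebesgue_rV n [set: 'rV[R]_n].
Proof.
elim: n => [|n IH]; first by rewrite /= diracT lte_fin.
suff -> : lebesgue_rV n.+1 [set: 'rV[R]_n.+1] =
    (leb \x lebesgue_rV n)%E (setT `*` setT).
  have lebT : 0 < leb [set: R] by rewrite -set_itvNyy lebesgue_measure_itv/= ltry.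
  by rewrite product_measure1E//; exact: mule_gt0.
by rewrite [LHS]/= /lebesgue_step /pushforward setXTT preimage_setT.
Qed.

End lebesgue_scaling.

(** * Iterated integrals *)

Lemma norm_coord_le (R : realType) n (x : 'rV[R]_n) (i : 'I_n) :
  `|x ord0 i| <= `|x|.
Proof.
rewrite [leRHS]mx_normrE.
exact: (@le_bigmax _ _ _ 0 (fun ij : 'I_1 * 'I_n => `|x ij.1 ij.2|) (ord0, i)).
Qed.

Section integral_tools.
Local Open Scope ereal_scope.

Lemma ge0_integral_mrestr d (T : measurableType d) (R : realType)
    (m : {measure set T -> \bar R}) (D : set T) (mD : measurable D)
    (f : T -> \bar R) :
  measurable_fun setT f -> (forall x, 0 <= f x) ->
  \int[mrestr m mD]_x f x = \int[m]_(x in D) f x.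
Proof.
move=> mf f0.
rewrite (@ge0_negligible_integral _ _ _ (mrestr m mD) setT (~` D))//; last 2 first.
- exact: measurableC.
- by change (m (~` D `&` D) = 0); rewrite setICl measure0.
rewrite setTD setCK; apply: eq_measure_integral => A mA AD.
by change (m (A `&` D) = m A); rewrite setIidl.
Qed.

Lemma ge0_integral_if d (T : measurableType d) (R : realType)
    (m : {measure set T -> \bar R}) (b : bool) (f : T -> \bar R) :
  \int[m]_x (if b then f x else 0) = if b then \int[m]_x f x else 0.
Proof. by case: b => //; rewrite integral0. Qed.

Lemma fubini_tonelli_in d1 d2 (T1 : measurableType d1) (T2 : measurableType d2)
    (R : realType) (m1 : {sigma_finite_measure set T1 -> \bar R})
    (m2 : {sigma_finite_measure set T2 -> \bar R})
    (A : set T1) (B : set T2) (f : T1 -> T2 -> \bar R) :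
  measurable A -> measurable B -> measurable_fun setT (fun p => f p.1 p.2) ->
  (forall x y, 0 <= f x y) ->
  \int[m1]_(x in A) \int[m2]_(y in B) f x y =
  \int[m2]_(y in B) \int[m1]_(x in A) f x y.
Proof.
move=> mA mB mf f0.
pose g (p : T1 * T2) := f p.1 p.2 * (\1_A p.1 * \1_B p.2)%:E.
have mg : measurable_fun setT g.
  apply: emeasurable_funM => //; apply/measurable_EFinP; apply: measurable_funM.
    by apply: (measurableT_comp (f := \1_A : T1 -> R)); [exact: measurable_indic|exact: measurable_fst].
  by apply: (measurableT_comp (f := \1_B : T2 -> R)); [exact: measurable_indic|exact: measurable_snd].
have g0 p : 0 <= g p by rewrite mule_ge0// lee_fin mulr_ge0.
transitivity (\int[m1]_x \int[m2]_y g (x, y)).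
  rewrite integral_mkcond; apply: eq_integral => x _; rewrite patchE.
  rewrite /g/= indicE; case: ifPn => xA; last first.
    by rewrite integral0_eq// => y _; rewrite mul0r mule0.
  rewrite integral_mkcond; apply: eq_integral => y _; rewrite patchE indicE mul1r.
  by case: ifPn; rewrite ?mule1 ?mule0.
rewrite fubini_tonelli//.
rewrite [RHS]integral_mkcond; apply: eq_integral => y _; rewrite patchE.
rewrite /g/= (indicE _ B y); case: ifPn => yB; last first.
  by rewrite integral0_eq// => x _; rewrite mulr0 mule0.
rewrite [RHS]integral_mkcond; apply: eq_integral => x _; rewrite patchE indicE mulr1.
by case: ifPn; rewrite ?mule1 ?mule0.
Qed.

Lemma tonelli_rV_R (R : realType) n (J : 'rV[R]_n * R -> \bar R) :
  measurable_fun setT J -> (forall p, 0 <= J p) ->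
  measurable_fun setT (fun x => \int[lebesgue_measure]_t J (x, t)) /\
  \int[lebesgue_rV n]_x \int[lebesgue_measure]_t J (x, t) =
  \int[lebesgue_measure]_t \int[lebesgue_rV n]_x J (x, t).
Proof.
move=> mJ J0; split.
  exact: (@measurable_fun_fubini_tonelli_F _ _ 'rV[R]_n (measurableTypeR R) R
    lebesgue_measure J mJ J0).
exact: (@fubini_tonelli _ _ 'rV[R]_n (measurableTypeR R) R
    (lebesgue_rV n) lebesgue_measure J mJ J0).
Qed.

End integral_tools.

(** * Polar coordinates *)

Section polar.
Context {R : realType} {N : nat} (K : set 'rV[R]_N) (hK : Kss_o K).
Hypothesis hN : (2 <= N)%N.
Local Open Scope ereal_scope.
Local Notation leb := (@lebesgue_measure R).
Local Notation lebN := (@lebesgue_rV R N).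
Local Notation mnormK := (measurable_normK hK).

Lemma measurable_normK_le (M : R) : measurable [set x | normK K x <= M]%R.
Proof.
rewrite (_ : [set _ | _] = normK K @^-1` `]-oo, M]%classic).
  by rewrite -[X in measurable X]setTI; apply: mnormK => //; exact: measurable_itv.
by apply/seteqP; split => x /=; rewrite in_itv.
Qed.

Lemma measurable_normK_lt (M : R) : measurable [set x | normK K x < M]%R.
Proof.
rewrite (_ : [set _ | _] = normK K @^-1` `]-oo, M[%classic).
  by rewrite -[X in measurable X]setTI; apply: mnormK => //; exact: measurable_itv.
by apply/seteqP; split => x /=; rewrite in_itv.
Qed.

Lemma measurable_bdry : measurable (bdry K).
Proof.
rewrite (_ : bdry K = normK K @^-1` [set 1%R]).
  by rewrite -[X in measurable X]setTI; exact: mnormK.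
by apply/seteqP; split => x /=; [move/(bdryP hK)|move=> ?; apply/(bdryP hK)].
Qed.

Lemma measurable_origin : measurable [set (0%R : 'rV[R]_N)].
Proof.
rewrite (_ : [set (0%R : 'rV[R]_N)] = normK K @^-1` [set 0%R]).
  by rewrite -[X in measurable X]setTI; exact: mnormK.
apply/seteqP; split => x /=; first by move=> ->; rewrite normK0.
by move/eqP; rewrite normK_eq0// => /eqP.
Qed.

Lemma lebesgue_normK_le (M : R) : lebN [set x | normK K x <= M]%R < +oo.
Proof.
have [C C0 CK] := norm_le_normK hK.
apply: le_lt_trans (lebesgue_rV_cube N (C * M)).
apply: le_measure; rewrite ?inE.
- exact: measurable_normK_le.
- exact: measurable_cube.
- move=> x /= xM i.
  rewrite (@le_trans _ _ `|x|%R)//.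
    exact: norm_coord_le.
  by rewrite (le_trans (CK x))// ler_pM2l.
Qed.

(** The dilation of ratio [1 / 2] fixes the origin and divides finite volumes by
    [2 ^ N]. *)
Lemma lebesgue_origin : lebN [set (0%R : 'rV[R]_N)] = 0.
Proof.
have fin : lebN [set (0%R : 'rV[R]_N)] \is a fin_num.
  rewrite ge0_fin_numE//; apply: le_lt_trans (lebesgue_normK_le 0).
  apply: le_measure; rewrite ?inE.
  - exact: measurable_origin.
  - exact: measurable_normK_le.
  - by move=> x /= ->; rewrite normK0.
have int_origin : \int[lebN]_x (\1_[set (0%R : 'rV[R]_N)] x)%:E = lebN [set (0%R : 'rV[R]_N)].
  by rewrite integral_indic ?setIT//; exact: measurable_origin.
have := @ge0_integral_scaleV R N 2 (fun x => (\1_[set (0%R : 'rV[R]_N)] x)%:E) (ltr0n _ 2).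
rewrite int_origin.
under eq_integral.
  move=> x _; rewrite (_ : \1_[set (0%R : 'rV[R]_N)] (2 *: x)%R = \1_[set (0%R : 'rV[R]_N)] x); last first.
    rewrite !indicE; congr ((nat_of_bool _)%:R); apply/idP/idP; rewrite !inE /=.
      by move=> /eqP; rewrite scaler_eq0 pnatr_eq0/= => /eqP.
    by move=> ->; rewrite scaler0.
  over.
rewrite int_origin.
move=> H; move: fin H; case: (lebN [set (0%R : 'rV[R]_N)]) => //= r _ H.
have {H}: r%:E = (2 ^- N)%:E * r%:E.
  apply: H; last by move=> x; rewrite lee_fin.
  by apply/measurable_EFinP; apply: measurable_indic; exact: measurable_origin.
rewrite -EFinM => -[] H; congr EFin.
have : ((1 - 2 ^- N) * r = 0 :> R)%R by rewrite mulrBl mul1r -H subrr.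
move/eqP; rewrite mulf_eq0 subr_eq0 => /orP[/eqP E|/eqP //].
have : (1 < 2 ^+ N :> R)%R by rewrite exprn_egt1 ?ltr1n// -lt0n (leq_trans _ hN).
by rewrite -invf_lt1 ?exprn_gt0// -E ltxx.
Qed.

Let r (x : 'rV[R]_N) : R := normK K x.
(** A probability density in [t] for every [x]. Once it is inserted into the
    integral of [u], the substitutions [x = t y] and [t -> t / r y] turn this
    integral into one over the body of a function of [sigmaK K y] and [t]. *)
Let k (x : 'rV[R]_N) (t : R) : R :=
  if (r x < t)%R then (N%:R * r x ^+ N * t^-1 ^+ N.+1)%R else 0%R.

Let k_ge0 x t : (0 <= k x t)%R.
Proof.
rewrite /k; case: ifPn => // rt; rewrite !mulr_ge0 ?exprn_ge0 ?normK_ge0//.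
by rewrite invr_ge0 (le_trans (normK_ge0 hK x))// ltW.
Qed.

Let mk : measurable_fun setT (fun p : 'rV[R]_N * R => k p.1 p.2).
Proof.
have mr : measurable_fun setT (fun p : 'rV[R]_N * R => r p.1).
  by apply: (measurableT_comp (f := r)); [exact: mnormK|exact: measurable_fst].
apply: measurable_fun_ifT => //.
  by apply: measurable_fun_ltr => //; exact: measurable_snd.
apply: measurable_funM.
  by apply: measurable_funM => //; exact: measurable_funX.
apply: measurable_funX; apply: measurableT_comp; first exact: measurable_inv.
exact: measurable_snd.
Qed.

Let cvg_inv_y : (t : R)^-1%R @[t --> +oo%R] --> (0 : R)%R.
Proof.
apply/gtr0_cvgV0; first by near=> x; near: x; exact: nbhs_pinfty_gt.
exact: cvg_id.
Unshelve. all: by end_near. Qed.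

Let k_total x : x != 0%R -> \int[leb]_t (k x t)%:E = 1.
Proof.
move=> x0; have r0 : (0 < r x)%R by exact: normK_gt0.
pose f (t : R) : R := (N%:R * r x ^+ N * t^-1 ^+ N.+1)%R.
pose F (t : R) : R := (- r x ^+ N * t^-1 ^+ N)%R.
have df (t : R) : (0 < t)%R -> is_derive t (1%R : R) F (f t).
  move=> t0; have tn0 : t != 0%R by rewrite gt_eqF.
  have dV : is_derive t (1%R : R) (fun s : R => s^-1%R) (- (t ^- 2))%R.
    by apply: is_derive_eq; first exact: is_deriveV; rewrite /GRing.scale/= mulr1.
  have -> : F = (- r x ^+ N)%R \*: ((fun s : R => s^-1%R) ^+ N)%R.
    by apply/funext => s; rewrite /F /= fctE.
  apply: is_derive_eq; rewrite /f /GRing.scale/=.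
  by case: N hN => // n _ /=; rewrite -exprVn !exprS; ring.
transitivity (\int[leb]_(t in `](r x), +oo[) (f t)%:E).
  rewrite [RHS]integral_mkcond; apply: eq_integral => t _.
  by rewrite patchE mem_setE in_itv/= andbT /k; case: ifP.
have cf t : (0 < t)%R -> {for t, continuous f}.
  move=> t0; apply: cvgM; first exact: cvg_cst.
  apply: (@continuous_comp _ _ _ (fun t : R => t^-1%R) (fun t => t ^+ N.+1)%R).
    by apply: inv_continuous; rewrite gt_eqF.
  exact: exprn_continuous.
rewrite integral_itv_obnd_cbnd; last first.
  apply/measurable_EFinP; apply: open_continuous_measurable_fun.
    exact: interval_open.
  move=> t; rewrite inE/= in_itv/= andbT => rt; apply: cf; exact: lt_trans rt.
rewrite (@ge0_continuous_FTC2y _ f F (r x) 0%R).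
- rewrite sub0e /F mulNr -EFinN opprK -exprMn divff ?expr1n//.
  by rewrite gt_eqF.
- move=> t rt; rewrite !mulr_ge0 ?exprn_ge0 ?invr_ge0//.
  + exact: normK_ge0.
  + by rewrite (le_trans _ rt)// ltW.
- apply: continuous_in_subspaceT => t; rewrite inE/= in_itv/= andbT => rt.
  by apply: cf; exact: lt_le_trans rt.
- rewrite -(mulr0 (- r x ^+ N)%R); apply: cvgM; first exact: cvg_cst.
  have zN : (0 ^+ N = 0 :> R)%R by rewrite expr0n gtn_eqF// (leq_trans _ hN).
  rewrite -[X in _ --> X]zN.
  apply: (@cvg_comp _ _ _ (fun t : R => t^-1%R) (fun t => t ^+ N)%R _ _ _ cvg_inv_y).
  exact: exprn_continuous.
- by move=> t rt; apply: ex_derive; apply: df; exact: lt_trans rt.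
- apply: cvg_at_right_filter; have := df _ r0.
  by move=> /@ex_derive /derivable1_diffP /differentiable_continuous.
- move=> t; rewrite in_itv/= andbT => rt.
  by rewrite derive1E; apply: derive_val; apply: df; exact: lt_trans rt.
Qed.

Let D : set 'rV[R]_N := [set y | r y < 1]%R.
Let mD : measurable D.
Proof. exact: measurable_normK_lt. Qed.

Let cone_measure0 : {measure set 'rV[R]_N -> \bar R}.
Proof.
pose m1 : {measure set 'rV[R]_N -> \bar R} :=
  mscale (NngNum (ler0n R N)) (pushforward (mrestr lebN mD) (sigmaK K)).
exact: (m1 (measurable_sigmaK hK)).
Defined.

Definition cone_measure : set 'rV[R]_N -> \bar R := cone_measure0.

HB.instance Definition _ := isMeasure.Build _ _ _ cone_measure
  (measure0 cone_measure0) (measure_ge0 cone_measure0)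
  (@measure_semi_sigma_additive _ _ _ cone_measure0).

Let cone_measureE A : cone_measure A = N%:R%:E * lebN (sigmaK K @^-1` A `&` D).
Proof. by []. Qed.

Let cone_measure_fin : fin_num_fun cone_measure.
Proof.
move=> A mA; rewrite cone_measureE fin_numM// ge0_fin_numE//.
apply: le_lt_trans (lebesgue_normK_le 1); apply: le_measure; rewrite ?inE.
- apply: measurableI => //; rewrite -[X in measurable X]setTI.
  by apply: (measurable_sigmaK hK).
- exact: measurable_normK_le.
- by move=> x [_ /= /ltW].
Qed.

HB.instance Definition _ :=
  Measure_isFinite.Build _ _ _ cone_measure cone_measure_fin.

(** The measure of a set of directions is [N] times the volume of the part of
    the body seen in these directions, as forced by the polar formula for
    indicators of cones. *)
Lemma cone_measure_exists : exists mu : {finite_measure set 'rV[R]_N -> \bar R},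
  mu (~` bdry K) = 0 /\
  forall h : 'rV[R]_N -> \bar R, measurable_fun setT h -> (forall x, 0 <= h x) ->
    \int[mu]_(s in bdry K) h s = N%:R%:E * \int[lebN]_(y in D) h (sigmaK K y).
Proof.
have msig := measurable_sigmaK hK.
pose mu : {finite_measure set 'rV[R]_N -> \bar R} := cone_measure.
have mu0 : mu (~` bdry K) = 0.
  rewrite [LHS]cone_measureE (_ : lebN _ = 0) ?mule0//.
  apply/eqP; rewrite eq_le measure_ge0 andbT -lebesgue_origin.
  apply: le_measure; rewrite ?inE.
  - apply: measurableI => //; rewrite -[X in measurable X]setTI.
    by apply: msig => //; apply: measurableC; exact: measurable_bdry.
  - exact: measurable_origin.
  - move=> x [/= + _]; apply: contra_notP => /eqP x0; apply/(bdryP hK).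
    exact: normK_sigmaK.
exists mu; split => // h mh h0.
transitivity (\int[mu]_s h s).
  rewrite [RHS](@ge0_negligible_integral _ _ _ mu setT (~` bdry K))//.
    by rewrite setTD setCK.
  by apply: measurableC; exact: measurable_bdry.
rewrite ge0_integral_mscale//; congr (_ * _).
rewrite ge0_integral_pushforward// preimage_setT ge0_integral_mrestr//.
  exact: measurableT_comp.
by move=> y; exact: h0.
Qed.

Lemma polar_measure_exists :
  exists mu : {finite_measure set 'rV[R]_N -> \bar R}, polar_measure K mu.
Proof.
have [mu [mu0 muE]] := cone_measure_exists; exists mu; split => // u mu_ u0.
have hN0 : (0 < N)%N by rewrite (leq_trans _ hN).
have msig := measurable_sigmaK hK.
have mfst : measurable_fun setT (fun p : 'rV[R]_N * R => p.1) by exact: measurable_fst.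
have msnd : measurable_fun setT (fun p : 'rV[R]_N * R => p.2) by exact: measurable_snd.
have mr : measurable_fun setT (fun p : 'rV[R]_N * R => r p.1).
  by apply: (measurableT_comp (f := r)); [exact: mnormK|].
pose J (p : 'rV[R]_N * R) := u p.1 * (k p.1 p.2)%:E.
have mJ : measurable_fun setT J.
  apply: emeasurable_funM; last exact/measurable_EFinP.
  exact: measurableT_comp.
have J0 p : 0 <= J p by rewrite mule_ge0// lee_fin.
pose J2 (p : 'rV[R]_N * R) := if (0 < p.2)%R then
  (if (r p.1 < 1)%R then u (p.2 *: p.1)%R * (N%:R * r p.1 ^+ N * p.2 ^+ N.-1)%:E else 0)
  else 0.
have mJ2 : measurable_fun setT J2.
  apply: measurable_fun_ifT => //; first exact: measurable_fun_ltr.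
  apply: measurable_fun_ifT => //; first exact: measurable_fun_ltr.
  apply: emeasurable_funM.
    by apply: (measurableT_comp mu_); exact: measurable_scale_rV.
  apply/measurable_EFinP; apply: measurable_funM; last exact: measurable_funX.
  by apply: measurable_funM => //; exact: measurable_funX.
have J20 p : 0 <= J2 p.
  rewrite /J2; case: ifPn => // p0; case: ifPn => // _.
  by rewrite mule_ge0// lee_fin !mulr_ge0// ?exprn_ge0 ?normK_ge0// ltW.
pose J3 (p : 'rV[R]_N * R) := if (0 < p.2)%R then
  (if (r p.1 < 1)%R then u (p.2 *: sigmaK K p.1)%R * (N%:R * p.2 ^+ N.-1)%:E else 0)
  else 0.
have mJ3 : measurable_fun setT J3.
  apply: measurable_fun_ifT => //; first exact: measurable_fun_ltr.
  apply: measurable_fun_ifT => //; first exact: measurable_fun_ltr.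
  apply: emeasurable_funM.
    apply: (measurableT_comp mu_); apply: measurable_scale_rV => //.
    exact: (measurableT_comp msig).
  by apply/measurable_EFinP; apply: measurable_funM => //; exact: measurable_funX.
have J30 p : 0 <= J3 p.
  rewrite /J3; case: ifPn => // p0; case: ifPn => // _.
  by rewrite mule_ge0// lee_fin !mulr_ge0// ?exprn_ge0 ?normK_ge0// ltW.
have off0 (f g : 'rV[R]_N -> \bar R) : measurable_fun setT f -> measurable_fun setT g ->
    (forall x, 0 <= f x) -> (forall x, 0 <= g x) ->
    (forall x, x != 0%R -> f x = g x) -> \int[lebN]_x f x = \int[lebN]_x g x.
  move=> mf mg f0 g0 fg.
  rewrite (@ge0_negligible_integral _ _ _ lebN setT [set (0%R : 'rV[R]_N)])//; last 2 first.
  - exact: measurable_origin.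
  - exact: lebesgue_origin.
  rewrite [RHS](@ge0_negligible_integral _ _ _ lebN setT [set (0%R : 'rV[R]_N)])//; last 2 first.
  - exact: measurable_origin.
  - exact: lebesgue_origin.
  by apply: eq_integral => x; rewrite inE => -[_ /= /eqP]; exact: fg.
transitivity (\int[lebN]_x \int[leb]_t J (x, t)).
  apply: off0 => //.
  - exact: (tonelli_rV_R mJ J0).1.
  - by move=> x; apply: integral_ge0 => t _.
  move=> x x0; have mkx : measurable_fun [set: R] (fun t => (k x t)%:E).
    apply/measurable_EFinP.
    have : measurable_fun [set: R] ((fun p : 'rV[R]_N * R => k p.1 p.2) \o (pair x)).
      by apply: measurableT_comp => //; exact: measurable_pair1.
    by [].
  rewrite /J/= ge0_integralZl//; first by rewrite k_total// mule1.
  by move=> t _; rewrite lee_fin.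
rewrite (tonelli_rV_R mJ J0).2.
transitivity (\int[leb]_t \int[lebN]_y J2 (y, t)).
  apply: eq_integral => t _; have [t0|t0] := leP t 0%R.
    rewrite !integral0_eq// => y _; first by rewrite /J2/= ltNge t0.
    by rewrite /J/= /k ltNge (le_trans t0) ?normK_ge0//= mule0.
  have mJt : measurable_fun setT (fun x => J (x, t)).
    by apply: (measurableT_comp mJ); exact: measurable_pair2.
  have -> : \int[lebN]_x J (x, t) = (t ^+ N)%:E * \int[lebN]_y J (t *: y, t)%R.
    rewrite (ge0_integral_scaleV t0 mJt)// muleA -EFinM divff ?mul1e//.
    by rewrite expf_neq0// gt_eqF.
  rewrite -ge0_integralZl//; last 2 first.
  - by apply: (measurableT_comp mJt); exact: measurable_scaleV.
  - by rewrite lee_fin exprn_ge0// ltW.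
  apply: eq_integral => y _; rewrite /J2 /J/= t0 /k /r normKZ ?ltW//.
  rewrite -[X in (_ < X)%R](mulr1 t) ltr_pM2l//; case: ifPn => // _; last by rewrite !mule0.
  rewrite muleCA -EFinM; congr (_ * _%:E).
  rewrite exprMn; move: (normK K y) => ry; case: N hN0 => // n _ /=.
  rewrite !exprS exprVn; field.
  by rewrite expf_neq0 gt_eqF.
rewrite -(tonelli_rV_R mJ2 J20).2.
transitivity (\int[lebN]_y \int[leb]_s J3 (y, s)).
  apply: off0 => //.
  - exact: (tonelli_rV_R mJ2 J20).1.
  - exact: (tonelli_rV_R mJ3 J30).1.
  - by move=> x; apply: integral_ge0 => t _.
  - by move=> x; apply: integral_ge0 => t _.
  move=> y y0; have r0 : (0 < r y)%R by exact: normK_gt0.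
  have mJy : measurable_fun setT (fun s => J3 (y, s)).
    by apply: (measurableT_comp mJ3); exact: measurable_pair1.
  have -> : \int[leb]_s J3 (y, s) = (r y)%:E * \int[leb]_s J3 (y, r y * s)%R.
    by rewrite (ge0_integral_scale r0 mJy)// muleA -EFinM divff ?mul1e// gt_eqF.
  rewrite -ge0_integralZl//; last 2 first.
  - have : measurable_fun [set: R] ((fun s => J3 (y, s)) \o ( *%R (r y))).
      exact: measurableT_comp.
    by [].
  - by rewrite lee_fin ltW.
  apply: eq_integral => s _; rewrite /J2 /J3/= pmulr_rgt0//.
  case: ifPn => s0; last by rewrite mule0.
  case: ifPn => _; last by rewrite mule0.
  rewrite muleCA -EFinM [(_ * s)%R]mulrC -scalerA normK_sigma_decomp//.
  congr (_ * _%:E); rewrite exprMn; move: (r y) => ry; case: N hN0 => // n _ /=.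
  by rewrite exprS; ring.
rewrite (tonelli_rV_R mJ3 J30).2.
rewrite [RHS]integral_mkcond; apply: eq_integral => s _; rewrite patchE.
rewrite mem_setE in_itv/= andbT /J3/= ge0_integral_if.
rewrite le_eqVlt eq_sym; have [->/=|s0] := eqVneq s 0%R.
  rewrite ltxx integral0_eq// => x _.
  by rewrite expr0n -subn1 subn_eq0 leqNgt hN mule0.
case: ifPn => //= {}s0.
rewrite muE; last 2 first.
- apply: emeasurable_funM => //; apply: (measurableT_comp mu_).
  exact: measurable_scaleV.
- by move=> x; rewrite mule_ge0// lee_fin exprn_ge0// ltW.
rewrite [in RHS]integral_mkcond -ge0_integralZl//.
- apply: eq_integral => y _; rewrite patchE (_ : (y \in D) = (r y < 1)%R); last first.
    by apply/idP/idP; rewrite inE.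
  by case: ifPn => _; rewrite ?mule0// muleCA -EFinM.
- apply/(measurable_restrictT _ mD); apply: measurable_funTS.
  apply: emeasurable_funM => //; apply: (measurableT_comp mu_).
  exact: measurable_scale_rV.
- move=> y _; rewrite patchE; case: ifPn => // _.
  by rewrite mule_ge0// lee_fin exprn_ge0// ltW.
Qed.

(** Tonelli's theorem applied to the polar formula, so that the rays can be
    treated one by one. *)
Lemma polar_measure_rays (mu : {finite_measure set 'rV[R]_N -> \bar R}) :
  polar_measure K mu -> forall u : 'rV[R]_N -> \bar R,
  measurable_fun setT u -> (forall x, 0 <= u x) ->
  \int[lebN]_x u x =
  \int[mu]_(s in bdry K) \int[leb]_(t in `[0%R, +oo[)
    (u (t *: s)%R * (t ^+ N.-1)%:E).
Proof.
move=> [_ muE] u mu_ u0; rewrite muE//.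
rewrite integral_mkcond [in RHS]integral_mkcond.
pose I : set R := `[0%R, +oo[%classic.
pose f (t : R) (s : 'rV[R]_N) := u (t *: s)%R * (Num.max t 0 ^+ N.-1)%:E.
transitivity (\int[leb]_(t in I) \int[mu]_(s in bdry K) f t s).
  rewrite [RHS]integral_mkcond; apply: eq_integral => t _; rewrite !patchE.
  case: ifPn => //; rewrite inE /I/= in_itv/= andbT => t0.
  by apply: eq_integral => s _; rewrite /f max_l.
rewrite fubini_tonelli_in//.
- rewrite [LHS]integral_mkcond; apply: eq_integral => s _; rewrite !patchE.
  case: ifPn => // _; apply: eq_integral => t.
  by rewrite inE /I/= in_itv/= andbT => t0; rewrite /f max_l.
- exact: measurable_itv.
- exact: measurable_bdry.
- rewrite /f; apply: emeasurable_funM.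
    apply: (measurableT_comp mu_); apply: measurable_scale_rV.
      exact: measurable_fst.
    exact: measurable_snd.
  apply/measurable_EFinP; apply: measurable_funX.
  by apply: measurable_maxr => //; exact: measurable_fst.
- by move=> t s; rewrite /f mule_ge0// lee_fin exprn_ge0// le_max lexx orbT.
Qed.

End polar.

(** * Directional derivatives *)

Section directional.
Context {R : realType} {N : nat}.
Implicit Types (u v : 'rV[R]_N -> R) (x y e : 'rV[R]_N).

Lemma is_derive_line u y e (s d : R) :
  is_derive (y + s *: e) e u d <->
  is_derive s (1 : R) (fun t : R => u (y + t *: e)) d.
Proof.
have E : (fun h : R => h^-1 *: ((u \o shift (y + s *: e)) (h *: e) - u (y + s *: e))) =
   (fun h : R => h^-1 *: (((fun t : R => u (y + t *: e)) \o shift s) (h *: (1 : R)) -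
      u (y + s *: e))).
  apply/funext => h /=; congr (_ *: (u _ - _)).
  by rewrite [h *: 1]mulr1 scalerDl addrCA.
split=> -[d1 d2].
- by apply: DeriveDef; [rewrite /derivable -E|rewrite /derive -E].
- by apply: DeriveDef; [rewrite /derivable E|rewrite /derive E].
Qed.

Lemma is_derive_line0 u x e (d : R) :
  is_derive x e u d <-> is_derive (0 : R) (1 : R) (fun t : R => u (x + t *: e)) d.
Proof. by rewrite -is_derive_line scale0r addr0. Qed.

Lemma is_derive_comp1 (f : R -> R) u x e (d' d : R) :
  is_derive (u x) (1 : R) f d' -> is_derive x e u d ->
  is_derive x e (f \o u) (d' * d).
Proof.
move=> df /is_derive_line0 du; apply/is_derive_line0.
apply: (@is_derive1_comp R f (fun t => u (x + t *: e))) => //.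
by rewrite scale0r addr0.
Qed.

Lemma MVT_bound (f f' : R -> R) (L eps eta s : R) :
  (forall t, is_derive t (1 : R) f (f' t)) ->
  (forall t, `|t| <= eta -> `|f' t - L| <= eps) -> `|s| <= eta ->
  `|f s - f 0 - s * L| <= eps * `|s|.
Proof.
move=> df f'L seta.
have cf (a b : R) : {within `[a, b], continuous f}.
  apply: continuous_subspaceT => t.
  by apply: differentiable_continuous; apply/derivable1_diffP; exact: ex_derive.
have [s0|s0] := leP 0 s.
  have [c /[!in_itv]/= /andP[c0 cs] E] := @MVT_segment R f f' 0 s s0 (fun t _ => df t) (cf 0 s).
  rewrite E subr0 mulrC -mulrBr normrM mulrC ler_wpM2r//.
  by apply: f'L; rewrite (le_trans _ seta)// !ger0_norm.
have [c /[!in_itv]/= /andP[cs c0] E] := @MVT_segment R f f' s 0 (ltW s0) (fun t _ => df t) (cf s 0).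
have -> : f s - f 0 - s * L = s * (f' c - L).
  have -> : f s - f 0 = - (f 0 - f s) by rewrite opprB.
  by rewrite E; ring.
rewrite normrM mulrC ler_wpM2r//; apply: f'L; rewrite (le_trans _ seta)//.
by rewrite !ler0_norm ?lerN2// ltW.
Qed.

(** A function with continuous partial derivatives has all directional
    derivatives: the coordinates are changed one after the other, and the mean
    value theorem bounds the error made at each step. *)
Lemma derive_sum_partial u x e :
  (forall i y, derivable u y (delta_mx ord0 i)) ->
  (forall i, {for x, continuous (partial i u)}) ->
  is_derive x e u (dotv (gradient u x) e).
Proof.
move=> du cu.
pose tr m : 'rV[R]_N := \row_i (if (i < m)%N then e ord0 i else 0).
pose L m := \sum_(i < N | (i < m)%N) partial i u x * e ord0 i.
suff H m : (m <= N)%N -> forall eps : R, 0 < eps -> \forall h \near (0 : R),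
    `|u (x + h *: tr m) - u x - h * L m| <= eps * `|h|.
  have trN : tr N = e by apply/rowP => i; rewrite mxE ltn_ord.
  have LN : L N = dotv (gradient u x) e.
    by rewrite /dotv; apply: eq_big => i; rewrite ?ltn_ord// mxE.
  have lim : (fun h : R => h^-1 *: ((u \o shift x) (h *: e) - u x)) @ 0^' -->
      (dotv (gradient u x) e).
    apply/cvgrPdist_le => eps eps0.
    have := H N (leqnn N) eps eps0; rewrite trN LN => {}H.
    near=> h; have h0 : h != 0 by near: h; exact: nbhs_dnbhs_neq.
    have hn0 : 0 < `|h| by rewrite normr_gt0.
    rewrite distrC -(ler_pM2r hn0) -normrM.
    rewrite mulrBl [h^-1 *: _]mulrC -mulrA mulVf// mulr1 /= [h *: e + x]addrC.
    rewrite [_ * h]mulrC; near: h.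
    exact: nbhs_dnbhs.
  by apply: DeriveDef; [apply/cvg_ex; eexists; exact: lim|exact: cvg_lim].
elim: m => [_ eps eps0|m IH mN eps eps0].
  near=> h; have -> : tr 0%N = 0 by apply/rowP => i; rewrite !mxE.
  rewrite /L big_pred0//.
  by rewrite scaler0 addr0 subrr mulr0 subr0 normr0 mulr_ge0// ltW.
pose i0 := Ordinal mN; pose a := e ord0 i0.
have trS : tr m.+1 = tr m + a *: delta_mx ord0 i0.
  apply/rowP => i; rewrite !mxE eqxx/= ltnS leq_eqVlt -val_eqE/=.
  case: (eqVneq (i : nat) m) => [im|_]; last by rewrite mulr0 addr0.
  by rewrite im ltnn/= mulr1 add0r /a; congr (e _ _); exact/val_inj.
have LS : L m.+1 = L m + partial i0 u x * a.
  rewrite /L (bigD1 i0)//= addrC; congr (_ + _); apply: eq_bigl => i.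
  by rewrite ltnS -val_eqE/= andbC -ltn_neqAle.
have eps2 : 0 < eps / 2 by rewrite divr_gt0.
pose c := eps / 2 / (`|a| + 1); have a1 : 0 < `|a| + 1 by rewrite ltr_pwDr.
have c0 : 0 < c by rewrite divr_gt0.
have /cvgrPdist_le /(_ _ c0) /nbhs_ballP[d /= d0 dP] := cu i0.
pose M := `|tr m| + `|a|; have M0 : 0 <= M by rewrite addr_ge0.
have IHm := IH (ltnW mN) _ eps2.
near=> h.
have hM : `|h| * M < d.
  near: h; apply/nbhs_ballP; exists (d / (M + 1)) => /=.
    by rewrite divr_gt0// ltr_wpDl.
  move=> h; rewrite -ball_normE /= sub0r normrN ltr_pdivlMr ?ltr_wpDl//.
  by apply: le_lt_trans; rewrite ler_wpM2l// lerDl.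
pose y := x + h *: tr m; pose f t := u (y + t *: delta_mx ord0 i0).
have df t : is_derive t (1 : R) f (partial i0 u (y + t *: delta_mx ord0 i0)).
  by apply/is_derive_line; exact: derivableP.
have bnd t : `|t| <= `|h * a| ->
    `|partial i0 u (y + t *: delta_mx ord0 i0) - partial i0 u x| <= c.
  move=> th; rewrite distrC; apply: dP; rewrite -ball_normE /= /y.
  rewrite -addrA opprD addNKr normrN (le_lt_trans _ hM)//.
  rewrite (le_trans (ler_normD _ _))// mulrDr lerD//; first by rewrite normrZ.
  rewrite normrZ (le_trans (ler_wpM2r _ th))// normrM -mulrA ler_wpM2l// -[leRHS]mulr1.
  rewrite ler_wpM2l// [leLHS]mx_normrE; apply: bigmax_le => // ij _.
  by rewrite mxE; case: (_ && _); rewrite ?normr1 ?normr0.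
have := MVT_bound df bnd (lexx _).
rewrite /f scale0r addr0 => key.
have -> : u (x + h *: tr m.+1) - u x - h * L m.+1 =
    (u (y + (h * a) *: delta_mx ord0 i0) - u y - h * a * partial i0 u x) +
    (u (x + h *: tr m) - u x - h * L m).
  rewrite trS LS scalerDr scalerA addrA -/y /y; ring.
rewrite (le_trans (ler_normD _ _))// [eps]splitr mulrDl lerD//; last by near: h.
rewrite (le_trans key)// normrM mulrCA mulrC ler_wpM2r//.
rewrite /c mulrAC -mulrA ler_piMr// ?ltW//.
by rewrite ltr_pdivrMr// mul1r ltrDl.
Unshelve. all: by end_near. Qed.

End directional.

(** * Smooth functions on open sets *)

Lemma near_continuous {R : realType} {T : topologicalType} (x : T) (u v : T -> R) :
  (\forall y \near nbhs x, u y = v y) ->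
  {for x, continuous u} -> {for x, continuous v}.
Proof.
move=> uv cu; rewrite /prop_for /continuous_at -(nbhs_singleton uv).
by apply: cvg_trans cu; exact: near_eq_cvg uv.
Qed.

Section smooth_on.
Context {R : realType} {N : nat}.
Implicit Types (u v : 'rV[R]_N -> R) (U V : set 'rV[R]_N).

(** [Ck] on an open set, with the continuity of all intermediate derivatives
    made explicit, so that the order can be decreased. *)
Fixpoint CkU U (k : nat) u : Prop :=
  (forall x, U x -> {for x, continuous u}) /\
  if k is j.+1 then
    (forall i x, U x -> derivable u x (delta_mx ord0 i)) /\
    (forall i, CkU U j (partial i u))
  else True.

Definition smooth_on U u := forall k, CkU U k u.

Lemma CkU_cont U k u : CkU U k u -> forall x, U x -> {for x, continuous u}.
Proof. by case: k => [|k] []. Qed.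

Lemma CkU_is_derive U k u i x : CkU U k.+1 u -> U x ->
  is_derive x (delta_mx ord0 i) u (partial i u x).
Proof. by move=> [_ [+ _]] Ux; move/(_ i x Ux); exact: derivableP. Qed.

Lemma CkU_Ck k u : CkU setT k u -> Ck k u.
Proof.
elim: k u => [|k IH] u /= [cu]; first by move=> _ x; exact: cu.
by move=> [du pu]; split=> i; [move=> x; exact: du|exact/IH/pu].
Qed.

Lemma Ck_smooth u : (forall k, Ck k u) -> smooth_on setT u.
Proof.
move=> + k; elim: k u => [|k IH] u cu /=; (split; first by move=> x _; exact: (cu 0%N)) => //.
split=> [i x _|i]; first by have [+ _] := cu 1%N; exact.
by apply: IH => j; have [_] := cu j.+1; exact.
Qed.

Lemma CkU_pred U k u : CkU U k.+1 u -> CkU U k u.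
Proof.
elim: k u => [|k IH] u; first by move=> [].
by move=> [cu [du pu]]; split => //; split => // i; exact: IH.
Qed.

Lemma CkU_union U V k u : CkU U k u -> CkU V k u -> CkU (U `|` V) k u.
Proof.
elim: k u => [|k IH] u /=.
  by move=> [HU _] [HV _]; split=> // x [/HU|/HV].
move=> [HU [U1 U2]] [HV [V1 V2]]; split=> [x [/HU|/HV]//|].
by split=> [i x [Ux|Vx]|i]; [exact: U1|exact: V1|exact: IH].
Qed.

Lemma CkU_eq U k u v : open U -> (forall x, U x -> u x = v x) ->
  CkU U k u -> CkU U k v.
Proof.
move=> oU; have nU x : U x -> nbhs x U by move=> Ux; exact: open_nbhs_nbhs.
elim: k u v => [|k IH] u v uv.
  move=> [cu _]; split => // x Ux; apply: near_continuous (cu x Ux).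
  by move: (nU _ Ux); apply: filterS.
have nuv x : U x -> \forall y \near nbhs x, u y = v y by move=> /nU; apply: filterS.
move=> [cu [d1 d2]]; split.
  by move=> x Ux; apply: near_continuous (cu x Ux); exact: nuv.
split=> [i x Ux|i].
  by apply: near_eq_derivable (d1 i x Ux); exact: nuv.
apply: IH (d2 i) => x Ux; apply: near_eq_derive; exact: nuv.
Qed.

Lemma CkU_cst U k (c : R) : open U -> CkU U k (fun=> c).
Proof.
move=> oU; elim: k c => [|k IH] c /=; (split; first by move=> x _ ; apply: cst_continuous) => //.
split=> [i x _|i]; first exact: derivable_cst.
by rewrite (_ : partial i _ = fun=> 0)//; apply/funext => x; rewrite /partial derive_cst.
Qed.

Lemma is_derive_coord (i : 'I_N) (x e : 'rV[R]_N) :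
  is_derive x e (fun x : 'rV[R]_N => x ord0 i) (e ord0 i).
Proof.
apply/is_derive_line0; rewrite (_ : (fun _ => _) =
  cst (x ord0 i) + (e ord0 i \*: id)); last first.
  by apply/funext => t; rewrite !mxE mulrC.
by apply: is_derive_eq; rewrite add0r [_ *: _]mulr1.
Qed.

Lemma CkU_coord U k (i : 'I_N) : open U -> CkU U k (fun x => x ord0 i).
Proof.
move=> oU; case: k => [|k]; (split; first by move=> x _; exact: coord_continuous) => //.
split=> [j x _|j]; first by have [] := is_derive_coord i x (delta_mx ord0 j).
rewrite (_ : partial j _ = fun=> (delta_mx ord0 j : 'rV[R]_N) ord0 i).
  exact: CkU_cst.
by apply/funext => x; rewrite /partial; have [_ ->] := is_derive_coord i x (delta_mx ord0 j).
Qed.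

Lemma CkUD U k u v : open U -> CkU U k u -> CkU U k v ->
  CkU U k (fun x => u x + v x).
Proof.
move=> oU; elim: k u v => [|k IH] u v su sv;
  (split; first by move=> x Ux; exact: (cvgD (CkU_cont su Ux) (CkU_cont sv Ux))) => //.
have duv i x : U x -> is_derive x (delta_mx ord0 i) (u + v)
    (partial i u x + partial i v x).
  move=> Ux; have d1 := CkU_is_derive i su Ux; have d2 := CkU_is_derive i sv Ux.
  exact: is_deriveD.
split=> [i x Ux|i]; first by have [] := duv i x Ux.
apply: (@CkU_eq _ _ (fun x => partial i u x + partial i v x)) => //.
  by move=> x Ux; rewrite {3}/partial; have [_ ->] := duv i x Ux.
by apply: IH; [case: su => _ [_]; exact|case: sv => _ [_]; exact].
Qed.

Lemma CkUM U k u v : open U -> CkU U k u -> CkU U k v ->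
  CkU U k (fun x => u x * v x).
Proof.
move=> oU; elim: k u v => [|k IH] u v su sv;
  (split; first by move=> x Ux; exact: (cvgM (CkU_cont su Ux) (CkU_cont sv Ux))) => //.
have duv i x : U x -> is_derive x (delta_mx ord0 i) (u * v)
    (u x * partial i v x + v x * partial i u x).
  move=> Ux; have d1 := CkU_is_derive i su Ux; have d2 := CkU_is_derive i sv Ux.
  exact: is_deriveM.
split=> [i x Ux|i]; first by have [] := duv i x Ux.
apply: (@CkU_eq _ _ (fun x => u x * partial i v x + v x * partial i u x)) => //.
  by move=> x Ux; rewrite {3}/partial; have [_ ->] := duv i x Ux.
by apply: CkUD => //; apply: IH; do ?exact: CkU_pred; [case: sv => _ [_]; exact|case: su => _ [_]; exact].
Qed.

Lemma CkU_prod U k (I : Type) (s : seq I) (F : I -> 'rV[R]_N -> R) : open U ->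
  (forall i, CkU U k (F i)) -> CkU U k (fun x => \prod_(i <- s) F i x).
Proof.
move=> oU sF; elim: s => [|i s IH].
  apply: (@CkU_eq _ _ (fun=> 1)) => //; first by move=> x _; rewrite big_nil.
  exact: CkU_cst.
apply: (@CkU_eq _ _ (fun x => F i x * \prod_(j <- s) F j x)) => //.
  by move=> x _; rewrite big_cons.
exact: CkUM.
Qed.

Lemma CkU_sum U k (I : Type) (s : seq I) (F : I -> 'rV[R]_N -> R) : open U ->
  (forall i, CkU U k (F i)) -> CkU U k (fun x => \sum_(i <- s) F i x).
Proof.
move=> oU sF; elim: s => [|i s IH].
  apply: (@CkU_eq _ _ (fun=> 0)) => //; first by move=> x _; rewrite big_nil.
  exact: CkU_cst.
apply: (@CkU_eq _ _ (fun x => F i x + \sum_(j <- s) F j x)) => //.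
  by move=> x _; rewrite big_cons.
exact: CkUD.
Qed.

(** Smoothness of a function of one variable on [D], witnessed by the sequence
    of its successive derivatives. *)
Definition smooth1 (D : set R) (f : R -> R) := exists F : nat -> R -> R,
  F 0%N = f /\ forall n t, D t -> is_derive t (1 : R) (F n) (F n.+1 t).

Lemma CkU_comp U k (D : set R) (f : R -> R) u : open U -> smooth1 D f ->
  (forall x, U x -> D (u x)) -> CkU U k u -> CkU U k (fun x => f (u x)).
Proof.
move=> oU [F [<- dF]] UD; suff : forall n, CkU U k u -> CkU U k (fun x => F n (u x)) by exact.
elim: k => [|k IH] n su;
  (split; first by move=> x Ux; apply: (@continuous_comp _ _ _ u (F n));
    [exact: (CkU_cont su Ux)|apply: differentiable_continuous; apply/derivable1_diffP;
     have [] := dF n _ (UD _ Ux)]) => //.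
have dc i x : U x -> is_derive x (delta_mx ord0 i) (F n \o u) (F n.+1 (u x) * partial i u x).
  by move=> Ux; apply: is_derive_comp1; [exact/dF/UD|exact: (CkU_is_derive i su Ux)].
split=> [i x Ux|i]; first by have [] := dc i x Ux.
apply: (@CkU_eq _ _ (fun x => F n.+1 (u x) * partial i u x)) => //.
  by move=> x Ux; rewrite {2}/partial; have [_ ->] := dc i x Ux.
by apply: CkUM => //; [apply: IH; exact: CkU_pred su|case: su => _ [_]; exact].
Qed.

End smooth_on.

(** * A flat function of one variable *)

Section flat_function.
Context {R : realType}.

Lemma smooth1_expR : smooth1 setT (@expR R).
Proof. by exists (fun=> expR); split=> // n t _; exact: is_derive_expR. Qed.

Lemma smooth1_ln : smooth1 [set t : R | 0 < t] (@ln R).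
Proof.
exists (fun n => if n is m.+1 then
  (fun t : R => (-1) ^+ m * m`!%:R * t^-1 ^+ m.+1) else @ln R).
split => // -[|m] t t0.
  by apply: is_derive_eq; first exact: is_derive1_ln; rewrite fact0 expr0 expr1 !mul1r.
have tn0 : t != 0 by rewrite gt_eqF.
have dV : is_derive t (1 : R) (fun s : R => s^-1) (- (t ^- 2)).
  by apply: is_derive_eq; first exact: is_deriveV; rewrite /GRing.scale/= mulr1.
rewrite (_ : (fun _ => _) = ((-1) ^+ m * m`!%:R) \*: ((fun s : R => s^-1) ^+ m.+1)); last first.
  by apply/funext => s; rewrite /= fctE.
apply: is_derive_eq; rewrite /GRing.scale/= factS natrM -exprVn !exprS; ring.
Qed.

(** The flat function [exp (- 1 / t)] for [t > 0], extended by [0]; [flat p] is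
    the general form [p (1 / t) exp (- 1 / t)] of its derivatives. *)
Definition flat (p : {poly R}) (t : R) : R :=
  if 0 < t then p.[t^-1] * expR (- t^-1) else 0.

Definition smooth_step : R -> R := flat 1.

(** Term by term, from [y ^ i.+1 <= i.+1! exp y]. *)
Lemma expR_poly_bound (p : {poly R}) :
  exists2 C : R, 0 <= C & forall y, 0 < y -> `|p.[y] * expR (- y)| <= C / y.
Proof.
have mono i (y : R) : 0 < y -> y ^+ i * expR (- y) <= i.+1`!%:R / y.
  move=> y0; rewrite ler_pdivlMr// mulrAC -exprSr expRN ler_pdivrMr ?expR_gt0//.
  rewrite -ler_pdivrMl ?ltr0n ?fact_gt0// mulrC.
  by rewrite (le_trans _ (expR_ge1Dxn i (ltW y0)))// lerDr.
exists (\sum_(i < size p) `|p`_i| * i.+1`!%:R).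
  by apply: sumr_ge0 => i _; rewrite mulr_ge0.
move=> y y0; rewrite horner_coef !mulr_suml (le_trans (ler_norm_sum _ _ _))//.
apply: ler_sum => i _; rewrite !normrM -!mulrA ler_wpM2l//.
by rewrite (ger0_norm (expR_ge0 _)) ger0_norm ?mono// exprn_ge0 ?ltW.
Qed.

(** At the origin the difference quotient is of the form of [expR_poly_bound]
    with one more power of the variable, and tends to [0]. *)
Lemma is_derive_flat (p : {poly R}) (t : R) :
  is_derive t (1 : R) (flat p) (flat ('X^2 * (p - p^`())) t).
Proof.
have [t0|t0|->] := ltgtP t 0.
- have -> : flat ('X^2 * (p - p^`())) t = 0 by rewrite /flat ltNge ltW.
  have d0 : is_derive t (1 : R) (cst (0 : R)) 0 by exact: is_derive_cst.
  apply: near_eq_is_derive d0.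
  near=> s; rewrite /flat ltNge ltW//=; near: s; exact: lt_nbhsl.
- have tn0 : t != 0 by rewrite gt_eqF.
  have dV : is_derive t (1 : R) (fun s : R => s^-1) (- (t ^- 2)).
    by apply: is_derive_eq; first exact: is_deriveV; rewrite /GRing.scale/= mulr1.
  have dp := is_derive1_comp (is_derive_poly p t^-1) dV.
  have dN : is_derive t (1 : R) (fun s : R => - s^-1) (t ^- 2).
    by apply: is_derive_eq; rewrite opprK.
  have de := @is_derive1_comp R expR (fun s => - s^-1) t _ _ (is_derive_expR _) dN.
  have dpe : is_derive t (1 : R) (fun s : R => p.[s^-1] * expR (- s^-1))
      (flat ('X^2 * (p - p^`())) t).
    have := is_deriveM dp de => /is_derive_eq; apply.
    by rewrite /flat t0 /GRing.scale/= !hornerE/= -exprVn; ring.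
  apply: near_eq_is_derive dpe; near=> s.
  by rewrite /flat ifT//; near: s; exact: lt_nbhsr.
- have [C C0 CP] := expR_poly_bound (p * 'X).
  have lim : (fun h : R => h^-1 *: ((flat p \o shift 0) (h *: (1 : R)) - flat p 0)) @ 0^' -->
      (0 : R).
    apply/cvgrPdist_le => eps eps0; near=> h.
    have h0 : h != 0 by near: h; exact: nbhs_dnbhs_neq.
    rewrite sub0r normrN /= [h *: 1]mulr1 addr0 [flat p 0]/flat ltxx subr0 /flat.
    case: ifPn => hp; last by rewrite scaler0 normr0 ltW.
    rewrite [_ *: _]mulrA [h^-1 * _]mulrC.
    have := CP h^-1; rewrite invr_gt0 invrK hornerMX => /(_ hp) /le_trans; apply.
    have : `|h| <= eps / (C + 1).
      near: h; apply: dnbhs0_le; rewrite divr_gt0// ltr_wpDl//.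
    rewrite (ger0_norm (ltW hp)) ler_pdivlMr ?ltr_wpDl// => hC.
    by rewrite (le_trans _ hC)// [C * h]mulrC ler_wpM2l ?lerDl ?(ltW hp).
  have -> : flat ('X^2 * (p - p^`())) 0 = 0 by rewrite /flat ltxx.
  by apply: DeriveDef; [apply/cvg_ex; eexists; exact: lim|exact: cvg_lim].
Unshelve. all: by end_near. Qed.

Lemma smooth1_smooth_step : smooth1 setT smooth_step.
Proof.
exists (fun n => flat (iter n (fun p => 'X^2 * (p - p^`())) 1)).
by split => // n t _; exact: is_derive_flat.
Qed.

Lemma smooth_stepE t : smooth_step t = if 0 < t then expR (- t^-1) else 0.
Proof. by rewrite /smooth_step /flat hornerC mul1r. Qed.

Lemma smooth_step_ge0 t : 0 <= smooth_step t.
Proof. by rewrite smooth_stepE; case: ifP => // _; rewrite expR_ge0. Qed.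

Lemma smooth_step_le1 t : smooth_step t <= 1.
Proof.
rewrite smooth_stepE; case: ifP => // t0.
by rewrite -expR0 ler_expR oppr_le0 invr_ge0 ltW.
Qed.

(** Dilations of [smooth_step] approximate the indicator of a half line. *)
Lemma cvg_smooth_step (z : R) :
  (fun n : nat => smooth_step (n%:R * z)) @ \oo --> ((0 < z)%R%:R : R).
Proof.
have [z0|z0] := ltP 0 z; last first.
  rewrite (_ : (fun _ => _) = cst 0); first exact: cvg_cst.
  apply/funext => n; rewrite smooth_stepE ltNge.
  by rewrite mulr_ge0_le0//.
rewrite -[X in _ --> X]expR0 -oppr0 -(mul0r z^-1).
apply: (@cvg_trans _ ((fun n : nat => expR (- (n%:R^-1 * z^-1))) @ \oo)).
  apply: near_eq_cvg; near=> n; rewrite smooth_stepE invfM pmulr_rgt0 ?z0// ltr0n.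
  by near: n; exact: nbhs_infty_gt.
apply: continuous_cvg; first exact: continuous_expR.
apply: cvgN; apply: cvgM; last exact: cvg_cst.
by rewrite -(cvg_shiftS _); exact: cvg_harmonic.
Unshelve. all: by end_near. Qed.

End flat_function.

(** * Test functions in Euclidean polar coordinates *)

Section euclidean_test_functions.
Context {R : realType} {N : nat}.
Implicit Types (x y : 'rV[R]_N).

(** Logarithm of the Euclidean norm. *)
Definition lnorm x : R := ln (dotv x x) / 2.

Lemma dotv_ge0 x : 0 <= dotv x x.
Proof. by apply: sumr_ge0 => i _; rewrite -expr2 sqr_ge0. Qed.

Lemma coord_le_dotv x i : x ord0 i ^+ 2 <= dotv x x.
Proof.
rewrite /dotv (bigD1 i)//= expr2 lerDl; apply: sumr_ge0 => j _.
by rewrite -expr2 sqr_ge0.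
Qed.

Lemma dotv_gt0 x : x != 0 -> 0 < dotv x x.
Proof.
move=> x0; rewrite lt_neqAle dotv_ge0 andbT eq_sym; apply: contra x0 => /eqP dx.
apply/eqP/rowP => i; rewrite mxE; apply/eqP; rewrite -sqrf_eq0.
by rewrite eq_le sqr_ge0 andbT -dx coord_le_dotv.
Qed.

Lemma norm_sqr_le_dotv x : `|x| ^+ 2 <= dotv x x.
Proof.
have [->|x0] := eqVneq x 0; first by rewrite normr0 expr0n dotv_ge0.
have nx : `|x| != 0 by rewrite normr_eq0.
have [[i j] xE] := mx_norm_neq0 nx.
have {}xE : `|x| = `|x i j| := xE.
by rewrite xE (ord1 i) real_normK ?num_real// coord_le_dotv.
Qed.

Lemma dotv_le_norm_sqr x : dotv x x <= N%:R * `|x| ^+ 2.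
Proof.
rewrite /dotv (@le_trans _ _ (\sum_(i < N) `|x| ^+ 2))//.
  apply: ler_sum => i _; rewrite -expr2 -(@real_normK _ (x ord0 i)) ?num_real//.
  by rewrite lerXn2r ?nnegrE// norm_coord_le.
by rewrite sumr_const card_ord mulr_natl.
Qed.

Lemma dotvZ (t : R) x : dotv (t *: x) (t *: x) = t ^+ 2 * dotv x x.
Proof.
by rewrite /dotv mulr_sumr; apply: eq_bigr => i _; rewrite mxE; ring.
Qed.

Lemma lnormZ (t : R) x : 0 < t -> x != 0 -> lnorm (t *: x) = ln t + lnorm x.
Proof.
move=> t0 x0; rewrite /lnorm dotvZ lnM ?posrE ?exprn_gt0 ?dotv_gt0// lnXn//.
by rewrite mulrDl -(mulr_natr (ln t)) mulfK// pnatr_eq0.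
Qed.

Definition nonzero : set 'rV[R]_N := [set x | x != 0].

Lemma open_nonzero : open nonzero.
Proof.
rewrite (_ : nonzero = ~` [set 0]); last first.
  by apply/seteqP; split => x /= /eqP.
apply: closed_openC; apply: accessible_closed_set1; exact: hausdorff_accessible.
Qed.

Lemma CkU_dotv U k : open U -> CkU U k (fun x => dotv x x).
Proof.
move=> oU; apply: CkU_sum => // i; apply: CkUM => //; exact: CkU_coord.
Qed.

Lemma CkU_lnorm k : CkU nonzero k lnorm.
Proof.
apply: CkUM; [exact: open_nonzero| |apply: CkU_cst; exact: open_nonzero].
apply: (@CkU_comp _ _ _ _ _ _ (fun x => dotv x x) open_nonzero (@smooth1_ln R)).
  by move=> x; exact: dotv_gt0.
by apply: CkU_dotv; exact: open_nonzero.
Qed.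

(** The functions [A x * H (ln |x| + d)], with [A] smooth and homogeneous of
    degree [0] and [H] smooth with compact support. *)
Definition ang_rad (A : 'rV[R]_N -> R) (H : R -> R) (d : R) x : R :=
  if x == 0 then 0 else A x * H (lnorm x + d).

(** The support lies in an annulus around the origin, where the Euclidean norm
    is smooth. *)
Lemma test_fun_ang_rad (A : 'rV[R]_N -> R) (H : R -> R) (S d : R) :
  (forall k, CkU nonzero k A) -> smooth1 setT H ->
  (forall s, S < `|s| -> H s = 0) -> test_fun (ang_rad A H d).
Proof.
move=> sA sH HS; pose f := ang_rad A H d.
have f0 x : x != 0 -> f x != 0 ->
    expR (2 * (- S - d)) <= dotv x x <= expR (2 * (S - d)).
  move=> x0; rewrite /f /ang_rad (negbTE x0) => fx.
  have : `|lnorm x + d| <= S.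
    by rewrite leNgt; apply/negP => /HS H0; rewrite H0 mulr0 eqxx in fx.
  rewrite ler_norml => /andP[l1 l2].
  have dx := dotv_gt0 x0; rewrite -(@lnK _ (dotv x x)) ?posrE// !ler_expR.
  by move: l1 l2; rewrite /lnorm => l1 l2; apply/andP; split; lra.
pose M := Num.sqrt (expR (2 * (S - d))).
pose del := Num.sqrt (expR (2 * (- S - d)) / (N%:R + 1)).
have N1 : 0 < N%:R + 1 :> R by rewrite ltr_wpDl.
have del0 : 0 < del by rewrite sqrtr_gt0 divr_gt0// expR_gt0.
have fM x : f x != 0 -> `|x| <= M.
  have [->|x0] := eqVneq x 0; first by rewrite normr0 sqrtr_ge0.
  move=> /(f0 _ x0) /andP[_ dM].
  by rewrite -[`|x|]ger0_norm// -sqrtr_sqr ler_wsqrtr// (le_trans (norm_sqr_le_dotv x)).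
have fd x : `|x| < del -> f x = 0.
  move=> xd; apply/eqP; apply: contraTT xd => fx; rewrite -leNgt.
  have x0 : x != 0 by apply: contra fx => /eqP ->; rewrite /f /ang_rad eqxx.
  have /andP[dm _] := f0 _ x0 fx.
  rewrite -[`|x|]ger0_norm// -sqrtr_sqr ler_wsqrtr// ler_pdivrMr// (le_trans dm)//.
  rewrite (le_trans (dotv_le_norm_sqr x))// mulrC ler_wpM2l ?sqr_ge0//.
  by rewrite lerDl.
have ball0 : nbhs (0 : 'rV[R]_N) [set x | `|x| < del].
  apply/nbhs_ballP; exists del => // x; rewrite -ball_normE /= sub0r normrN.
  by [].
have oball : open [set x : 'rV[R]_N | `|x| < del].
  rewrite (_ : [set _ | _] = Num.norm @^-1` [set y | y < del])//.
  apply: open_comp; last exact: open_lt.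
  by move=> x _; exact: norm_continuous.
split.
- move=> k; apply: CkU_Ck.
  rewrite (_ : setT = nonzero `|` [set x | `|x| < del]); last first.
    apply/seteqP; split => // x _; have [->|x0] := eqVneq x 0.
      by right; rewrite /= normr0.
    by left.
  apply: CkU_union.
    apply: (@CkU_eq _ _ _ _ (fun x => A x * H (lnorm x + d))).
    + exact: open_nonzero.
    + by move=> x /= x0; rewrite /ang_rad (negbTE x0).
    + apply: CkUM; [exact: open_nonzero|exact: sA|].
      apply: (@CkU_comp _ _ _ _ setT) => //; first exact: open_nonzero.
      apply: CkUD; [exact: open_nonzero|exact: CkU_lnorm|].
      apply: CkU_cst; exact: open_nonzero.
  apply: (@CkU_eq _ _ _ _ (fun=> 0)) => //.
    by move=> x /= xd; rewrite -[RHS]/(f x) fd.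
  exact: CkU_cst.
- apply: bounded_closed_compact; last exact: closed_closure.
  have cM : closed [set x : 'rV[R]_N | `|x| <= M].
    rewrite (_ : [set _ | _] = Num.norm @^-1` [set y | y <= M])//.
    by apply: preimage_closed; [move=> x _; exact: norm_continuous|exact: closed_le].
  have sub : supp (ang_rad A H d) `<=` [set x | `|x| <= M].
    rewrite [X in _ `<=` X]((closure_id _).1 cM); apply: closureS => x /= fx; exact: fM.
  exists M; split; first exact: num_real.
  by move=> y My x /sub /= xM; rewrite (le_trans xM)// ltW.
- move=> /(_ _ ball0)[x [/= fx xd]].
  by move: fx; rewrite -[ang_rad _ _ _ _]/(f x) fd// eqxx.
Qed.

Lemma test_fun_derive (u : 'rV[R]_N -> R) x e : test_fun u ->
  is_derive x e u (dotv (gradient u x) e).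
Proof.
move=> [su _ _]; apply: derive_sum_partial.
- by move=> i y; have [+ _] := su 1%N; exact.
- by move=> i y; have [_ /(_ i)] := su 1%N; exact.
Qed.

(** On a ray the function is [t |-> A x * H (ln t + c)] for a constant [c]. *)
Lemma radial_deriv_ang_rad K (A : 'rV[R]_N -> R) (H H' : R -> R) (d : R) :
  Kss_o K -> test_fun (ang_rad A H d) ->
  (forall t x, 0 < t -> A (t *: x) = A x) ->
  (forall s, is_derive s (1 : R) H (H' s)) ->
  radial_deriv K (ang_rad A H d) =
    (fun x => if x == 0 then 0 else A x * H' (lnorm x + d) / normK K x).
Proof.
move=> hK tA hA dH; apply/funext => x; have [x0|x0] := eqVneq x 0.
  rewrite x0 /radial_deriv /sigmaK scaler0 /dotv big1// => i _.
  by rewrite [X in _ * X]mxE mulr0.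
have r0 := normK_gt0 hK x0; set r := normK K x in r0 *.
have sx0 : sigmaK K x != 0 by rewrite scaler_eq0 negb_or x0 invr_eq0 andbT gt_eqF.
rewrite /radial_deriv.
have := test_fun_derive x (sigmaK K x) tA.
rewrite -{1}(normK_sigma_decomp hK x) -[normK K x *: _]add0r => /is_derive_line [_ <-].
have d1 : is_derive r (1 : R) (fun t => ln t + (lnorm (sigmaK K x) + d)) r^-1.
  by apply: is_derive_eq; first (apply: is_deriveD; first exact: is_derive1_ln); rewrite addr0.
have d2 := @is_derive1_comp R H (fun t => ln t + (lnorm (sigmaK K x) + d)) r
  _ _ (dH _) d1.
have d3 := is_deriveZ (A x) d2.
have : is_derive r (1 : R) (fun t => ang_rad A H d (0 + t *: sigmaK K x))
    (A x *: (H' (ln r + (lnorm (sigmaK K x) + d)) * r^-1)).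
  apply: near_eq_is_derive d3; near=> t.
  have t0 : 0 < t by near: t; exact: lt_nbhsr.
  rewrite add0r /ang_rad scaler_eq0 gt_eqF//= (negbTE sx0).
  by rewrite lnormZ// addrA hA// hA// invr_gt0.
move=> [_ ->]; rewrite addrA -lnormZ// normK_sigma_decomp//.
by rewrite /GRing.scale/= mulrA.
Unshelve. all: by end_near. Qed.

End euclidean_test_functions.

(** * The inequality for test functions *)

Section test_function_inequalities.
Context {R : realType} {N : nat} (K : set 'rV[R]_N) (hK : Kss_o K).
Hypothesis hN : (2 <= N)%N.
Implicit Types (u f w : 'rV[R]_N -> R) (x : 'rV[R]_N).
Local Notation leb := (@lebesgue_measure R).
Local Notation lebN := (@lebesgue_rV R N).
Local Notation r := (normK K).
Local Notation g u := (radial_deriv K u).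

(** Bounded measurable functions supported away from the origin and infinity:
    all integrals of the proof of the inequality are integrals of such
    functions. *)
Definition annular f : Prop := measurable_fun setT f /\
  exists del M C : R, 0 < del /\
    forall x, `|f x| <= if del <= r x <= M then C else 0.

Definition loc_bounded w : Prop := measurable_fun setT w /\
  forall del M : R, 0 < del ->
    exists C : R, forall x, del <= r x <= M -> `|w x| <= C.

Lemma annular_loc f : annular f -> loc_bounded f.
Proof.
move=> [mf [d [M [C [d0 fC]]]]]; split => // d' M' _; exists (Num.max C 0) => x _.
by rewrite (le_trans (fC x))//; case: ifP => _; rewrite le_max lexx ?orbT.
Qed.

Lemma annularM f w : annular f -> loc_bounded w -> annular (fun x => f x * w x).
Proof.
move=> [mf [d [M [C [d0 fC]]]]] [mw wC]; split; first exact: measurable_funM.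
have [D wD] := wC d M d0; exists d, M, (C * D); split => // x.
have := fC x; rewrite normrM; case: ifP => dM fx.
  by rewrite ler_pM// wD.
by rewrite (le_trans (ler_wpM2r _ fx))// mul0r.
Qed.

Lemma annularD f1 f2 : annular f1 -> annular f2 -> annular (fun x => f1 x + f2 x).
Proof.
move=> [m1 [d1 [M1 [C1 [d10 f1C]]]]] [m2 [d2 [M2 [C2 [d20 f2C]]]]].
split; first exact: measurable_funD.
exists (Num.min d1 d2), (Num.max M1 M2), (Num.max C1 0 + Num.max C2 0).
split; first by rewrite lt_min d10.
have C0 (C : R) : 0 <= Num.max C 0 by rewrite le_max lexx orbT.
have CC (C : R) : C <= Num.max C 0 by rewrite le_max lexx.
move=> x; rewrite (le_trans (ler_normD _ _))//.
have := f1C x; have := f2C x; rewrite ge_min le_max.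
have := C0 C1; have := C0 C2; have := CC C1; have := CC C2.
move: (Num.max C1 0) (Num.max C2 0) => c1 c2 H1 H2 H3 H4.
case E2: (d2 <= r x <= M2) => h2; case E1: (d1 <= r x <= M1) => h1; case: ifP => E; lra.
Qed.

Lemma annularZ c f : annular f -> annular (fun x => c * f x).
Proof.
move=> [mf [d [M [C [d0 fC]]]]]; split; first exact: measurable_funM.
exists d, M, (`|c| * C); split => // x; have := fC x; rewrite normrM.
by case: ifP => _ h; rewrite ?ler_wpM2l// (le_trans (ler_wpM2l _ h))// mulr0.
Qed.

Lemma annular_integrable f : annular f -> lebN.-integrable setT (EFin \o f).
Proof.
move=> [mf [d [M [C [d0 fC]]]]].
pose B : set 'rV[R]_N := [set x | r x <= M].
have mB : measurable B := measurable_normK_le hK M.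
have fB x : x \notin B -> f x = 0.
  rewrite notin_setE => xB; apply/eqP; rewrite -normr_eq0.
  have := fC x; case: ifP => [/andP[_ rM]|_]; first by case: xB.
  by rewrite normr_le0 normr_eq0.
rewrite (_ : EFin \o f = (EFin \o f) \_ B); last first.
  apply/funext => x; rewrite patchE; case: ifPn => // /fB; rewrite /comp => -> //.
apply: (integrable_mkcond _ mB).1.
apply: measurable_bounded_integrable => //.
- exact: lebesgue_normK_le.
- exact: measurable_funTS.
- exists (Num.max C 0); split; first exact: num_real.
  move=> y Cy x _ /=; rewrite (le_trans (fC x))// (le_trans _ (ltW Cy))//.
  by case: ifP => _; rewrite le_max lexx ?orbT.
Qed.

Lemma loc_bounded_radial (om : R -> R) : measurable_fun setT om ->
  (forall t : R, 0 < t -> {for t, continuous om}) -> loc_bounded (fun x => om (r x)).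
Proof.
move=> mom com; split.
  by apply: (measurableT_comp mom); exact: measurable_normK.
move=> d M d0.
have cw : {within `[d, M], continuous om}.
  apply: continuous_in_subspaceT => t; rewrite inE/= in_itv/= => /andP[dt _].
  by apply: com; exact: lt_le_trans dt.
have := compact_bounded (continuous_compact cw (@segment_compact _ d M)).
move=> [C [_ CP]]; exists (`|C| + 1) => x dM.
apply: (CP (`|C| + 1)); first by rewrite (le_lt_trans (ler_norm C))// ltrDl.
by exists (r x) => //=; rewrite in_itv.
Qed.

Lemma test_fun_off_supp u x : test_fun u -> ~ supp u x ->
  u x = 0 /\ g u x = 0.
Proof.
move=> [su _ _] xu; have o : open (~` supp u) by apply: closed_openC; exact: closed_closure.
have u0 y : (~` supp u) y -> u y = 0.
  move=> yu; apply/eqP; apply: contra_notT yu => uy.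
  by apply: subset_closure.
split; first exact: u0.
rewrite /radial_deriv /dotv big1// => i _; rewrite mxE.
have -> : partial i u x = 'D_(delta_mx ord0 i) (fun=> 0 : R) x.
  apply: near_eq_derive; have : nbhs x (~` supp u) by exact: open_nbhs_nbhs.
  by apply: filterS => y /u0.
by rewrite derive_cst mul0r.
Qed.

Lemma continuous_bounded_supp u f : test_fun u -> continuous f ->
  exists C : R, forall x, supp u x -> `|f x| <= C.
Proof.
move=> [_ cu _] cf.
have := compact_bounded (continuous_compact (continuous_subspaceT cf) cu).
move=> [C [_ CP]]; exists (`|C| + 1) => x xu.
apply: (CP (`|C| + 1)); first by rewrite (le_lt_trans (ler_norm C))// ltrDl.
by exists x.
Qed.

Lemma test_fun_annulus u : test_fun u -> exists del M : R, 0 < del /\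
  forall x, supp u x -> del <= r x <= M.
Proof.
move=> [_ cu u0]; have [A A0 rA] := normK_le_norm hK.
have [B B0 rB] := norm_le_normK hK.
have [C [_ CP]] := compact_bounded cu.
have : nbhs (0 : 'rV[R]_N) (~` supp u).
  by apply: open_nbhs_nbhs; split => //; apply: closed_openC; exact: closed_closure.
move=> /nbhs_ballP[e /= e0 eP].
exists (e / B), (A * (`|C| + 1)); split; first exact: divr_gt0.
move=> x xu; apply/andP; split.
  rewrite ler_pdivrMr// mulrC (le_trans _ (rB x))// leNgt; apply/negP => xe.
  by apply: (eP x) => //; rewrite -ball_normE /= sub0r normrN.
rewrite (le_trans (rA x))// ler_pM2l//.
by apply: (CP (`|C| + 1)) => //; rewrite (le_lt_trans (ler_norm C))// ltrDl.
Qed.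

Lemma measurable_gradient u i : test_fun u -> measurable_fun setT (partial i u).
Proof.
move=> [su _ _]; apply: continuous_measurable_rVR.
by have [_ /(_ i)] := su 1%N.
Qed.

Lemma measurable_test_fun u : test_fun u -> measurable_fun setT u.
Proof. by move=> [su _ _]; apply: continuous_measurable_rVR; exact: (su 0%N). Qed.

Lemma measurable_radial_deriv u : test_fun u -> measurable_fun setT (g u).
Proof.
move=> tu; apply: measurable_sum => i; apply: measurable_funM.
  under eq_fun do rewrite mxE; exact: measurable_gradient.
by apply: (measurableT_comp (measurable_coord i)); exact: measurable_sigmaK.
Qed.

Lemma annular_test_fun u : test_fun u -> annular u.
Proof.
move=> tu; split; first exact: measurable_test_fun.
have [d [M [d0 dM]]] := test_fun_annulus tu.
have cu : continuous u by case: tu => su _ _; exact: (su 0%N).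
have [C uC] := continuous_bounded_supp tu cu.
exists d, M, (Num.max C 0); split => // x.
have [xu|xu] := pselect (supp u x).
  by rewrite (dM _ xu) le_max uC.
have [-> _] := test_fun_off_supp tu xu; rewrite normr0; case: ifP => // _.
by rewrite le_max lexx orbT.
Qed.

Lemma annular_radial_deriv u : test_fun u -> annular (g u).
Proof.
move=> tu; split; first exact: measurable_radial_deriv.
have [d [M [d0 dM]]] := test_fun_annulus tu.
have [B B0 rB] := norm_le_normK hK.
have /choice[C CP] : forall i, exists C : R, forall x, supp u x -> `|partial i u x| <= C.
  move=> i; apply: (continuous_bounded_supp tu).
  by case: tu => su _ _; have [_ /(_ i)] := su 1%N.
pose D := \sum_i `|C i| * B.
have D0 : 0 <= D by apply: sumr_ge0 => i _; rewrite mulr_ge0// ltW.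
exists d, M, D; split => // x; have [xu|xu] := pselect (supp u x); last first.
  by have [_ ->] := test_fun_off_supp tu xu; rewrite normr0; case: ifP.
rewrite (dM _ xu) (le_trans (ler_norm_sum _ _ _))//; apply: ler_sum => i _.
rewrite normrM mxE ler_pM//.
  by rewrite (le_trans (CP _ _ xu))// ler_norm.
rewrite (le_trans (norm_coord_le _ _))// /sigmaK normrZ.
have x0 : x != 0.
  rewrite -(normK_eq0 hK) gt_eqF//.
  by have /andP[+ _] := dM _ xu; exact: lt_le_trans.
have rx := normK_gt0 hK x0.
by rewrite gtr0_norm ?invr_gt0// ler_pdivrMl// mulrC.
Qed.

(** Integration by parts along the rays: in polar coordinates the integrand is
    the derivative of [u^2 om t^(N-1)] in the radial variable. *)
Lemma test_fun_IBP u (om om' : R -> R) : test_fun u ->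
  measurable_fun setT om -> measurable_fun setT om' ->
  (forall t : R, 0 < t -> is_derive t (1 : R) om (om' t)) ->
  (forall t : R, 0 < t -> {for t, continuous om'}) ->
  2 * \int[lebN]_x (u x * g u x * om (r x)) =
  - \int[lebN]_x (u x * u x * (om' (r x) + (N%:R - 1) * (om (r x) / r x))).
Proof.
move=> tu mom mom' dom com'.
have com t : 0 < t -> {for t, continuous om}.
  move=> t0; apply: differentiable_continuous; apply/derivable1_diffP.
  by have [] := dom t t0.
have a1 : annular (fun x => u x * g u x * om (r x)).
  apply: annularM; last exact: loc_bounded_radial.
  apply: annularM; first exact: annular_test_fun.
  by apply: annular_loc; exact: annular_radial_deriv.
have a2 : annular (fun x => u x * u x * (om' (r x) + (N%:R - 1) * (om (r x) / r x))).
  apply: annularM.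
    by apply: annularM; [|apply: annular_loc]; exact: annular_test_fun.
  apply: (@loc_bounded_radial (fun t => om' t + (N%:R - 1) * (om t / t))).
    apply: measurable_funD => //; apply: measurable_funM => //.
    by apply: measurable_funM => //; exact: measurable_inv.
  move=> t t0; apply: cvgD; first exact: com'.
  apply: cvgM; first exact: cvg_cst.
  by apply: cvgM; [exact: com|apply: inv_continuous; rewrite gt_eqF].
pose F x := 2 * (u x * g u x * om (r x)) +
   u x * u x * (om' (r x) + (N%:R - 1) * (om (r x) / r x)).
have aF : annular F by apply: annularD => //; exact: annularZ.
have iF := annular_integrable aF.
suff F0 : \int[lebN]_x F x = 0.
  have := F0; rewrite /F RintegralD//; last 2 first.
  - exact/annular_integrable/annularZ.
  - exact: annular_integrable.
  rewrite RintegralZl//; last exact: annular_integrable.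
  by move/eqP; rewrite addr_eq0 => /eqP.
have mF : measurable_fun setT F.
  by apply/measurable_EFinP; case/integrableP: iF.
have [mu hmu] := polar_measure_exists hK hN.
have [d [M [d0 dM]]] := test_fun_annulus tu.
have F_off x : ~ (d <= r x <= M) -> F x = 0.
  move=> xdM; have xu : ~ supp u x by move/dM.
  rewrite /F; have [-> ->] := test_fun_off_supp tu xu.
  by rewrite !(mul0r, mulr0) addr0.
(* The polar formula is about nonnegative functions: the integrals of the
   positive and of the negative part are compared ray by ray. *)
rewrite /Rintegral integralE.
suff -> : (\int[lebN]_x ((EFin \o F)^\+ x) = \int[lebN]_x ((EFin \o F)^\- x))%E.
  rewrite subee//; apply: integrable_neg_fin_num => //.
have mFe : measurable_fun setT (EFin \o F) by exact/measurable_EFinP.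
rewrite (polar_measure_rays hK hmu); [|exact: measurable_funepos|by move=> x; exact: funepos_ge0].
rewrite (polar_measure_rays hK hmu); [|exact: measurable_funeneg|by move=> x; exact: funeneg_ge0].
apply: eq_integral => s /[!inE] sK; have s1 := (bdryP hK s).1 sK.
pose f (t : R) := F (t *: s) * t ^+ N.-1.
pose G (t : R) := u (t *: s) * u (t *: s) * om t * t ^+ N.-1.
have rs t : 0 <= t -> r (t *: s) = t by move=> t0; rewrite normKZ// s1 mulr1.
have f_off t : 0 <= t -> ~ (d <= t <= M) -> F (t *: s) = 0.
  by move=> t0 tdM; apply: F_off; rewrite rs.
have dG (t : R) : 0 < t -> is_derive t (1 : R) G (f t).
  move=> t0.
  have du : is_derive t (1 : R) (fun t : R => u (t *: s)) (dotv (gradient u (t *: s)) s).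
    have := test_fun_derive (t *: s) s tu.
    rewrite -{1}[t *: s]add0r => /is_derive_line.
    by under [X in is_derive _ _ X]eq_fun do rewrite add0r.
  have dt := dom t t0.
  have dp : is_derive t (1 : R) (fun t : R => t ^+ N.-1) (N.-1%:R * t ^+ N.-2).
    rewrite (_ : (fun _ => _) = (id : R -> R) ^+ N.-1); last first.
      by apply/funext => y; rewrite fctE.
    by apply: is_derive_eq; rewrite [_ *: _]mulr1.
  have := is_deriveM (is_deriveM (is_deriveM du du) dt) dp.
  move/is_derive_eq; apply; rewrite /f /F rs ?ltW// /GRing.scale/=.
  rewrite /radial_deriv sigmaKZ// sigmaK_bdry//.
  have -> : N.-1%:R = N%:R - 1 :> R by rewrite -subn1 natrB// (leq_trans _ hN).
  have -> : t ^+ N.-1 = t ^+ N.-2 * t.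
    by rewrite -exprSr prednK// -subn1 subn_gt0.
  rewrite ?mulrfctE /=.
  by field; rewrite gt_eqF.
have cf (t : R) : 0 < t -> {for t, continuous f}.
  move=> t0; have cs : {for t, continuous (fun t : R => t *: s)}.
    by apply: cvgZr_tmp; exact: cvg_id.
  have cu : {for t, continuous (fun t : R => u (t *: s))}.
    apply: (continuous_comp cs); case: tu => su _ _; exact: (su 0%N).
  have cg : {for t, continuous (fun t : R => dotv (gradient u (t *: s)) s)}.
    rewrite /dotv; apply: cvg_big => [|i _]; first exact: add_continuous.
    apply: cvgM; last exact: cvg_cst.
    under [X in X @ _ --> _]eq_fun do rewrite mxE.
    rewrite mxE; apply: (@continuous_comp _ _ _ (fun t : R => t *: s) (partial i u)) => //.
    by case: tu => su _ _; have [_ /(_ i)] := su 1%N; apply.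
  apply: (@near_continuous R _ t (fun t : R => (2 * (u (t *: s) * dotv (gradient u (t *: s)) s * om t) +
     u (t *: s) * u (t *: s) * (om' t + (N%:R - 1) * (om t / t))) * t ^+ N.-1)).
    near=> y; have y0 : 0 < y by near: y; exact: lt_nbhsr.
    rewrite /f /F rs ?ltW// /radial_deriv sigmaKZ// sigmaK_bdry//.
  apply: cvgM; last exact: exprn_continuous.
  apply: cvgD; apply: cvgM; [exact: cvg_cst| |by apply: cvgM|].
    by apply: cvgM; [apply: cvgM|exact: com].
  apply: cvgD; first exact: com'.
  apply: cvgM; first exact: cvg_cst.
  by apply: cvgM; [exact: com|apply: inv_continuous; rewrite gt_eqF].
pose d' := d / 2; pose M' := Num.max M d + 1.
have d'0 : 0 < d' by rewrite divr_gt0.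
have d'd : d' < d by rewrite /d' ltr_pdivrMr// mulr_natr mulr2n ltrDl.
have MM' : M < M' by rewrite /M' (@le_lt_trans _ _ (Num.max M d)) ?le_max ?lexx ?ltrDl.
have d'M' : d' < M'.
  by rewrite (lt_trans d'd)// /M' (@le_lt_trans _ _ (Num.max M d)) ?le_max ?lexx ?orbT ?ltrDl.
pose I : set R := `[d', M']%classic.
have restr (h : \bar R -> \bar R) : h 0%E = 0%E ->
    (\int[leb]_(t in `[0%R, +oo[) (h (F (t *: s))%:E * (t ^+ N.-1)%:E) =
     \int[leb]_(t in I) (h (F (t *: s))%:E * (t ^+ N.-1)%:E))%E.
  move=> h0; rewrite integral_mkcond [RHS]integral_mkcond; apply: eq_integral => t _.
  rewrite !patchE /I !mem_setE !in_itv/= andbT.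
  have [t0|t0] := leP 0 t; last by rewrite leNgt (lt_trans t0 d'0).
  case: ifPn => // tI; rewrite f_off ?h0 ?mul0e// => /andP[dt tM].
  by move: tI; rewrite (le_trans (ltW d'd) dt) (le_trans tM (ltW MM')).
have uoff t : 0 <= t -> ~ (d <= t <= M) -> u (t *: s) = 0.
  move=> t0 tdM; have xu : ~ supp u (t *: s) by move/dM; rewrite rs.
  by have [-> _] := test_fun_off_supp tu xu.
have sF : (\int[leb]_(t in I) (f t)%:E = 0)%E.
  rewrite (@continuous_FTC2 R f G d' M')//.
  - have uM' : u (M' *: s) = 0.
      apply: uoff; first exact: (ltW (lt_trans d'0 d'M')).
      by move=> /andP[_]; rewrite leNgt MM'.
    have ud' : u (d' *: s) = 0.
      by apply: uoff; [exact: ltW|move=> /andP[+ _]; rewrite leNgt d'd].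
    by rewrite /G uM' ud' !mul0r subee.
  - apply: continuous_in_subspaceT => t; rewrite inE/= in_itv/= => /andP[dt _].
    by apply: cf; exact: lt_le_trans dt.
  - have cG (t : R) : 0 < t -> {for t, continuous G}.
      move=> t0; apply: differentiable_continuous; apply/derivable1_diffP.
      by have [] := dG t t0.
    split.
    + move=> t /[!in_itv]/= /andP[dt _]; apply: ex_derive; apply: dG.
      exact: lt_trans dt.
    + by apply: cvg_at_right_filter; exact: cG.
    + by apply: cvg_at_left_filter; apply: cG; exact: lt_trans d'M'.
  - move=> t /[!in_itv]/= /andP[dt _]; rewrite derive1E; apply: derive_val.
    by apply: dG; exact: lt_trans dt.
have iI : leb.-integrable I (EFin \o f).
  apply: continuous_compact_integrable; first exact: segment_compact.
  apply: continuous_in_subspaceT => t; rewrite inE /I/= in_itv/= => /andP[dt _].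
  by apply: cf; exact: lt_le_trans dt.
transitivity (\int[leb]_(t in I) ((EFin \o f)^\+ t))%E.
  under eq_integral do rewrite funeposE.
  have := restr (fun y => maxe y 0)%E; rewrite maxxx => /(_ erefl) /= ->.
  apply: eq_integral => t.
  rewrite inE /I/= in_itv/= => /andP[dt _]; rewrite funeposE /f/= EFinM.
  rewrite maxe_pMl// ?mul0e// lee_fin exprn_ge0//.
  by rewrite (le_trans _ dt)// ltW.
transitivity (\int[leb]_(t in I) ((EFin \o f)^\- t))%E.
  have fp : (\int[leb]_(t in I) ((EFin \o f)^\+ t))%E \is a fin_num.
    by apply: integrable_pos_fin_num => //; exact: measurable_itv.
  have fn : (\int[leb]_(t in I) ((EFin \o f)^\- t))%E \is a fin_num.
    by apply: integrable_neg_fin_num => //; exact: measurable_itv.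
  move: sF; rewrite integralE -(fineK fp) -(fineK fn) -EFinB => -[] /eqP.
  by rewrite subr_eq0 => /eqP ->.
under [RHS]eq_integral do rewrite funenegE.
have := restr (fun y => maxe (- y) 0)%E; rewrite oppe0 maxxx => /(_ erefl) /= ->.
apply: eq_integral => t.
rewrite inE /I/= in_itv/= => /andP[dt _]; rewrite funenegE /f/= -mulNr EFinM.
rewrite maxe_pMl// ?mul0e// lee_fin exprn_ge0//.
by rewrite (le_trans _ dt)// ltW.
Unshelve. all: by end_near. Qed.

Local Notation w c := (fun x => r x `^ (- c)).

Lemma continuous_powR_gt0 (c t : R) : 0 < t -> {for t, continuous (fun t : R => t `^ c)}.
Proof.
move=> t0; apply: differentiable_continuous; apply/derivable1_diffP.
by have [] := is_derive1_powR c t0.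
Qed.

Lemma loc_bounded_powR c : loc_bounded (fun x => r x `^ c).
Proof.
apply: (@loc_bounded_radial (fun t => t `^ c)); first exact: measurable_powR.
by move=> t t0; exact: continuous_powR_gt0.
Qed.

Lemma loc_bounded_inv : loc_bounded (fun x => (r x)^-1).
Proof.
apply: (@loc_bounded_radial (fun t => t^-1)); first exact: measurable_inv.
by move=> t t0; apply: inv_continuous; rewrite gt_eqF.
Qed.

Lemma powR_predE (c t : R) : 0 < t -> t `^ (- c) / t = t `^ (- (c + 1)).
Proof.
move=> t0; rewrite opprD powRB; last by rewrite (gt_eqF t0) implybT.
by rewrite powRr1 ?ltW.
Qed.

Lemma test_fun0 u : test_fun u -> u 0 = 0.
Proof. by move=> tu; have [_ _ u0] := tu; have [] := test_fun_off_supp tu u0. Qed.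

Lemma test_fun_at0 u x : x = 0 -> test_fun u -> u x = 0 /\ g u x = 0.
Proof. by move=> -> tu; have [_ _ u0] := tu; exact: test_fun_off_supp. Qed.

Lemma test_fun_IBP_pow u c : test_fun u ->
  2 * \int[lebN]_x (u x * g u x * w c x) =
  (c + 1 - N%:R) * \int[lebN]_x (u x * u x * w (c + 1) x).
Proof.
move=> tu.
rewrite (@test_fun_IBP _ (fun t => t `^ (- c)) (fun t => - c * t `^ (- c - 1)))//.
- rewrite -RintegralZl//; last first.
    apply: annular_integrable; apply: annularM; last exact: loc_bounded_powR.
    by apply: annularM; [|apply: annular_loc]; exact: annular_test_fun.
  rewrite -[LHS]mulN1r -RintegralZl//; last first.
    apply: annular_integrable; apply: annularM.
      by apply: annularM; [|apply: annular_loc]; exact: annular_test_fun.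
    apply: (@loc_bounded_radial (fun t => - c * t `^ (- c - 1) + (N%:R - 1) * (t `^ (- c) / t))).
      apply: measurable_funD; first by apply: measurable_funM => //; exact: measurable_powR.
      apply: measurable_funM => //; apply: measurable_funM; first exact: measurable_powR.
      exact: measurable_inv.
    move=> t t0; apply: cvgD; apply: cvgM; try exact: cvg_cst.
      exact: continuous_powR_gt0.
    by apply: cvgM; [exact: continuous_powR_gt0|apply: inv_continuous; rewrite gt_eqF].
  apply: eq_Rintegral => x _; have [->|x0] := eqVneq x 0.
    by rewrite test_fun0// !(mul0r, mulr0).
  by rewrite powR_predE ?normK_gt0// -opprD; ring.
- by apply: measurable_funM => //; exact: measurable_powR.
- by move=> t t0; apply: cvgM; [exact: cvg_cst|exact: continuous_powR_gt0].
Qed.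

Lemma annular_CS f h : annular f -> annular h ->
  (\int[lebN]_x (f x * h x)) ^+ 2 <=
  \int[lebN]_x (f x * f x) * \int[lebN]_x (h x * h x).
Proof.
move=> af ah; have lf := annular_loc af; have lh := annular_loc ah.
have a1 := annularM af lf; have a2 := annularM af lh; have a3 := annularM ah lh.
set A := \int[lebN]_x (f x * f x); set B := \int[lebN]_x (h x * h x).
set X := \int[lebN]_x (f x * h x).
have q (l m : R) : 0 <= l ^+ 2 * A + (2 * l * m) * X + m ^+ 2 * B.
  have : 0 <= \int[lebN]_x ((l * f x + m * h x) ^+ 2).
    by apply: Rintegral_ge0 => x _; exact: sqr_ge0.
  suff -> : \int[lebN]_x ((l * f x + m * h x) ^+ 2) =
    l ^+ 2 * A + (2 * l * m) * X + m ^+ 2 * B by [].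
  rewrite -!RintegralZl//; try exact: annular_integrable.
  rewrite -RintegralD//; try (apply: annular_integrable; exact: annularZ).
  rewrite -RintegralD//; last 2 first.
  - by apply: annular_integrable; apply: annularD; exact: annularZ.
  - by apply: annular_integrable; exact: annularZ.
  by apply: eq_Rintegral => x _; ring.
have A0 : 0 <= A by apply: Rintegral_ge0 => x _; rewrite -expr2 sqr_ge0.
have [A_eq0|A_neq0] := eqVneq A 0.
  rewrite A_eq0 mul0r; have [->|X0] := eqVneq X 0; first by rewrite expr0n.
  have := q (- (B + 1) / (2 * X)) 1; rewrite A_eq0 mulr0 add0r expr1n mul1r mulr1.
  have -> : 2 * (- (B + 1) / (2 * X)) * X = - (B + 1) by field.
  by lra.
have := q (- X) A.
rewrite sqrrN; have -> : X ^+ 2 * A + 2 * - X * A * X + A ^+ 2 * B = A * (A * B - X ^+ 2).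
  by ring.
by rewrite pmulr_rge0 ?subr_ge0// lt_neqAle eq_sym A_neq0.
Qed.

Lemma powR_mulD (c d : R) x : x != 0 -> r x `^ (- c) * r x `^ (- d) = r x `^ (- (c + d)).
Proof.
move=> x0; have rx := normK_gt0 hK x0.
by rewrite opprD powRD// (gt_eqF rx) implybT.
Qed.

(** The shift [l = N - 2 b - 2] leaves the norm of the radial derivative
    unchanged: it corresponds to the multiplication of [u] by a power of the
    gauge, and exchanges the two constants. *)
Lemma test_fun_shift u (b l : R) : test_fun u ->
  \int[lebN]_x ((g u x + l * (u x * (r x)^-1)) * w b x *
                ((g u x + l * (u x * (r x)^-1)) * w b x)) =
  \int[lebN]_x (g u x * g u x * w (2 * b) x) +
   l * (l - (N%:R - 2 * b - 2)) * \int[lebN]_x (u x * u x * w (2 * b + 2) x).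
Proof.
move=> tu; have au := annular_test_fun tu; have ag := annular_radial_deriv tu.
have lu := annular_loc au; have lg := annular_loc ag.
have auw := annularM (annularM au lu) (loc_bounded_powR _).
have augw := annularM (annularM au lg) (loc_bounded_powR _).
have aggw := annularM (annularM ag lg) (loc_bounded_powR _).
have -> : l * (l - (N%:R - 2 * b - 2)) * \int[lebN]_x (u x * u x * w (2 * b + 2) x) =
  l * (2 * \int[lebN]_x (u x * g u x * w (2 * b + 1) x)) +
  l ^+ 2 * \int[lebN]_x (u x * u x * w (2 * b + 2) x).
  rewrite test_fun_IBP_pow// -[2 * b + 1 + 1]addrA [1 + 1]addrC -[1 + 1]/(2%:R).
  by ring.
rewrite mulrA -!RintegralZl//; try exact: annular_integrable.
rewrite -RintegralD//; try exact/annular_integrable/annularZ.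
rewrite -RintegralD//; last 2 first.
- exact: annular_integrable.
- by apply: annular_integrable; apply: annularD; exact: annularZ.
apply: eq_Rintegral => x _; have [x0|x0] := eqVneq x 0.
  by have [-> ->] := test_fun_at0 x0 tu; rewrite !(mul0r, mulr0, add0r).
have rx := normK_gt0 hK x0.
have -> : 2 * b + 2 = 2 * b + 1 + 1 by ring.
rewrite -!powR_predE//; have -> : 2 * b = b + b by ring.
rewrite -powR_mulD//.
by field; rewrite gt_eqF.
Qed.

(** Cauchy-Schwarz inequality for [u r ^ - a] and [(R u + l u / r) r ^ - b],
    where [R u] is the radial derivative; the mixed integral is given by the
    integration by parts. *)
Lemma test_fun_ineq u (a b l : R) : test_fun u ->
  ((a + b + 1 - N%:R + 2 * l) / 2 * \int[lebN]_x (u x * u x * w (a + b + 1) x)) ^+ 2 <=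
  \int[lebN]_x (u x * u x * w (2 * a) x) *
  (\int[lebN]_x (g u x * g u x * w (2 * b) x) +
   l * (l - (N%:R - 2 * b - 2)) * \int[lebN]_x (u x * u x * w (2 * b + 2) x)).
Proof.
move=> tu; have au := annular_test_fun tu; have ag := annular_radial_deriv tu.
have lu := annular_loc au; have lg := annular_loc ag.
have auw := annularM (annularM au lu) (loc_bounded_powR _).
have augw := annularM (annularM au lg) (loc_bounded_powR _).
have af := annularM au (loc_bounded_powR (- a)).
have ah0 := annularM (annularD ag (annularZ l (annularM au loc_bounded_inv)))
  (loc_bounded_powR (- b)).
have := annular_CS af ah0; congr (_ <= _); last congr (_ * _).
- congr (_ ^+ 2).
  have -> : (a + b + 1 - N%:R + 2 * l) / 2 * \int[lebN]_x (u x * u x * w (a + b + 1) x) =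
      2^-1 * ((a + b + 1 - N%:R) * \int[lebN]_x (u x * u x * w (a + b + 1) x)) +
      l * \int[lebN]_x (u x * u x * w (a + b + 1) x) by field.
  rewrite -test_fun_IBP_pow// mulrA mulVf ?pnatr_eq0// mul1r.
  rewrite -RintegralZl//; last exact: annular_integrable.
  rewrite -RintegralD//; last 2 first.
  - exact: annular_integrable.
  - exact/annular_integrable/annularZ.
  apply: eq_Rintegral => x _; have [->|x0] := eqVneq x 0.
    by rewrite test_fun0// !(mul0r, mulr0, add0r).
  have rx := normK_gt0 hK x0.
  rewrite -(powR_predE (a + b) rx) -powR_mulD//.
  by field; rewrite gt_eqF.
- apply: eq_Rintegral => x _; have [->|x0] := eqVneq x 0.
    by rewrite test_fun0// !(mul0r, mulr0).
  have -> : 2 * a = a + a by ring.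
  by rewrite -powR_mulD//; ring.
- exact: test_fun_shift.
Qed.

Lemma loc_boundedM w1 w2 : loc_bounded w1 -> loc_bounded w2 ->
  loc_bounded (fun x => w1 x * w2 x).
Proof.
move=> [m1 b1] [m2 b2]; split; first exact: measurable_funM.
move=> d M d0; have [C1 H1] := b1 d M d0; have [C2 H2] := b2 d M d0.
by exists (C1 * C2) => x dM; rewrite normrM ler_pM// ?H1// H2.
Qed.

(** For [l = (N - 2 b - 2) / 2] the integral of [test_fun_shift] is the deficit in
    the Hardy inequality. Testing it against [u k(r)], with [k(t) = t / (1 + t)]
    bounded, the integration by parts leaves the derivative of [k] only, and
    [t k'(t) = t / (1 + t) ^ 2] is positive. *)
Lemma test_fun_hardy_ineq u (b : R) : test_fun u ->
  (\int[lebN]_x (u x * u x * (w (2 * b + 2) x * (r x / (1 + r x) ^+ 2)))) ^+ 2 <=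
  4 * \int[lebN]_x (u x * u x * w (2 * b + 2) x) *
  (\int[lebN]_x (g u x * g u x * w (2 * b) x) -
   ((N%:R - 2 * b - 2) / 2) ^+ 2 * \int[lebN]_x (u x * u x * w (2 * b + 2) x)).
Proof.
move=> tu; have au := annular_test_fun tu; have ag := annular_radial_deriv tu.
have lu := annular_loc au; have lg := annular_loc ag.
pose c0 := (N%:R - 2 * b - 2) / 2.
pose k (t : R) := t * (1 + t)^-1.
have m1t : measurable_fun setT (fun t : R => (1 + t)^-1).
  by apply: (measurableT_comp measurable_inv); exact: measurable_funD.
have mk : measurable_fun setT k by exact: measurable_funM.
have n1t (t : R) : 0 < t -> 1 + t != 0 by move=> t0; rewrite gt_eqF// addr_gt0.
have c1t (t : R) : 0 < t -> {for t, continuous (fun t : R => (1 + t)^-1)}.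
  move=> t0; apply: (@continuous_comp _ _ _ (fun t : R => 1 + t) (fun t : R => t^-1)).
    by apply: cvgD; [exact: cvg_cst|exact: cvg_id].
  by apply: inv_continuous; exact: n1t.
have ck (t : R) : 0 < t -> {for t, continuous k}.
  by move=> t0; apply: cvgM; [exact: cvg_id|exact: c1t].
have dk (t : R) : 0 < t -> is_derive t (1 : R) k ((1 + t)^-1 ^+ 2).
  move=> t0; have nt := n1t t t0.
  have d1 : is_derive t (1 : R) (cst (1 : R) + id) 1.
    by apply: is_derive_eq; rewrite add0r.
  have d2 := @is_deriveV R (cst (1 : R) + id) t 1 1 nt d1.
  have := is_deriveM (is_derive_id t (1 : R)) d2 => /is_derive_eq; apply.
  have -> : (cst (1 : R) + id) t = 1 + t by [].
  by rewrite /GRing.scale/=; field.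
have lk : loc_bounded (fun x => k (r x)) by exact: (@loc_bounded_radial k).
have lth : loc_bounded (fun x => r x / (1 + r x) ^+ 2).
  apply: (@loc_bounded_radial (fun t => t / (1 + t) ^+ 2)).
    apply: measurable_funM => //; apply: (measurableT_comp measurable_inv).
    by apply: measurable_funX; exact: measurable_funD.
  move=> t t0; apply: cvgM; first exact: cvg_id.
  apply: (@continuous_comp _ _ _ (fun t : R => (1 + t) ^+ 2) (fun t : R => t^-1)).
    apply: (@continuous_comp _ _ _ (fun t : R => 1 + t) (fun t : R => t ^+ 2)).
      by apply: cvgD; [exact: cvg_cst|exact: cvg_id].
    exact: exprn_continuous.
  by apply: inv_continuous; rewrite expf_neq0// n1t.
have auk := annularM (annularM au lu) (loc_boundedM (loc_bounded_powR (- (2 * b + 2))) lk).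
have auth := annularM (annularM au lu) (loc_boundedM (loc_bounded_powR (- (2 * b + 2))) lth).
have auw := annularM (annularM au lu) (loc_bounded_powR (- (2 * b + 2))).
have augk := annularM (annularM au lg) (loc_boundedM (loc_bounded_powR (- (2 * b + 1))) lk).
have af := annularM au (loc_boundedM (loc_bounded_powR (- (b + 1))) lk).
have ah := annularM (annularD ag (annularZ c0 (annularM au loc_bounded_inv)))
  (loc_bounded_powR (- b)).
set X := \int[lebN]_x _; set A := \int[lebN]_x (u x * u x * w (2 * b + 2) x).
set Y := \int[lebN]_x (u x * u x * (w (2 * b + 2) x * k (r x))).
pose om (t : R) := t `^ (- (2 * b + 1)) * k t.
pose om' (t : R) := - (2 * b + 1) * t `^ (- (2 * b + 1) - 1) * k t +
  t `^ (- (2 * b + 1)) * (1 + t)^-1 ^+ 2.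
have mom : measurable_fun setT om.
  by apply: measurable_funM => //; exact: measurable_powR.
have mom' : measurable_fun setT om'.
  apply: measurable_funD; apply: measurable_funM => //.
  - by apply: measurable_funM => //; exact: measurable_powR.
  exact: measurable_funX.
have dom (t : R) : 0 < t -> is_derive t (1 : R) om (om' t).
  move=> t0; have dp := @is_derive1_powR R (- (2 * b + 1)) t t0.
  have := is_deriveM dp (dk t t0) => /is_derive_eq; apply.
  by rewrite /om' /GRing.scale/=; ring.
have com' (t : R) : 0 < t -> {for t, continuous om'}.
  move=> t0; apply: cvgD; apply: cvgM.
  - by apply: cvgM; [exact: cvg_cst|exact: continuous_powR_gt0].
  - exact: ck.
  - exact: continuous_powR_gt0.
  - apply: (@continuous_comp _ _ _ (fun t : R => (1 + t)^-1) (fun t : R => t ^+ 2)).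
      exact: c1t.
    exact: exprn_continuous.
have IBP := test_fun_IBP tu mom mom' dom com'.
have fh := annular_CS af ah; rewrite test_fun_shift// in fh.
have E1 : 2 * \int[lebN]_x (u x * g u x * (w (2 * b + 1) x * k (r x))) =
    - (2 * c0 * Y + X).
  rewrite IBP /om /om'.
  rewrite -RintegralZl//; last exact: annular_integrable.
  rewrite -RintegralD//; last 2 first.
  - exact/annular_integrable/annularZ.
  - exact: annular_integrable.
  congr (- _); apply: eq_Rintegral => x _; have [->|x0] := eqVneq x 0.
    by rewrite test_fun0// !(mul0r, mulr0) addr0.
  have rx := normK_gt0 hK x0.
  have -> : 2 * b + 2 = 2 * b + 1 + 1 by ring.
  rewrite -(opprD (2 * b + 1)) -!(powR_predE (2 * b + 1) rx) /k /c0.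
  by field; rewrite n1t// gt_eqF.
have E2 : \int[lebN]_x (u x * (w (b + 1) x * k (r x)) *
      ((g u x + c0 * (u x * (r x)^-1)) * w b x)) = - X / 2.
  have -> : - X / 2 = 2^-1 * (- (2 * c0 * Y + X)) + c0 * Y by field.
  rewrite -E1 mulrA mulVf ?pnatr_eq0// mul1r.
  rewrite -RintegralZl//; last exact: annular_integrable.
  rewrite -RintegralD//; last 2 first.
  - exact: annular_integrable.
  - exact/annular_integrable/annularZ.
  apply: eq_Rintegral => x _; have [->|x0] := eqVneq x 0.
    by rewrite test_fun0// !(mul0r, mulr0, addr0).
  have rx := normK_gt0 hK x0.
  have -> : 2 * b + 2 = 2 * b + 1 + 1 by ring.
  rewrite -(powR_predE (2 * b + 1) rx).
  have -> : 2 * b + 1 = b + 1 + b by ring.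
  by rewrite -!(@powR_mulD (b + 1) b)//; field; rewrite gt_eqF.
have E3 : \int[lebN]_x (u x * (w (b + 1) x * k (r x)) * (u x * (w (b + 1) x * k (r x)))) <= A.
  apply: le_Rintegral => //; try exact: annular_integrable.
    by apply: annular_integrable; apply: annularM => //; exact: annular_loc.
  move=> x _; have [->|x0] := eqVneq x 0.
    by rewrite test_fun0// !(mul0r, mulr0).
  have rx := normK_gt0 hK x0.
  have -> : 2 * b + 2 = b + 1 + (b + 1) by ring.
  rewrite -(@powR_mulD (b + 1) (b + 1))//.
  have -> : u x * (r x `^ (- (b + 1)) * k (r x)) * (u x * (r x `^ (- (b + 1)) * k (r x))) =
    u x * u x * (r x `^ (- (b + 1)) * r x `^ (- (b + 1))) * k (r x) ^+ 2 by ring.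
  rewrite ler_piMr//.
    by rewrite mulr_ge0 -?expr2 ?sqr_ge0// mulr_ge0// powR_ge0.
  rewrite expr_le1// /k ?mulr_ge0 ?invr_ge0 ?addr_ge0 ?ltW//.
  by rewrite ltr_pdivrMr ?mul1r ?ltrDr// addr_gt0.
rewrite E2 in fh.
have q0 : 0 <= \int[lebN]_x (g u x * g u x * w (2 * b) x) - c0 ^+ 2 * A.
  have := @test_fun_shift u b c0 tu.
  have -> : c0 * (c0 - (N%:R - 2 * b - 2)) = - c0 ^+ 2 by rewrite /c0; field.
  rewrite mulNr -/A => <-; apply: Rintegral_ge0 => x _.
  by rewrite -expr2 sqr_ge0.
have -> : X ^+ 2 = 4 * (- X / 2) ^+ 2 by field.
rewrite -mulrA ler_pM2l// (le_trans fh)//.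
have -> : c0 * (c0 - (N%:R - 2 * b - 2)) = - c0 ^+ 2 by rewrite /c0; field.
by rewrite mulNr -/A ler_wpM2r.
Qed.

End test_function_inequalities.

(** * The inequality on the completion *)

Section completion.
Context {R : realType} {N : nat} (K : set 'rV[R]_N) (hK : Kss_o K).
Hypothesis hN : (2 <= N)%N.
Implicit Types (u v g w phi : 'rV[R]_N -> R) (x : 'rV[R]_N) (a b c : R).
Local Notation leb := (@lebesgue_measure R).
Local Notation lebN := (@lebesgue_rV R N).
Local Notation r := (normK K).

Definition qint w u : \bar R := (\int[lebN]_x (u x ^+ 2 * w x)%:E)%E.

Definition weight w := measurable_fun setT w /\ forall x, 0 <= w x.

Lemma weight_pow c : weight (fun x => (r x `^ c)^-1).
Proof.
split=> [|x]; last by rewrite invr_ge0 powR_ge0.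
apply: (measurableT_comp measurable_inv).
by apply: (measurableT_comp (@measurable_powR R c)); exact: measurable_normK.
Qed.

Lemma measurable_qint w u : weight w -> measurable_fun setT u ->
  measurable_fun setT (fun x => (u x ^+ 2 * w x)%:E).
Proof.
move=> [mw _] mu; apply/measurable_EFinP; apply: measurable_funM => //.
exact: measurable_funX.
Qed.

Lemma qint_ge0 w u : weight w -> (0 <= qint w u)%E.
Proof. by move=> [_ w0]; apply: integral_ge0 => x _; rewrite lee_fin mulr_ge0 ?sqr_ge0. Qed.

Lemma qint_le w w' u v : weight w -> weight w' ->
  measurable_fun setT u -> measurable_fun setT v ->
  (forall x, u x ^+ 2 * w x <= v x ^+ 2 * w' x) -> (qint w u <= qint w' v)%E.
Proof.
move=> ww ww' mu mv uv; apply: ge0_le_integral => //.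
- by move=> x _; rewrite lee_fin mulr_ge0 ?sqr_ge0//; case: ww.
- exact: measurable_qint.
- exact: measurable_qint.
- by move=> x _; rewrite lee_fin.
Qed.

Lemma qint_comb (c d : R) w w' w'' u v v' :
  weight w -> weight w' -> weight w'' -> measurable_fun setT u -> measurable_fun setT v ->
  measurable_fun setT v' -> 0 <= c -> 0 <= d ->
  (forall x, u x ^+ 2 * w x <= c * (v x ^+ 2 * w' x) + d * (v' x ^+ 2 * w'' x)) ->
  (qint w u <= c%:E * qint w' v + d%:E * qint w'' v')%E.
Proof.
move=> ww ww' ww'' mu mv mv' c0 d0 uv.
have p w1 u1 x : weight w1 -> 0 <= u1 x ^+ 2 * w1 x.
  by move=> [_ w0]; rewrite mulr_ge0 ?sqr_ge0.
rewrite /qint -ge0_integralZl_EFin//; last 2 first.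
- by move=> x _; rewrite lee_fin; exact: p.
- exact: measurable_qint.
rewrite -ge0_integralZl_EFin//; last 2 first.
- by move=> x _; rewrite lee_fin; exact: p.
- exact: measurable_qint.
rewrite -ge0_integralD//; last 4 first.
- by move=> x _; rewrite lee_fin mulr_ge0//; exact: p.
- by apply: measurable_funeM; exact: measurable_qint.
- by move=> x _; rewrite lee_fin mulr_ge0//; exact: p.
- by apply: measurable_funeM; exact: measurable_qint.
apply: ge0_le_integral => //.
- by move=> x _; rewrite lee_fin; exact: p.
- exact: measurable_qint.
- by apply: emeasurable_funD; apply: measurable_funeM; exact: measurable_qint.
- by move=> x _; rewrite -!EFinM -EFinD lee_fin.
Qed.

(** Young's inequality. Letting [d] tend to [0] replaces the triangle inequality
    for square roots. *)
Lemma qint_young (d k : R) w w' u v : weight w -> weight w' ->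
  measurable_fun setT u -> measurable_fun setT v -> 0 < d -> 0 <= k ->
  (forall x, w x <= k * w' x) ->
  (qint w u <= (1 + d)%:E * qint w v + ((1 + d^-1) * k)%:E * qint w' (v \- u)%R)%E.
Proof.
move=> ww ww' mu mv d0 k0 wk.
apply: qint_comb => //.
- exact: measurable_funB.
- by rewrite addr_ge0// ltW.
- by rewrite mulr_ge0// addr_ge0// invr_ge0 ltW.
move=> x; have w0 : 0 <= w x by case: ww.
apply: (@le_trans _ _ ((1 + d) * (v x ^+ 2 * w x) + (1 + d^-1) * ((v x - u x) ^+ 2 * w x))).
  rewrite [(1 + d) * _]mulrA [(1 + d^-1) * _]mulrA -mulrDl ler_wpM2r//.
  rewrite -subr_ge0.
  have -> : (1 + d) * v x ^+ 2 + (1 + d^-1) * (v x - u x) ^+ 2 - u x ^+ 2 =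
    d^-1 * (d * v x + (v x - u x)) ^+ 2 by field; rewrite gt_eqF.
  by rewrite mulr_ge0 ?sqr_ge0// invr_ge0 ltW.
rewrite lerD2l -[(1 + d^-1) * k * _]mulrA ler_wpM2l ?addr_ge0 ?invr_ge0 ?(ltW d0)//.
by rewrite mulrCA ler_wpM2l ?sqr_ge0.
Qed.

(** The squared norm of the completion. *)
Definition energy a b u g : \bar R := (wint K (2 * b) g + wint K (2 * a) u)%E.

Lemma wintE c u : wint K c u = qint (fun x => (r x `^ c)^-1) u. Proof. by []. Qed.

Lemma wint_ge0 c u : (0 <= wint K c u)%E.
Proof. by rewrite wintE; apply: qint_ge0; exact: weight_pow. Qed.

Lemma energy_ge0 a b u g : (0 <= energy a b u g)%E.
Proof. by rewrite adde_ge0// wint_ge0. Qed.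

Definition approximable a b u g := forall e : R, 0 < e ->
  exists2 phi, test_fun phi & (energy a b (phi \- u)%R (radial_deriv K phi \- g)%R <= e%:E)%E.

Lemma in_completionP a b u g : measurable_fun setT u -> measurable_fun setT g ->
  in_completion K a b u g <-> approximable a b u g.
Proof.
move=> mu mg; split.
  move=> [_ _ [phi tphi /fine_cvgP[nfin /cvgr0Pnorm_lt cv]]] e e0.
  have s0 : 0 < Num.sqrt e by rewrite sqrtr_gt0.
  near \oo => n.
  have : C_norm K a b (phi n \- u) (radial_deriv K (phi n) \- g) \is a fin_num.
    by near: n.
  have : `|(fine \o (fun n => C_norm K a b (phi n \- u) (radial_deriv K (phi n) \- g))) n| < Num.sqrt e.
    by near: n; exact: cv.
  rewrite /= /C_norm -/(energy a b _ _).
  have := energy_ge0 a b (phi n \- u) (radial_deriv K (phi n) \- g).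
  set E := energy _ _ _ _ => E0 Ee Efin; exists (phi n); first exact: tphi.
  rewrite -/E; move: E0 Efin Ee; case: E => [y| |]//=; last first.
    by rewrite invr_eq0 pnatr_eq0.
  rewrite !lee_fin => y0 _; rewrite powR12_sqrt// ger0_norm ?sqrtr_ge0//.
  by rewrite ltr_sqrt// => /ltW.
move=> ap; split => //.
have /choice[phi phiP] : forall n : nat, exists phi, test_fun phi /\
    (energy a b (phi \- u)%R (radial_deriv K phi \- g)%R <= ((n.+1%:R^-1) ^+ 2)%:E)%E.
  move=> n; have [|phi tphi pe] := ap ((n.+1%:R^-1) ^+ 2); last by exists phi.
  by rewrite exprn_gt0// invr_gt0 ltr0n.
exists phi; first by move=> n; case: (phiP n).
apply: (squeeze_cvge _ (cvg_cst 0%E) cvge_harmonic).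
apply: nearW => n; rewrite poweR_ge0/=.
  have [_ h] := phiP n.
  have -> : (n.+1%:R^-1 : R) = (n.+1%:R^-1 ^+ 2) `^ 2^-1.
    by rewrite powR12_sqrt ?sqr_ge0// sqrtr_sqr ger0_norm// invr_ge0.
  rewrite -poweR_EFin; apply: gt0_ler_poweR => //.
  - by rewrite in_itv/= energy_ge0 leey.
  - by rewrite in_itv/= lee_fin sqr_ge0 leey.
Unshelve. all: by end_near. Qed.

Lemma wint_annular c f : annular K f ->
  wint K c f = (\int[lebN]_x (f x * f x * r x `^ (- c)))%:E.
Proof.
move=> af; rewrite fineK.
  by apply: eq_integral => x _; rewrite powRN expr2.
apply: integrable_fin_num => //; apply: (annular_integrable hK).
apply: annularM; last exact: loc_bounded_powR.
by apply: annularM => //; exact: annular_loc.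
Qed.

Lemma hup_inequality_sqr a b (C : R) : 0 <= C ->
  (forall u, test_fun u ->
    (C * \int[lebN]_x (u x * u x * r x `^ (- (a + b + 1)))) ^+ 2 <=
    \int[lebN]_x (u x * u x * r x `^ (- (2 * a))) *
    \int[lebN]_x (radial_deriv K u x * radial_deriv K u x * r x `^ (- (2 * b)))) ->
  hup_inequality K a b C.
Proof.
move=> C0 H u tu; have au := annular_test_fun hK tu; have ag := annular_radial_deriv hK tu.
rewrite /hup_lhs !wint_annular// -EFinM !poweR_EFin -EFinM lee_fin.
have p c f : 0 <= \int[lebN]_x (f x * f x * r x `^ (- c)).
  by apply: Rintegral_ge0 => x _; rewrite mulr_ge0 ?powR_ge0// -expr2 sqr_ge0.
rewrite !powR12_sqrt ?p// -sqrtrM ?p// mulrC.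
rewrite -[leLHS]ger0_norm ?mulr_ge0 ?p// -sqrtr_sqr ler_wsqrtr//.
by rewrite [_ * C]mulrC [leRHS]mulrC H.
Qed.

(** Completing the square without a shift gives the first constant. *)
Lemma hup_inequality1 a b : hup_inequality K a b `|(N%:R - a - b - 1) / 2|.
Proof.
apply: hup_inequality_sqr => // u tu.
rewrite exprMn real_normK ?num_real// -exprMn.
have := test_fun_ineq hK hN a b 0 tu; rewrite mul0r mul0r addr0 mulr0 addr0.
move=> h; apply: le_trans h; rewrite !exprMn le_eqVlt; apply/orP; left; apply/eqP; ring.
Qed.

(** The shift of [test_fun_shift] gives the second one. *)
Lemma hup_inequality2 a b : hup_inequality K a b `|(N%:R - 3 * b + a - 3) / 2|.
Proof.
apply: hup_inequality_sqr => // u tu.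
rewrite exprMn real_normK ?num_real// -exprMn.
have := test_fun_ineq hK hN a b (N%:R - 2 * b - 2) tu; rewrite subrr mulr0 mul0r addr0.
move=> h; apply: le_trans h; rewrite !exprMn le_eqVlt; apply/orP; left; apply/eqP; ring.
Qed.

Lemma le_at_right0 (X : R) (f : R -> R) : {for 0, continuous f} ->
  (forall d, 0 < d -> X <= f d) -> X <= f 0.
Proof.
move=> cf Xf; apply: (cvgr_to_ge (cvg_at_right_filter cf)); by near=> d; apply: Xf; near: d; exact: nbhs_right_gt.
Unshelve. all: by end_near. Qed.

(** Approximation by test functions, in a form in which all the errors are
    polynomials in one parameter. *)
Lemma approximable_test a b u g : measurable_fun setT u -> measurable_fun setT g ->
  approximable a b u g ->
  exists M G : R, [/\ wint K (2 * a) u = M%:E, wint K (2 * b) g = G%:E, 0 <= M, 0 <= G &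
  forall d : R, 0 < d -> exists phi (M' G' : R),
    [/\ test_fun phi, wint K (2 * a) phi = M'%:E, wint K (2 * b) (radial_deriv K phi) = G'%:E &
    [/\ M' <= (1 + d) * M + (d ^+ 2 + d), G' <= (1 + d) * G + (d ^+ 2 + d),
     M <= (1 + d) * M' + (d ^+ 2 + d) &
     forall k w, 0 <= k -> weight w -> (forall x, w x <= k * (r x `^ (2 * a))^-1) ->
       (qint w u <= (1 + d)%:E * qint w phi + (k * (d ^+ 2 + d))%:E)%E]]].
Proof.
move=> mu mg ap.
have step d : 0 < d -> exists phi, [/\ test_fun phi,
    (wint K (2 * a) (phi \- u)%R <= (d ^+ 2)%:E)%E &
    (wint K (2 * b) (radial_deriv K phi \- g)%R <= (d ^+ 2)%:E)%E].
  move=> d0; have [|phi tphi pe] := ap (d ^+ 2); first exact: exprn_gt0.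
  exists phi; split => //; apply: le_trans pe; rewrite /energy.
    by rewrite leeDr// wint_ge0.
  by rewrite leeDl// wint_ge0.
have comp (d c : R) (f h : 'rV[R]_N -> R) (k : R) w : 0 < d -> 0 <= k -> weight w ->
    (forall x, w x <= k * (r x `^ c)^-1) ->
    measurable_fun setT f -> measurable_fun setT h ->
    (wint K c (h \- f)%R <= (d ^+ 2)%:E)%E ->
    (qint w f <= (1 + d)%:E * qint w h + (k * (d ^+ 2 + d))%:E)%E.
  move=> d0 k0 ww wk mf mh fh.
  apply: le_trans (qint_young ww (weight_pow c) mf mh d0 k0 wk) _.
  apply: leeD => //; apply: (@le_trans _ _ (((1 + d^-1) * k)%:E * (d ^+ 2)%:E)%E).
    by apply: lee_pmul => //; [rewrite lee_fin mulr_ge0// addr_ge0// invr_ge0 ltW|exact: wint_ge0].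
  rewrite -EFinM lee_fin le_eqVlt; apply/orP; left; apply/eqP; field.
  by rewrite gt_eqF.
have sym c (f h : 'rV[R]_N -> R) : wint K c (f \- h) = wint K c (h \- f).
  by apply: eq_integral => x _; congr (_ * _)%:E; rewrite /= -sqrrN opprB.
have compw (d c : R) (f h : 'rV[R]_N -> R) : 0 < d -> measurable_fun setT f -> measurable_fun setT h ->
    (wint K c (h \- f)%R <= (d ^+ 2)%:E)%E ->
    (wint K c f <= (1 + d)%:E * wint K c h + (d ^+ 2 + d)%:E)%E.
  move=> d0 mf mh fh; have := comp _ _ _ _ _ _ d0 ler01 (weight_pow c) _ mf mh fh.
  by rewrite mul1r; apply=> x; rewrite mul1r.
have fin (c : R) (f h : 'rV[R]_N -> R) : measurable_fun setT f -> annular K h ->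
    (wint K c (h \- f)%R <= (1 ^+ 2)%:E)%E -> exists2 M : R, 0 <= M & wint K c f = M%:E.
  move=> mf ah fh; have := compw _ _ _ _ ltr01 mf ah.1 fh.
  rewrite (wint_annular c ah) -EFinM -EFinD; have := wint_ge0 c f.
  by case: (wint K c f) => // M M0 _; exists M.
have [phi [tphi ua gb]] := step 1 ltr01.
have [M M0 ME] := fin _ _ _ mu (annular_test_fun hK tphi) ua.
have [G G0 GE] := fin _ _ _ mg (annular_radial_deriv hK tphi) gb.
exists M, G; split => // d d0.
have {phi tphi ua gb} [phi [tphi ua gb]] := step d d0.
have ma := annular_test_fun hK tphi; have mb := annular_radial_deriv hK tphi.
exists phi; do 2!eexists; split.
- exact: tphi.
- exact: wint_annular.
- exact: wint_annular.
- split.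
  + rewrite -lee_fin -(wint_annular (2 * a) ma) EFinD EFinM -ME.
    by apply: (compw d _ _ _ d0 ma.1 mu); rewrite sym.
  + rewrite -lee_fin -(wint_annular (2 * b) mb) EFinD EFinM -GE.
    by apply: (compw d _ _ _ d0 mb.1 mg); rewrite sym.
  + rewrite -lee_fin EFinD EFinM -(wint_annular (2 * a) ma) -ME.
    exact: (compw d _ _ _ d0 mu ma.1).
  + by move=> k w k0 ww wk; apply: comp ua => //; exact: ma.1.
Qed.

Lemma integral_nonzero (f : 'rV[R]_N -> \bar R) : measurable_fun setT f ->
  (forall x, 0 <= f x)%E ->
  (\int[lebN]_x f x = \int[lebN]_(x in nonzero) f x)%E.
Proof.
move=> mf f0; have m0 := measurable_origin hK.
have -> : @nonzero R N = setT `\` [set 0].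
  by apply/seteqP; split => x /=; [move/eqP; split|move=> [_ /eqP]].
apply: ge0_negligible_integral => //.
exact: lebesgue_origin hK hN.
Qed.

(** The quotient of the two weights is unbounded, so that the right-hand side
    of the inequality is not continuous for the norm of the completion; it is a
    supremum of continuous functionals. *)
Lemma wint_le_sup a b u (B : R) : measurable_fun setT u ->
  (forall k w, 0 <= k -> weight w -> (forall x, w x <= k * (r x `^ (2 * a))^-1) ->
     (forall x, w x <= (r x `^ b)^-1) -> (qint w u <= B%:E)%E) ->
  (wint K b u <= B%:E)%E.
Proof.
move=> mu H; have [mA A0] := weight_pow b; have [mB B0] := weight_pow (2 * a).
pose w (n : nat) x := Num.min ((r x `^ b)^-1) (n%:R * (r x `^ (2 * a))^-1).
have ww n : weight (w n).
  split=> [|x]; last by rewrite /w le_min A0 mulr_ge0.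
  by apply: measurable_minr => //; exact: measurable_funM.
have mnz : measurable (@nonzero R N).
  by apply: open_measurable_mx; exact: open_nonzero.
rewrite wintE /qint integral_nonzero; last 2 first.
- exact: measurable_qint (weight_pow b) mu.
- by move=> x; rewrite lee_fin mulr_ge0 ?sqr_ge0.
pose f n x := (u x ^+ 2 * w n x)%:E.
have mf n : measurable_fun setT (f n) by exact: measurable_qint.
have f0 n x : (0 <= f n x)%E by rewrite lee_fin mulr_ge0 ?sqr_ge0//; case: (ww n).
have cv : (\int[lebN]_(x in nonzero) f n x @[n --> \oo] -->
    \int[lebN]_(x in nonzero) (u x ^+ 2 * (r x `^ b)^-1)%:E)%E.
  rewrite (_ : (\int[lebN]_(x in nonzero) (u x ^+ 2 * (r x `^ b)^-1)%:E)%E =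
      (\int[lebN]_(x in nonzero) limn (f ^~ x))%E); last first.
    apply: eq_integral => x; rewrite inE => x0; apply/esym/cvg_lim => //.
    have rx := normK_gt0 hK x0.
    apply: cvg_near_cst.
    near=> m; rewrite /f /w; congr (_ * _)%:E; apply/min_idPl.
    rewrite -ler_pdivrMr ?invr_gt0 ?powR_gt0//; near: m.
    exact: nbhs_infty_ger.
  apply: cvg_monotone_convergence => //.
  - by move=> n; exact: measurable_funTS.
  - move=> x _ m n mn; rewrite lee_fin ler_wpM2l ?sqr_ge0//.
    by rewrite /w le_min ge_min lexx/= ge_min ler_wpM2r ?orbT// ler_nat.
apply: (cvge_to_le cv); apply: nearW => n.
apply: (@le_trans _ _ (qint (w n) u)).
  by rewrite /qint (integral_nonzero (mf n)).
apply: (H n%:R) => //.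
  by move=> x; rewrite /w ge_min lexx orbT.
by move=> x; rewrite /w ge_min lexx.
Unshelve. all: by end_near. Qed.

(** Both sides of the inequality are continuous once the weight on the left is
    truncated as in [wint_le_sup]. *)
Lemma hup_approximable a b (C : R) u g : 0 <= C -> hup_inequality K a b C ->
  measurable_fun setT u -> measurable_fun setT g -> approximable a b u g ->
  (C%:E * wint K (a + b + 1) u <= hup_lhs K a b u g)%E.
Proof.
move=> C0 HC mu mg ap; have [M [G [ME GE M0 G0 H]]] := approximable_test mu mg ap.
rewrite /hup_lhs ME GE !poweR_EFin -EFinM !powR12_sqrt// -sqrtrM//.
have [->|Cn0] := eqVneq C 0; first by rewrite mul0e lee_fin sqrtr_ge0.
have {C0 Cn0}C0 : 0 < C by rewrite lt_neqAle eq_sym Cn0.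
rewrite -lee_pdivlMl// -EFinM; apply: (@wint_le_sup a) => // k w k0 ww wa wb.
rewrite EFinM lee_pdivlMl//.
have [Q QE] : exists Q : R, qint w u = Q%:E.
  have := qint_ge0 u ww.
  have : (qint w u <= k%:E * wint K (2 * a) u)%E.
    have := qint_comb ww (weight_pow (2 * a)) (weight_pow (2 * a)) mu mu mu k0 (lexx 0).
    rewrite mul0e adde0; apply=> x; rewrite mul0r addr0 mulrCA.
    by rewrite ler_wpM2l ?sqr_ge0.
  by rewrite ME -EFinM; case: (qint w u) => // Q _ _; exists Q.
rewrite QE -EFinM lee_fin.
pose F d := (1 + d) * Num.sqrt (((1 + d) * G + (d ^+ 2 + d)) * ((1 + d) * M + (d ^+ 2 + d))) +
   C * (k * (d ^+ 2 + d)).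
have -> : Num.sqrt (G * M) = F 0 by rewrite /F expr0n/= !addr0 mul1r mulr0 mulr0 addr0 !mul1r.
apply: le_at_right0.
  have c2 : {for 0, continuous (fun d : R => d ^+ 2 + d)}.
    by apply: cvgD; [exact: exprn_continuous|exact: cvg_id].
  have c1 : {for 0, continuous (fun d : R => 1 + d)}.
    by apply: cvgD; [exact: cvg_cst|exact: cvg_id].
  have cl c : {for 0, continuous (fun d : R => (1 + d) * c + (d ^+ 2 + d))}.
    by apply: cvgD => //; apply: cvgM => //; exact: cvg_cst.
  apply: cvgD; apply: cvgM => //; try exact: cvg_cst.
    apply: (@continuous_comp _ _ _ (fun d : R => ((1 + d) * G + (d ^+ 2 + d)) *
      ((1 + d) * M + (d ^+ 2 + d))) (@Num.sqrt R)); last exact: sqrt_continuous.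
    by apply: cvgM; exact: cl.
  by apply: cvgM => //; exact: cvg_cst.
move=> d d0; have [phi [M' [G' [tphi ME' GE' [hM hG _ hw]]]]] := H d d0.
have M'0 : 0 <= M' by rewrite -lee_fin -ME' wint_ge0.
have G'0 : 0 <= G' by rewrite -lee_fin -GE' wint_ge0.
have := HC _ tphi; rewrite /hup_lhs ME' GE' !poweR_EFin -EFinM !powR12_sqrt// -sqrtrM// => h1.
have h2 : (qint w phi <= wint K (a + b + 1) phi)%E.
  have mphi := (annular_test_fun hK tphi).1.
  apply: qint_le => //; first exact: weight_pow.
  by move=> x; rewrite ler_wpM2l ?sqr_ge0.
have h3 := hw _ _ k0 ww wa; rewrite QE in h3.
have d10 : 0 <= 1 + d by rewrite addr_ge0// ltW.
rewrite /F; apply: (@le_trans _ _ (C * ((1 + d) * (Num.sqrt (G' * M') / C) + k * (d ^+ 2 + d)))).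
  rewrite ler_pM2l// -lee_fin; apply: le_trans h3 _.
  rewrite [leRHS]EFinD; apply: leeD => //; rewrite [leRHS]EFinM; apply: lee_pmul => //.
    exact: qint_ge0.
  by apply: le_trans h2 _; rewrite mulrC EFinM lee_pdivlMl.
rewrite mulrDr lerD2r mulrCA; have -> : C * (Num.sqrt (G' * M') / C) = Num.sqrt (G' * M').
  by field; rewrite gt_eqF.
by rewrite ler_wpM2l// ler_wsqrtr// ler_pM.
Qed.

(** At equality the deficit in the Hardy inequality vanishes, hence so does the
    remainder of [test_fun_hardy_ineq], which passes to the limit since its weight
    is dominated by the one of the norm, and which is positive off the origin. *)
Lemma hardy_not_achieved b u g (M : R) :
  measurable_fun setT u -> measurable_fun setT g -> approximable (b + 1) b u g ->
  wint K (2 * (b + 1)) u = M%:E ->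
  (wint K (2 * b) g * M%:E = (((N%:R - 2 * b - 2) / 2) ^+ 2 * M ^+ 2)%:E)%E ->
  ~ nonzero_fun u.
Proof.
move=> mu mg ap ME0; have [M' [G [ME GE M0 G0 H]]] := approximable_test mu mg ap.
move: M0 H; have {ME0 M' ME} [-> ME] : M' = M /\ wint K (2 * (b + 1)) u = M%:E.
  by split=> //; apply: EFin_inj; rewrite -ME -ME0.
move=> M0 H; rewrite GE -EFinM => -[] eqGM.
set c0 := (N%:R - 2 * b - 2) / 2 in eqGM *.
pose om x := r x / (1 + r x) ^+ 2 * (r x `^ (2 * b + 2))^-1.
have r0 := normK_ge0 hK.
have om1 x : 0 <= r x / (1 + r x) ^+ 2 <= 1.
  have h : 0 < (1 + r x) ^+ 2 by rewrite exprn_gt0// (lt_le_trans ltr01)// lerDl.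
  rewrite divr_ge0 ?(ltW h)// ler_pdivrMr// mul1r.
  by have := sqr_ge0 (r x); rewrite sqrrD expr1n mul1r; have := r0 x; lra.
have mr : measurable_fun setT r := measurable_normK hK.
have wom : weight om.
  split=> [|x]; last by have /andP[? _] := om1 x; rewrite mulr_ge0// invr_ge0 powR_ge0.
  apply: measurable_funM; last exact: (weight_pow _).1.
  apply: measurable_funM => //; apply: (measurableT_comp measurable_inv).
  by apply: measurable_funX; exact: measurable_funD.
have b2 : 2 * (b + 1) = 2 * b + 2 by ring.
have omle x : om x <= 1 * (r x `^ (2 * (b + 1)))^-1.
  rewrite b2 mul1r -[leRHS]mul1r ler_wpM2r ?invr_ge0 ?powR_ge0//.
  by case/andP: (om1 x).
suff X0 : qint om u = 0%E.
  apply; move: X0; rewrite /qint => X0.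
  have mq := measurable_qint wom mu.
  have : (\int[lebN]_x `|(u x ^+ 2 * om x)%:E| = 0)%E.
    rewrite -X0; apply: eq_integral => x _; rewrite gee0_abs// lee_fin.
    by rewrite mulr_ge0 ?sqr_ge0//; case: wom.
  move/(ae_eq_integral_abs _ measurableT mq).1.
  have : {ae lebN, forall x, x != 0}.
    exists [set 0]; split; [exact: measurable_origin hK|exact: lebesgue_origin hK hN|].
    by move=> x /= /negP; rewrite negbK => /eqP.
  apply: filterS2 => x x0 /(_ I) [] /eqP.
  have rx := normK_gt0 hK x0.
  rewrite mulf_eq0 sqrf_eq0 => /orP[/eqP//|].
  rewrite /om gt_eqF// mulr_gt0 ?invr_gt0 ?powR_gt0// divr_gt0// exprn_gt0//.
  by rewrite addr_gt0.
have X0 := qint_ge0 u wom.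
apply/eqP; rewrite eq_le X0 andbT.
have [X XE] : exists X : R, qint om u = X%:E.
  have : (qint om u <= M%:E)%E.
    rewrite -ME; apply: qint_le => //; first exact: weight_pow.
    by move=> x; rewrite ler_wpM2l ?sqr_ge0// -[leRHS]mul1r.
  by move: X0; case: (qint om u) => // X _ _; exists X.
rewrite XE lee_fin.
pose F d := (1 + d) * Num.sqrt (4 * ((1 + d) * M + (d ^+ 2 + d)) *
  ((1 + d) * G + (d ^+ 2 + d) - c0 ^+ 2 * ((M - (d ^+ 2 + d)) / (1 + d)))) + (d ^+ 2 + d).
have <- : F 0 = 0.
  rewrite /F expr0n/= !addr0 subr0 !mul1r divr1.
  have -> : 4 * M * (G - c0 ^+ 2 * M) = 4 * (G * M - c0 ^+ 2 * M ^+ 2) by ring.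
  by rewrite eqGM subrr mulr0 sqrtr0.
apply: le_at_right0.
  have c2 : {for 0, continuous (fun d : R => d ^+ 2 + d)}.
    by apply: cvgD; [exact: exprn_continuous|exact: cvg_id].
  have c1 : {for 0, continuous (fun d : R => 1 + d)}.
    by apply: cvgD; [exact: cvg_cst|exact: cvg_id].
  have cl c : {for 0, continuous (fun d : R => (1 + d) * c + (d ^+ 2 + d))}.
    by apply: cvgD => //; apply: cvgM => //; exact: cvg_cst.
  apply: cvgD => //; apply: cvgM => //.
  apply: (@continuous_comp _ _ _ (fun d : R => 4 * ((1 + d) * M + (d ^+ 2 + d)) *
    ((1 + d) * G + (d ^+ 2 + d) - c0 ^+ 2 * ((M - (d ^+ 2 + d)) / (1 + d))))
    (@Num.sqrt R)); last exact: sqrt_continuous.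
  apply: cvgM; first by apply: cvgM; [exact: cvg_cst|exact: cl].
  apply: cvgB; first exact: cl.
  apply: cvgM; first exact: cvg_cst.
  apply: cvgM; first by apply: cvgB => //; exact: cvg_cst.
  apply: (@continuous_comp _ _ _ (fun d : R => 1 + d) (fun d : R => d^-1)) => //.
  by apply: inv_continuous; rewrite addr0 oner_eq0.
move=> d d0; have [phi [M' [G' [tphi ME' GE' [hM hG hM' hw]]]]] := H d d0.
have := hw 1 _ ler01 wom omle; rewrite XE mul1r.
have au := annular_test_fun hK tphi; have ag := annular_radial_deriv hK tphi.
have aX : annular K (fun x => phi x * phi x * (r x `^ (- (2 * b + 2)) * (r x / (1 + r x) ^+ 2))).
  have au2 := annularM (annularM au (annular_loc au)) (loc_bounded_powR hK (- (2 * b + 2))).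
  split; last first.
    have [_ [del [D [C [del0 hC]]]]] := au2; exists del, D, C; split=> // x.
    apply: le_trans (hC x); rewrite mulrA normrM ler_piMr//.
    by rewrite ger0_norm; case/andP: (om1 x).
  under eq_fun do rewrite mulrA; apply: measurable_funM; first exact: au2.1.
  apply: measurable_funM => //; apply: (measurableT_comp measurable_inv).
  by apply: measurable_funX; exact: measurable_funD.
have -> : qint om phi = (\int[lebN]_x (phi x * phi x * (r x `^ (- (2 * b + 2)) *
    (r x / (1 + r x) ^+ 2))))%:E.
  rewrite fineK; last by apply: integrable_fin_num => //; exact: (annular_integrable hK).
  by apply: eq_integral => x _; rewrite powRN /om expr2; congr (_ * _)%:E; rewrite mulrC.
have := test_fun_hardy_ineq hK hN b tphi.
have ME'' : \int[lebN]_x (phi x * phi x * r x `^ (- (2 * b + 2))) = M'.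
  by apply: EFin_inj; rewrite -ME' b2; exact/esym/(wint_annular _ au).
have GE'' : \int[lebN]_x (radial_deriv K phi x * radial_deriv K phi x * r x `^ (- (2 * b))) = G'.
  by apply: EFin_inj; rewrite -GE'; exact/esym/(wint_annular _ ag).
rewrite ME'' GE''; set X' := \int[lebN]_x _ => hX.
rewrite -EFinM -EFinD lee_fin => /le_trans; apply.
have d10 : 0 < 1 + d by rewrite addr_gt0.
have M'0 : 0 <= M' by rewrite -lee_fin -ME' wint_ge0.
rewrite /F lerD2r ler_pM2l// (le_trans (ler_norm _))// -sqrtr_sqr ler_wsqrtr//.
apply: le_trans hX _.
have P : 0 <= G' - c0 ^+ 2 * M'.
  have := test_fun_shift hK hN b c0 tphi; rewrite ME'' GE''.
  have -> : c0 * (c0 - (N%:R - 2 * b - 2)) = - c0 ^+ 2 by rewrite /c0; field.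
  by rewrite mulNr => <-; apply: Rintegral_ge0 => x _; rewrite -expr2 sqr_ge0.
apply: ler_pM => //; [by rewrite mulr_ge0|by rewrite ler_pM2l|].
apply: lerB => //; rewrite ler_wpM2l ?sqr_ge0// ler_pdivrMr// lerBlDr.
by rewrite mulrC.
Qed.

End completion.

(** * Linear combinations of test functions *)

Section test_functions_linear.
Context {R : realType} {N : nat}.
Implicit Types (u v : 'rV[R]_N -> R).

Lemma compact_supp_sub u v : compact (supp v) -> ~ supp v 0 ->
  (forall x, v x = 0 -> u x = 0) -> compact (supp u) /\ ~ supp u 0.
Proof.
move=> cv v0 vu; have sub : supp u `<=` supp v.
  apply: closure_subset => x /=; apply: contra => /eqP vx.
  by apply/eqP; exact: vu.
split; last by move/sub.
by apply: subclosed_compact cv sub; exact: closed_closure.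
Qed.

Lemma test_funD u v : test_fun u -> test_fun v -> test_fun (u \+ v).
Proof.
move=> [su cu u0] [sv cv v0].
have sub : supp (u \+ v) `<=` supp u `|` supp v.
  rewrite /supp -closureU; apply: closure_subset => x /=.
  by have [->|] := eqVneq (u x) 0; [rewrite add0r; right|left].
split.
- move=> k; apply: CkU_Ck; apply: CkUD; first exact: openT.
    exact: (Ck_smooth su).
  exact: (Ck_smooth sv).
- apply: (subclosed_compact _ _ sub); first exact: closed_closure.
  exact: compactU.
- by move/sub => [].
Qed.

Lemma test_funZ (c : R) u : test_fun u -> test_fun (c \*: u).
Proof.
move=> [su cu u0]; have [? ?] : compact (supp (c \*: u)) /\ ~ supp (c \*: u) 0.
  by apply: (compact_supp_sub cu u0) => x /= ->; rewrite scaler0.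
split=> // k; apply: CkU_Ck; apply: CkUM; [exact: openT| |exact: (Ck_smooth su)].
by apply: CkU_cst; exact: openT.
Qed.

Lemma radial_derivD K u v : test_fun u -> test_fun v ->
  radial_deriv K (u \+ v) = radial_deriv K u \+ radial_deriv K v.
Proof.
move=> tu tv; apply/funext => x; rewrite /= /radial_deriv /dotv -big_split/=.
apply: eq_bigr => i _; rewrite !mxE -mulrDl; congr (_ * _).
have [du _ _] := tu; have [dv _ _] := tv.
by apply: deriveD; [have [+ _] := du 1%N|have [+ _] := dv 1%N]; exact.
Qed.

Lemma radial_derivZ K (c : R) u : test_fun u ->
  radial_deriv K (c \*: u) = c \*: radial_deriv K u.
Proof.
move=> tu; apply/funext => x; rewrite /= /radial_deriv /dotv scaler_sumr.
apply: eq_bigr => i _; rewrite !mxE scalerAl; congr (_ * _).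
have [du _ _] := tu.
by apply: deriveZ; have [+ _] := du 1%N; exact.
Qed.

End test_functions_linear.

(** * Limits in the completion *)

Section completion_closure.
Context {R : realType} {N : nat} (K : set 'rV[R]_N) (hK : Kss_o K).
Hypothesis hN : (2 <= N)%N.
Variables a b : R.
Implicit Types (u v g h w F L : 'rV[R]_N -> R) (x : 'rV[R]_N) (c : R).
Local Notation leb := (@lebesgue_measure R).
Local Notation lebN := (@lebesgue_rV R N).
Local Notation r := (normK K).

Lemma energyD_le u v g h : measurable_fun setT u -> measurable_fun setT v ->
  measurable_fun setT g -> measurable_fun setT h ->
  (energy K a b (u \+ v)%R (g \+ h)%R <=
   2%:E * energy K a b u g + 2%:E * energy K a b v h)%E.
Proof.
have young c (f f' : 'rV[R]_N -> R) : measurable_fun setT f -> measurable_fun setT f' ->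
    (wint K c (f \+ f')%R <= 2%:E * wint K c f + 2%:E * wint K c f')%E.
  move=> mf mf'; have wc := weight_pow hK c.
  apply: (qint_comb wc wc wc) => //; first exact: measurable_funD.
  move=> x; rewrite [2 * (f x ^+ 2 * _)]mulrA [2 * (f' x ^+ 2 * _)]mulrA -mulrDl ler_wpM2r//; first by case: wc.
  rewrite -subr_ge0; have -> : 2 * f x ^+ 2 + 2 * f' x ^+ 2 - (f \+ f') x ^+ 2 =
    (f x - f' x) ^+ 2 by rewrite /=; ring.
  exact: sqr_ge0.
move=> mu mv mg mh.
have E u1 g1 : (2%:E * energy K a b u1 g1 =
    2%:E * wint K (2 * b) g1 + 2%:E * wint K (2 * a) u1)%E.
  by rewrite ge0_muleDr ?(wint_ge0 hK).
by rewrite !E addeACA; apply: leeD; exact: young.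
Qed.

Lemma energyZ k u g : measurable_fun setT u -> measurable_fun setT g ->
  energy K a b (k \*: u) (k \*: g) = ((k ^+ 2)%:E * energy K a b u g)%E.
Proof.
have scale c (f : 'rV[R]_N -> R) : measurable_fun setT f -> wint K c (k \*: f) = ((k ^+ 2)%:E * wint K c f)%E.
  move=> mf; rewrite /wint -ge0_integralZl_EFin//; last 3 first.
  - by move=> x _; rewrite lee_fin divr_ge0 ?sqr_ge0// powR_ge0.
  - exact: (measurable_qint (weight_pow hK c) mf).
  - exact: sqr_ge0.
  by apply: eq_integral => x _; rewrite -EFinM; congr _%:E; rewrite mulrA -exprMn.
move=> mu mg; rewrite /energy (scale _ _ mu) (scale _ _ mg).
by apply/esym; apply: ge0_muleDr; exact: wint_ge0.
Qed.

Lemma in_completion_test u : test_fun u -> in_completion K a b u (radial_deriv K u).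
Proof.
move=> tu; have mu := measurable_test_fun tu; have mg := measurable_radial_deriv hK tu.
apply/in_completionP => // e e0; exists u => //.
rewrite /energy /wint !integral0_eq ?adde0 ?lee_fin ?ltW// => x _ /=.
- by rewrite subrr expr0n mul0r.
- by rewrite subrr expr0n mul0r.
Qed.

Lemma in_completion_closed u g : measurable_fun setT u -> measurable_fun setT g ->
  (forall e : R, 0 < e -> exists v h, in_completion K a b v h /\
     (energy K a b (v \- u)%R (h \- g)%R <= e%:E)%E) ->
  in_completion K a b u g.
Proof.
move=> mu mg H; apply/in_completionP => // e e0.
have e40 : 0 < e / 4 by rewrite divr_gt0.
have [v [h [vh vhe]]] := H _ e40; have [mv mh _] := vh.
have [|phi tphi phie] := (in_completionP hK a b mv mh).1 vh (e / 4) => //.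
exists phi => //.
have mphi := measurable_test_fun tphi; have mdphi := measurable_radial_deriv hK tphi.
have -> : phi \- u = (phi \- v) \+ (v \- u).
  by apply/funext => x /=; rewrite addrA subrK.
have -> : radial_deriv K phi \- g = (radial_deriv K phi \- h) \+ (h \- g).
  by apply/funext => x /=; rewrite addrA subrK.
apply: le_trans (energyD_le _ _ _ _) _; try exact: measurable_funB.
have -> : e%:E = (2%:E * (e / 4)%:E + 2%:E * (e / 4)%:E)%E.
  by rewrite -!EFinM -EFinD; congr _%:E; field.
by apply: leeD; rewrite lee_pmul2l ?lte_fin.
Qed.

Lemma in_completionD u v g h : in_completion K a b u g -> in_completion K a b v h ->
  in_completion K a b (u \+ v) (g \+ h).
Proof.
move=> ug vh; have [mu mg _] := ug; have [mv mh _] := vh.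
apply: in_completion_closed; try exact: measurable_funD.
move=> e e0; have e40 : 0 < e / 4 by rewrite divr_gt0.
have [phi tphi phie] := (in_completionP hK a b mu mg).1 ug _ e40.
have [psi tpsi psie] := (in_completionP hK a b mv mh).1 vh _ e40.
have mphi := measurable_test_fun tphi; have mdphi := measurable_radial_deriv hK tphi.
have mpsi := measurable_test_fun tpsi; have mdpsi := measurable_radial_deriv hK tpsi.
exists (phi \+ psi), (radial_deriv K (phi \+ psi)); split.
  by apply: in_completion_test; exact: test_funD.
rewrite radial_derivD//.
have -> : (phi \+ psi) \- (u \+ v) = (phi \- u) \+ (psi \- v).
  by apply/funext => x /=; rewrite opprD addrACA.
have -> : (radial_deriv K phi \+ radial_deriv K psi) \- (g \+ h) =
    (radial_deriv K phi \- g) \+ (radial_deriv K psi \- h).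
  by apply/funext => x /=; rewrite opprD addrACA.
apply: le_trans (energyD_le _ _ _ _) _; try exact: measurable_funB.
have -> : e%:E = (2%:E * (e / 4)%:E + 2%:E * (e / 4)%:E)%E.
  by rewrite -!EFinM -EFinD; congr _%:E; field.
by apply: leeD; rewrite lee_pmul2l ?lte_fin.
Qed.

Lemma in_completionZ k u g : in_completion K a b u g ->
  in_completion K a b (k \*: u) (k \*: g).
Proof.
move=> ug; have [mu mg _] := ug.
apply: in_completion_closed; try exact: measurable_funM.
move=> e e0; have k0 : 0 < k ^+ 2 + 1 by rewrite ltr_wpDl// sqr_ge0.
have e40 : 0 < e / (k ^+ 2 + 1) by rewrite divr_gt0.
have [phi tphi phie] := (in_completionP hK a b mu mg).1 ug _ e40.
have mphi := measurable_test_fun tphi; have mdphi := measurable_radial_deriv hK tphi.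
exists (k \*: phi), (radial_deriv K (k \*: phi)); split.
  by apply: in_completion_test; exact: test_funZ.
rewrite radial_derivZ//.
have -> : (k \*: phi) \- (k \*: u) = k \*: (phi \- u).
  by apply/funext => x /=; rewrite scalerBr.
have -> : (k \*: radial_deriv K phi) \- (k \*: g) = k \*: (radial_deriv K phi \- g).
  by apply/funext => x /=; rewrite scalerBr.
rewrite energyZ; try exact: measurable_funB.
apply: (@le_trans _ _ ((k ^+ 2 + 1)%:E * (e / (k ^+ 2 + 1))%:E)%E).
  by apply: lee_pmul; rewrite ?energy_ge0// ?lee_fin ?sqr_ge0// lerDl.
by rewrite -EFinM mulrC divfK// gt_eqF.
Qed.

Lemma wint_dominated c (v_ : nat -> 'rV[R]_N -> R) V :
  (forall n, measurable_fun setT (v_ n)) -> measurable_fun setT V ->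
  (forall x, v_ n x @[n --> \oo] --> 0) -> (forall n x, `|v_ n x| <= V x) ->
  (wint K c V < +oo)%E -> (wint K c (v_ n) @[n --> \oo] --> 0)%E.
Proof.
move=> mv mV cv vV Vfin; have wc := weight_pow hK c.
have w0 x : 0 <= (r x `^ c)^-1 by case: wc.
have -> : (0 = \int[lebN]_x (cst 0 x))%E by rewrite integral0.
apply: (@dominated_cvg _ _ _ lebN setT measurableT
  (fun n x => (v_ n x ^+ 2 / r x `^ c)%:E) (cst 0%E) (fun x => (V x ^+ 2 / r x `^ c)%:E)).
- by move=> n; exact: (measurable_qint wc).
- move=> x _; apply: cvg_EFin; first exact: nearW.
  have -> : (0 : R) = (0 : R) * 0 / r x `^ c by rewrite !mul0r.
  rewrite /comp/=; apply: cvgM; last exact: cvg_cst.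
  by apply: cvgM.
- by [].
- apply/integrableP; split; first exact: (measurable_qint wc).
  under eq_integral.
    move=> x _; rewrite gee0_abs; last by rewrite lee_fin mulr_ge0 ?sqr_ge0.
    over.
  exact: Vfin.
- move=> n x _; rewrite /= lee_fin (ger0_norm (mulr_ge0 (sqr_ge0 _) (w0 x))).
  by rewrite ler_wpM2r// -real_normK ?num_real// lerXn2r ?nnegrE// (le_trans _ (vV n x)).
Qed.

Lemma in_completion_dominated (u_ g_ : nat -> 'rV[R]_N -> R) u g U V :
  (forall n, in_completion K a b (u_ n) (g_ n)) ->
  measurable_fun setT u -> measurable_fun setT g ->
  measurable_fun setT U -> measurable_fun setT V ->
  (forall x, u_ n x @[n --> \oo] --> u x) -> (forall x, g_ n x @[n --> \oo] --> g x) ->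
  (forall n x, `|u_ n x - u x| <= U x) -> (forall n x, `|g_ n x - g x| <= V x) ->
  (wint K (2 * a) U < +oo)%E -> (wint K (2 * b) V < +oo)%E ->
  in_completion K a b u g.
Proof.
move=> ug mu mg mU mV cu cg uU gV Ufin Vfin.
apply: in_completion_closed => // e e0.
have c1 : (wint K (2 * a) (u_ n \- u)%R @[n --> \oo] --> 0)%E.
  apply: wint_dominated mU _ _ Ufin => //.
    by move=> n; apply: measurable_funB => //; case: (ug n).
  by move=> x; rewrite -(subrr (u x)); apply: cvgB => //; exact: cvg_cst.
have c2 : (wint K (2 * b) (g_ n \- g)%R @[n --> \oo] --> 0)%E.
  apply: wint_dominated mV _ _ Vfin => //.
    by move=> n; apply: measurable_funB => //; case: (ug n).
  by move=> x; rewrite -(subrr (g x)); apply: cvgB => //; exact: cvg_cst.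
have small f : (f n @[n --> \oo] --> 0)%E ->
    \forall n \near \oo, (f n <= (e / 2)%:E)%E.
  move=> /fine_cvgP[fin /cvgr0Pnorm_le cf].
  have e20 : 0 < e / 2 by rewrite divr_gt0.
  have := cf _ e20; move: fin; apply: filterS2 => n ffin.
  by rewrite -lee_fin => fe; rewrite -(fineK ffin); apply: le_trans fe; rewrite lee_fin ler_norm.
have [n [hg hu]] := filter_ex (filterI (small _ c2) (small _ c1)).
exists (u_ n), (g_ n); split; first exact: ug.
by rewrite [e]splitr EFinD; exact: leeD hg hu.
Qed.

End completion_closure.

(** * Products of an angular and a radial factor *)

Import HBSimple HBNNSimple.

Section log_polar_fields.
Context {R : realType} {N : nat} (K : set 'rV[R]_N) (hK : Kss_o K).
Hypothesis hN : (2 <= N)%N.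
Variables a b : R.
Implicit Types (u v f g w F L G : 'rV[R]_N -> R) (x : 'rV[R]_N) (c d S D C : R)
  (H : R -> R).
Local Notation leb := (@lebesgue_measure R).
Local Notation lebN := (@lebesgue_rV R N).
Local Notation r := (normK K).

(** Functions [F(x) H(L(x))], where [F] is an angular part and [L] stands for a
    logarithm of the radius. The radial derivative of such a function, when [F]
    is homogeneous of degree [0] and [L(t x) = ln t + L(x)], is [dfld]. *)
Definition fld F L H x : R := if x == 0 then 0 else F x * H (L x).
Definition dfld F L H' x : R := if x == 0 then 0 else F x * H' (L x) / r x.

Lemma measurable_off_origin f : measurable_fun setT f ->
  measurable_fun setT (fun x => if x == 0 then 0 else f x : R).
Proof.
move=> mf; rewrite (_ : (fun _ => _) = (fun x => \1_(~` [set 0]) x * f x)).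
  apply: measurable_funM => //; apply: measurable_indic.
  by apply: measurableC; exact: measurable_origin hK.
apply/funext => x; rewrite indicE; case: eqVneq => [->|x0].
  by rewrite memNset ?mul0r// => /(_ erefl).
by rewrite mem_set ?mul1r//; exact/eqP.
Qed.

Lemma measurable_fld F L H : measurable_fun setT F -> measurable_fun setT L ->
  continuous H -> measurable_fun setT (fld F L H).
Proof.
move=> mF mL cH; apply: measurable_off_origin; apply: measurable_funM => //.
by apply: measurableT_comp mL; exact: continuous_measurable_fun.
Qed.

Lemma measurable_dfld F L H' : measurable_fun setT F -> measurable_fun setT L ->
  continuous H' -> measurable_fun setT (dfld F L H').
Proof.
move=> mF mL cH; apply: measurable_off_origin; apply: measurable_funM.
  apply: measurable_funM => //.
  by apply: measurableT_comp mL; exact: continuous_measurable_fun.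
by apply: (measurableT_comp measurable_inv); exact: measurable_normK.
Qed.

Definition compact_profile H H' S := [/\ smooth1 setT H,
  forall s, is_derive s (1 : R) H (H' s) & forall s, S < `|s| -> H s = 0 /\ H' s = 0].

Lemma smooth1_continuous H : smooth1 setT H -> continuous H.
Proof.
move=> [D [<- dD]] s; apply: differentiable_continuous; apply/derivable1_diffP.
by have [] := dD 0%N s I.
Qed.

Lemma smooth1_derive_continuous H H' : smooth1 setT H ->
  (forall s, is_derive s (1 : R) H (H' s)) -> continuous H'.
Proof.
move=> [D [D0 dD]] dH; have -> : H' = D 1%N.
  by apply/funext => s; have [_ <-] := dH s; rewrite -D0; have [_ <-] := dD 0%N s I.
move=> s; apply: differentiable_continuous; apply/derivable1_diffP.
by have [] := dD 1%N s I.
Qed.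

Lemma compact_supp_bounded H S : continuous H -> (forall s, S < `|s| -> H s = 0) ->
  exists2 M : R, 0 <= M & forall s, `|H s| <= M.
Proof.
move=> cH HS.
have := compact_bounded (continuous_compact (continuous_subspaceT cH)
  (@segment_compact _ (- S) S)).
move=> [C [_ CP]]; exists (`|C| + 1); first by rewrite addr_ge0.
move=> s; have [sS|sS] := ltP S `|s|.
  by rewrite HS// normr0 addr_ge0.
apply: (CP (`|C| + 1)); first by rewrite (le_lt_trans (ler_norm C))// ltrDl.
by exists s => //=; rewrite in_itv/= -ler_norml.
Qed.

(** All weights are comparable on an annulus; the quantification over [c] covers
    both norms of the completion at once. *)
Definition annulus_finite G := measurable_fun setT G /\
  forall S c, (wint K c (fld G (fun x => ln (r x)) (fun s => (`|s| <= S)%R%:R)) < +oo)%E.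

Lemma measurable_lnr : measurable_fun setT (fun x => ln (r x)).
Proof. by apply: (measurableT_comp (@measurable_ln R)); exact: measurable_normK. Qed.

Lemma measurable_ind S : measurable_fun setT (fun s : R => (`|s| <= S)%R%:R : R).
Proof.
rewrite (_ : (fun _ => _) = \1_`[- S, S]); first exact: measurable_indic.
by apply/funext => s; rewrite indicE mem_setE in_itv/= -ler_norml.
Qed.

Lemma measurable_fld_ind G S : measurable_fun setT G ->
  measurable_fun setT (fld G (fun x => ln (r x)) (fun s => (`|s| <= S)%R%:R)).
Proof.
move=> mG; apply: measurable_off_origin; apply: measurable_funM => //.
by apply: (measurableT_comp (measurable_ind S)); exact: measurable_lnr.
Qed.

Lemma annulus_finite_cst C : annulus_finite (fun=> C).
Proof.
split=> // S c; rewrite wint_annular ?ltry//; split.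
  exact: measurable_fld_ind.
exists (expR (- S)), (expR S), `|C|; split; first exact: expR_gt0.
move=> x; rewrite /fld; case: eqVneq => [->|x0]; first by rewrite normr0; case: ifP.
have rx := normK_gt0 hK x0.
case: ifPn => [_|H]; first by rewrite normrM ler_piMr//; case: (`|ln (r x)| <= S); rewrite ?normr1 ?normr0.
case: (leP `|ln (r x)| S) => [lS|_]; last by rewrite mulr0 normr0.
move: lS; rewrite ler_norml => /andP[h1 h2]; move: H.
by rewrite -[r x]lnK ?posrE// !ler_expR h1 h2.
Qed.

Lemma wint_lt_pinfty c k u v : measurable_fun setT u -> measurable_fun setT v ->
  (forall x, `|u x| <= k * `|v x|) -> (wint K c v < +oo)%E -> (wint K c u < +oo)%E.
Proof.
move=> mu mv uv vfin; have wc := weight_pow hK c.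
have : (wint K c u <= (k ^+ 2)%:E * wint K c v + 0%:E * wint K c v)%E.
  apply: (qint_comb wc wc wc) => //; first exact: sqr_ge0.
  move=> x; rewrite mul0r addr0 mulrA ler_wpM2r//; first by case: wc.
  rewrite -exprMn -[leLHS]real_normK ?num_real// -[leRHS]real_normK ?num_real//.
  rewrite lerXn2r ?nnegrE// normrM (le_trans (uv x))// ler_wpM2r//.
  exact: ler_norm.
rewrite mul0e adde0 => /le_lt_trans; apply.
have := wint_ge0 hK c v; move: vfin; case: (wint K c v) => // y _ _.
by rewrite -EFinM ltry.
Qed.

(** Bounded convergence for the angular part and for the logarithm, the profile
    being fixed and compactly supported. *)
Lemma in_completion_fld_cvg (F_ L_ : nat -> 'rV[R]_N -> R) F L G H H' S D :
  compact_profile H H' S ->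
  (forall n, measurable_fun setT (F_ n)) -> (forall n, measurable_fun setT (L_ n)) ->
  measurable_fun setT F -> measurable_fun setT L ->
  (forall x, x != 0 -> F_ n x @[n --> \oo] --> F x) ->
  (forall x, x != 0 -> L_ n x @[n --> \oo] --> L x) ->
  (forall n x, x != 0 -> `|F_ n x| <= G x) ->
  (forall n x, x != 0 -> `|L_ n x - ln (r x)| <= D) -> annulus_finite G ->
  (forall n, in_completion K a b (fld (F_ n) (L_ n) H) (dfld (F_ n) (L_ n) H')) ->
  in_completion K a b (fld F L H) (dfld F L H').
Proof.
move=> [sH dH HS] mF_ mL_ mF mL cF cL FG LD [mG Gfin] FL.
have cH := smooth1_continuous sH; have cH' := smooth1_derive_continuous sH dH.
have [M M0 HM] := compact_supp_bounded cH (fun s h => (HS s h).1).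
have [M' M'0 HM'] := compact_supp_bounded cH' (fun s h => (HS s h).2).
have FG' x : x != 0 -> `|F x| <= G x.
  move=> x0; have cn : `|F_ n x| @[n --> \oo] --> `|F x| by apply: cvg_norm; exact: cF.
  by apply: (cvgr_to_le cn); apply: nearW => n; exact: FG.
have LD' x : x != 0 -> `|L x - ln (r x)| <= D.
  move=> x0; have cn : `|L_ n x - ln (r x)| @[n --> \oo] --> `|L x - ln (r x)|.
    by apply: cvg_norm; apply: cvgB; [exact: cL|exact: cvg_cst].
  by apply: (cvgr_to_le cn); apply: nearW => n; exact: LD.
pose I := fld G (fun x => ln (r x)) (fun s => (`|s| <= S + D)%R%:R).
have mI : measurable_fun setT I by exact: measurable_fld_ind.
have key (h : R -> R) m y l x : x != 0 -> 0 <= m -> (forall s, `|h s| <= m) ->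
    (forall s, S < `|s| -> h s = 0) -> `|y| <= G x -> `|l - ln (r x)| <= D ->
    `|y * h l| <= m * I x.
  move=> x0 m0 hm hS yG lD; rewrite /I /fld (negbTE x0).
  have [lS|lS] := leP `|ln (r x)| (S + D).
    by rewrite mulr1 normrM mulrC ler_pM.
  rewrite mulr0 mulr0 hS ?mulr0 ?normr0//.
  rewrite -(ltrD2r D); apply: lt_le_trans lS _.
  by rewrite -[ln (r x)](subKr l) (le_trans (ler_normB _ _))// lerD2l.
have I0 x : 0 <= I x.
  rewrite /I /fld; case: eqVneq => // x0; rewrite mulr_ge0//.
  by rewrite (le_trans _ (FG' _ x0)).
have Iinv x : x != 0 -> I x / r x <= expR (S + D) * I x.
  move=> x0; rewrite [leLHS]mulrC; have := I0 x; rewrite /I /fld (negbTE x0).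
  have rx := normK_gt0 hK x0.
  have [lS|lS] := leP `|ln (r x)| (S + D); last by rewrite !mulr0.
  rewrite mulr1 => G0; rewrite ler_wpM2r//.
  rewrite -[r x]lnK ?posrE// -expRN ler_expR (le_trans _ lS)//.
  by rewrite (le_trans (ler_norm _))// normrN.
apply: (@in_completion_dominated _ _ _ hK a b (fun n => fld (F_ n) (L_ n) H)
  (fun n => dfld (F_ n) (L_ n) H') _ _ (fun x => 2 * M * I x)
  (fun x => 2 * M' * expR (S + D) * I x)) => //.
- exact: measurable_fld.
- exact: measurable_dfld.
- exact: measurable_funM.
- exact: measurable_funM.
- move=> x; rewrite /fld; case: eqVneq => [_|x0]; first exact: cvg_cst.
  by apply: cvgM; [exact: cF|apply: continuous_cvg; [exact: cH|exact: cL]].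
- move=> x; rewrite /dfld; case: eqVneq => [_|x0]; first exact: cvg_cst.
  apply: cvgM; last exact: cvg_cst.
  by apply: cvgM; [exact: cF|apply: continuous_cvg; [exact: cH'|exact: cL]].
- move=> n x; rewrite /fld; case: eqVneq => [_|x0].
    by rewrite subrr normr0 !mulr_ge0.
  rewrite (le_trans (ler_normB _ _))// -mulrA mulr_natl mulr2n lerD//.
    by apply: key => //; [move=> s /HS[]|exact: FG|exact: LD].
  by apply: key => //; [move=> s /HS[]|exact: FG'|exact: LD'].
- move=> n x; rewrite /dfld; case: eqVneq => [_|x0].
    by rewrite subrr normr0 !mulr_ge0// expR_ge0.
  have rx := normK_gt0 hK x0.
  rewrite -mulrBl normrM (@gtr0_norm _ (r x)^-1) ?invr_gt0//.
  apply: (@le_trans _ _ (2 * (M' * I x) / r x)).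
    rewrite ler_wpM2r ?invr_ge0 ?(ltW rx)//.
    rewrite (le_trans (ler_normB _ _))// mulr_natl mulr2n lerD//.
      by apply: key => //; [move=> s /HS[]|exact: FG|exact: LD].
    by apply: key => //; [move=> s /HS[]|exact: FG'|exact: LD'].
  by rewrite -!mulrA !ler_wpM2l// Iinv.
- apply: (wint_lt_pinfty (k := 2 * M) _ mI _ (Gfin _ _)); first exact: measurable_funM.
  by move=> x; rewrite normrM ger0_norm ?mulr_ge0.
- apply: (wint_lt_pinfty (k := 2 * M' * expR (S + D)) _ mI _ (Gfin _ _)).
    exact: measurable_funM.
  by move=> x; rewrite normrM ger0_norm ?mulr_ge0 ?expR_ge0.
Qed.

(** The point of the Euclidean sphere in the direction of [x]. *)
Definition dir x : 'rV[R]_N := expR (- lnorm x) *: x.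

Lemma dirZ (t : R) x : 0 < t -> dir (t *: x) = dir x.
Proof.
move=> t0; have [->|x0] := eqVneq x 0; first by rewrite scaler0.
rewrite /dir lnormZ// scalerA opprD expRD (expRN (ln t)) lnK ?posrE// mulrAC mulVf ?mul1r//.
by rewrite gt_eqF.
Qed.

Lemma measurable_lnorm : measurable_fun setT (@lnorm R N).
Proof.
apply: measurable_funM => //; apply: (measurableT_comp (@measurable_ln R)).
by apply: measurable_sum => i; apply: measurable_funM; exact: measurable_coord.
Qed.

Lemma measurable_dir : measurable_fun setT dir.
Proof.
apply: measurable_fun_rV => i; under eq_fun do rewrite mxE.
apply: measurable_funM; last exact: measurable_coord.
apply: (measurableT_comp (@measurable_expR R)).
by apply: (measurableT_comp (@oppr_measurable R setT)); exact: measurable_lnorm.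
Qed.

Lemma CkU_dir k i : CkU nonzero k (fun x => dir x ord0 i).
Proof.
have oN := @open_nonzero R N.
apply: (CkU_eq oN (u := fun x => expR (-1 * lnorm x) * x ord0 i)).
  by move=> x _; rewrite /dir mxE mulN1r.
apply: CkUM => //; last exact: CkU_coord.
apply: (CkU_comp oN (@smooth1_expR R)) => //.
by apply: CkUM => //; [exact: CkU_cst|exact: CkU_lnorm].
Qed.

Lemma dotv_dir x : x != 0 -> dotv (dir x) (dir x) = 1.
Proof.
move=> x0; rewrite dotvZ /lnorm.
rewrite expr2 -expRD -mulr2n -[X in expR X]mulr_natr mulNr divfK//.
by rewrite expRN lnK ?posrE ?dotv_gt0// mulVf// gt_eqF// dotv_gt0.
Qed.

Lemma normK_dir x : x != 0 -> ln (r x) = lnorm x + ln (r (dir x)).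
Proof.
move=> x0; have rx := normK_gt0 hK x0.
rewrite /dir normKZ ?expR_ge0// lnM ?posrE ?expR_gt0// expRK.
by rewrite addrA subrr add0r.
Qed.

(** The gauge and the Euclidean norm are both comparable to the sup norm. *)
Lemma dir_bounded : exists2 D : R, 0 <= D &
  forall x, x != 0 -> `|ln (r (dir x))| <= D.
Proof.
have [A A0 rA] := normK_le_norm hK; have [B B0 rB] := norm_le_normK hK.
exists (`|ln A| + `|ln (N%:R * B)|); first by rewrite addr_ge0.
move=> x x0; have d1 := dotv_dir x0; set y := dir x in d1 *.
have y0 : y != 0.
  apply: contra_eq_neq d1 => ->; rewrite /dotv big1 ?(eq_sym 0) ?oner_neq0//.
  by move=> i _; rewrite mxE mul0r.
have ry := normK_gt0 hK y0.
have y1 : `|y| <= 1.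
  by have := norm_sqr_le_dotv y; rewrite d1 expr_le1.
have N0 : 0 < N%:R :> R by rewrite ltr0n (leq_trans _ hN).
have y2 : 1 <= N%:R * B * r y.
  have := dotv_le_norm_sqr y; rewrite d1 => /le_trans; apply.
  rewrite -mulrA ler_pM2l//; apply: le_trans (rB y).
  by rewrite expr2 ler_piMr.
rewrite ler_norml; apply/andP; split.
  rewrite lerNl (@le_trans _ _ (ln (N%:R * B)))//; last first.
    by rewrite (le_trans (ler_norm _))// lerDr.
  rewrite -lnV ?posrE// ler_ln ?posrE ?invr_gt0 ?mulr_gt0//.
  by rewrite -[leLHS]mul1r ler_pdivrMr.
rewrite (@le_trans _ _ (ln A))//; last by rewrite (le_trans (ler_norm _))// lerDl.
rewrite ler_ln ?posrE// (le_trans (rA y))//.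
by rewrite -[leRHS]mulr1 ler_pM2l.
Qed.

(** A generating family of Borel sets whose indicators are limits of products of
    smooth functions of the coordinates; intersecting two members amounts to
    concatenating the lists. *)
Definition halfspaces (s : seq ('I_N * R)) : set 'rV[R]_N :=
  [set x | all (fun p => p.2 < x ord0 p.1) s].

Definition halfspaces_system : set (set 'rV[R]_N) := range halfspaces.

Lemma measurable_halfspaces s : measurable (halfspaces s).
Proof.
elim: s => [|p s IH].
  by rewrite (_ : halfspaces _ = setT)//; apply/seteqP; split.
rewrite (_ : halfspaces _ = (fun x => x ord0 p.1) @^-1` `]p.2, +oo[ `&` halfspaces s).
  apply: measurableI => //; rewrite -[X in measurable X]setTI.
  exact: (measurable_coord p.1).
by apply/seteqP; split => x /=; rewrite in_itv/= andbT => /andP.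
Qed.

Lemma measurable_rV_halfspaces :
  @measurable _ 'rV[R]_N = <<s halfspaces_system >>.
Proof.
apply/seteqP; split; last first.
  apply: smallest_sub; first exact: sigma_algebra_measurable.
  by move=> _ [s _ <-]; exact: measurable_halfspaces.
move=> A mA.
have E i c : halfspaces [:: (i, c)] = (fun x : 'rV[R]_N => x ord0 i) @^-1` `]c, +oo[.
  by apply/seteqP; split => x; rewrite /halfspaces/= in_itv/= !andbT.
have mid : measurable_fun setT (id : g_sigma_algebraType halfspaces_system -> 'rV[R]_N).
  apply: measurable_fun_rV => i.
  apply: (measurability _ (RGenOInfty.measurableE R)) => _ [_ [c ->] <-].
  rewrite setTI; apply: sub_sigma_algebra; exists [:: (i, c)] => //; exact: E.
by have := mid measurableT A mA; rewrite setTI preimage_id.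
Qed.

Lemma in_completion_halfspaces s H H' S d : compact_profile H H' S ->
  in_completion K a b (fld (fun x => \1_(halfspaces s) (dir x)) (fun x => lnorm x + d) H)
    (dfld (fun x => \1_(halfspaces s) (dir x)) (fun x => lnorm x + d) H').
Proof.
move=> cp; have [sH dH HS] := cp; have [D D0 HD] := dir_bounded.
pose A (n : nat) x : R := \prod_(p <- s) smooth_step (n%:R * (dir x ord0 p.1 - p.2)).
have oN := @open_nonzero R N.
have sA n k : CkU nonzero k (A n).
  apply: CkU_prod => // p; apply: (CkU_comp oN (@smooth1_smooth_step R)) => //.
  apply: CkUM => //; first exact: CkU_cst.
  by apply: CkUD => //; [exact: CkU_dir|exact: CkU_cst].
have mL : measurable_fun setT (fun x : 'rV[R]_N => lnorm x + d).
  by apply: measurable_funD => //; exact: measurable_lnorm.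
have A01 n x : 0 <= A n x <= 1.
  rewrite /A; elim: (s) => [|p t IH]; first by rewrite big_nil ler01 lexx.
  rewrite big_cons; case/andP: IH => h0 h1.
  by rewrite mulr_ge0 ?smooth_step_ge0// mulr_ile1// ?smooth_step_ge0 ?smooth_step_le1.
apply: (@in_completion_fld_cvg A (fun _ x => lnorm x + d) _ _ (fun=> 1) H H' S (D + `|d|)) => //.
- move=> n; apply: measurable_prod => p _.
  apply: (@measurableT_comp _ _ _ _ _ _ smooth_step).
    apply: continuous_measurable_fun; apply: smooth1_continuous; exact: smooth1_smooth_step.
  apply: measurable_funM => //; apply: measurable_funB => //.
  by apply: (measurableT_comp (measurable_coord _)); exact: measurable_dir.
- have m1 : measurable_fun setT (\1_(halfspaces s) : 'rV[R]_N -> R).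
    by apply: measurable_indic; exact: measurable_halfspaces.
  exact: (measurableT_comp m1 measurable_dir).
- move=> x x0; rewrite indicE mem_setE /A.
  elim: (s) => [|p t IH] /=.
    by under eq_fun do rewrite big_nil; exact: cvg_cst.
  under eq_fun do rewrite big_cons.
  rewrite -mulnb natrM; apply: cvgM => //.
  by rewrite -subr_gt0; exact: cvg_smooth_step.
- by move=> x x0; exact: cvg_cst.
- by move=> n x _; have /andP[h0 h1] := A01 n x; rewrite ger0_norm.
- move=> n x x0; rewrite normK_dir// opprD addrACA subrr add0r addrC.
  by rewrite (le_trans (ler_normD _ _))// normrN lerD2r HD.
- exact: annulus_finite_cst.
- move=> n; have tA := test_fun_ang_rad d (sA n) sH (fun s h => (HS s h).1).
  rewrite (_ : dfld _ _ _ = radial_deriv K (ang_rad (A n) H d)).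
    exact: in_completion_test.
  rewrite (radial_deriv_ang_rad hK tA _ dH)// => t x t0.
  by rewrite /A dirZ.
Qed.

Lemma fldD F G L H : fld (fun x => F x + G x) L H = fld F L H \+ fld G L H.
Proof. by apply/funext => x; rewrite /= /fld; case: eqVneq; rewrite ?addr0// mulrDl. Qed.

Lemma dfldD F G L H : dfld (fun x => F x + G x) L H = dfld F L H \+ dfld G L H.
Proof. by apply/funext => x; rewrite /= /dfld; case: eqVneq; rewrite ?addr0// !mulrDl. Qed.

Lemma fldZ k F L H : fld (fun x => k * F x) L H = k \*: fld F L H.
Proof.
by apply/funext => x; rewrite /= /fld; case: eqVneq; rewrite ?scaler0// /GRing.scale/= mulrA.
Qed.

Lemma dfldZ k F L H : dfld (fun x => k * F x) L H = k \*: dfld F L H.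
Proof.
by apply/funext => x; rewrite /= /dfld; case: eqVneq; rewrite ?scaler0// /GRing.scale/= !mulrA.
Qed.

Lemma in_completion_fldD F G L H H' : in_completion K a b (fld F L H) (dfld F L H') ->
  in_completion K a b (fld G L H) (dfld G L H') ->
  in_completion K a b (fld (fun x => F x + G x) L H) (dfld (fun x => F x + G x) L H').
Proof. by move=> h1 h2; rewrite fldD dfldD; exact: in_completionD. Qed.

Lemma in_completion_fldZ k F L H H' : in_completion K a b (fld F L H) (dfld F L H') ->
  in_completion K a b (fld (fun x => k * F x) L H) (dfld (fun x => k * F x) L H').
Proof. by move=> h; rewrite fldZ dfldZ; exact: in_completionZ. Qed.

Lemma in_completion0 : in_completion K a b (fun=> 0) (fun=> 0).
Proof.
split => //; exists (fun _ _ => 0).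
  move=> n; have := @test_fun_ang_rad R N (fun=> 0) (fun=> 0) 0 0.
  rewrite (_ : ang_rad _ _ _ = fun=> 0); last first.
    by apply/funext => x; rewrite /ang_rad mul0r if_same.
  apply => // [k|]; first by apply: CkU_cst; exact: open_nonzero.
  by exists (fun _ _ => 0); split => // n' t _; exact: is_derive_cst.
rewrite (_ : (fun n : nat => _) = fun=> 0%E); first exact: cvg_cst.
have dz : radial_deriv K (fun=> 0) = fun=> 0.
  apply/funext => x; rewrite /radial_deriv /dotv big1// => i _.
  by rewrite mxE /partial derive_cst mul0r.
apply/funext => n; rewrite /C_norm dz.
rewrite /wint !integral0_eq ?adde0; last 2 first.
- by move=> x _ /=; rewrite subrr expr0n mul0r.
- by move=> x _ /=; rewrite subrr expr0n mul0r.
by rewrite poweR_EFin powR0 ?invr_eq0.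
Qed.

Lemma in_completion_fld0 L H H' :
  in_completion K a b (fld (fun=> 0) L H) (dfld (fun=> 0) L H').
Proof.
have -> : fld (fun=> 0) L H = fun=> 0.
  by apply/funext => x; rewrite /fld mul0r if_same.
have -> : dfld (fun=> 0) L H' = fun=> 0.
  by apply/funext => x; rewrite /dfld !mul0r if_same.
exact: in_completion0.
Qed.

Lemma measurable_comp_dir (f : 'rV[R]_N -> R) : measurable_fun setT f ->
  measurable_fun setT (fun x => f (dir x)).
Proof. by move=> mf; exact: (measurableT_comp mf measurable_dir). Qed.

Lemma measurable_indic_rV (B : set 'rV[R]_N) : measurable B ->
  measurable_fun setT (\1_B : 'rV[R]_N -> R).
Proof. by move=> mB; exact: measurable_indic. Qed.

(** From half-spaces to Borel sets of directions, by Dynkin's theorem. *)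
Lemma in_completion_borel B H H' S d : compact_profile H H' S -> measurable B ->
  in_completion K a b (fld (fun x => \1_B (dir x)) (fun x => lnorm x + d) H)
    (dfld (fun x => \1_B (dir x)) (fun x => lnorm x + d) H').
Proof.
move=> cp mB; set L := fun x => lnorm x + d.
have [D D0 HD] := dir_bounded.
have mL : measurable_fun setT L by apply: measurable_funD => //; exact: measurable_lnorm.
pose P (A : set 'rV[R]_N) := in_completion K a b (fld (fun x => \1_A (dir x)) L H)
    (dfld (fun x => \1_A (dir x)) L H').
have PT : P setT.
  have E : halfspaces [::] = setT by apply/seteqP; split.
  by have := in_completion_halfspaces [::] d cp; rewrite E.
apply: (@dynkin_induction _ _ halfspaces_system P measurable_rV_halfspaces _ PT).
- move=> _ _ [s _ <-] [t _ <-]; exists (s ++ t) => //.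
  by apply/seteqP; split => x; rewrite /halfspaces/= all_cat => /andP.
- by move=> _ [s _ <-]; exact: in_completion_halfspaces cp.
- move=> A mA PA; rewrite /P.
  have -> : (fun x => \1_(~` A) (dir x) : R) = (fun x => \1_setT (dir x) + -1 * \1_A (dir x)).
    apply/funext => x; rewrite !indicE in_setC in_setT.
    by case: (dir x \in A); rewrite ?mulr0 ?addr0// mulr1 subrr.
  by apply: in_completion_fldD => //; exact: in_completion_fldZ.
- move=> F mF tF PF.
  pose s (n : nat) x : R := \sum_(i < n) \1_(F i) (dir x).
  have sE n x k : F k (dir x) -> s n x = (k < n)%:R.
    move=> Fk; rewrite /s (eq_bigr (fun i : 'I_n => (i == k :> nat)%:R)).
      rewrite -natr_sum; congr _%:R; elim: n {s} => [|n IH]; first by rewrite big_ord0.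
      rewrite big_ord_recr/= IH ltnS [(k <= n)%N]leq_eqVlt [k == n]eq_sym.
      by case: eqVneq => [->|]; rewrite ?ltnn// addn0.
    move=> i _; rewrite indicE; case: eqVneq => [->|ik]; first by rewrite mem_set.
    rewrite memNset// => Fi; move: ik; apply/negP; rewrite negbK; apply/eqP.
    by apply: tF => //; exists (dir x).
  have s0 n x : ~ (\bigcup_k F k) (dir x) -> s n x = 0.
    by move=> nF; rewrite /s big1// => i _; rewrite indicE memNset// => Fi; apply: nF; exists i.
  have mFU : measurable (\bigcup_k F k) by exact: bigcup_measurable.
  apply: (@in_completion_fld_cvg s (fun _ => L) _ _ (fun=> 1) H H' S (D + `|d|)) => //.
  + move=> n; apply: measurable_sum => i.
    by apply: measurable_comp_dir; exact: measurable_indic_rV.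
  + by apply: measurable_comp_dir; exact: measurable_indic_rV.
  + move=> x _; have [[k _ Fk]|nF] := pselect ((\bigcup_k F k) (dir x)).
      rewrite indicE mem_set; last by exists k.
      apply: cvg_near_cst; exists k.+1 => // n /= kn.
      by rewrite (sE _ _ k)// kn.
    rewrite indicE memNset//; apply: cvg_near_cst; apply: nearW => n; exact: s0.
  + by move=> x x0; exact: cvg_cst.
  + move=> n x _; have [[k _ Fk]|nF] := pselect ((\bigcup_k F k) (dir x)).
      by rewrite (sE _ _ k)//; case: (_ < _)%N; rewrite ?normr1 ?normr0.
    by rewrite s0// normr0.
  + move=> n x x0; rewrite normK_dir// opprD addrACA subrr add0r addrC.
    by rewrite (le_trans (ler_normD _ _))// normrN lerD2r HD.
  + exact: annulus_finite_cst.
  + elim=> [|n IH].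
      rewrite (_ : s 0%N = fun=> 0); first exact: in_completion_fld0.
      by apply/funext => x; rewrite /s big_ord0.
    rewrite (_ : s n.+1 = fun x => s n x + \1_(F n) (dir x)); last first.
      by apply/funext => x; rewrite /s big_ord_recr.
    by apply: in_completion_fldD => //; exact: PF.
by rewrite -measurable_rV_halfspaces.
Qed.

(** A family depending on a simple function of the direction is a finite sum. *)
Lemma in_completion_simple (h : {nnsfun 'rV[R]_N >-> R}) (U V : R -> 'rV[R]_N -> R) :
  (forall y B, measurable B -> in_completion K a b (fun x => \1_B (dir x) * U y x)
    (fun x => \1_B (dir x) * V y x)) ->
  in_completion K a b (fun x => U (h (dir x)) x) (fun x => V (h (dir x)) x).
Proof.
move=> UV; have /finite_seqP[s0 hs0] := @fimfunP _ _ h.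
pose s := undup s0; have us : uniq s := undup_uniq s0.
have hs x : h x \in s.
  by rewrite mem_undup; have : range h (h x) by [exists x]; rewrite hs0.
have E (W : R -> 'rV[R]_N -> R) : (fun x => W (h (dir x)) x) =
    (fun x => \sum_(y <- s) \1_(h @^-1` [set y]) (dir x) * W y x).
  apply/funext => x; rewrite (bigD1_seq (h (dir x)))//= big1 ?addr0.
    by rewrite indicE mem_set// mul1r.
  move=> y yh; rewrite indicE memNset ?mul0r// => /= hy.
  by move: yh; rewrite hy eqxx.
rewrite !E; elim: (s) => [|y t IH].
  under eq_fun do rewrite big_nil; under [X in in_completion _ _ _ _ X]eq_fun do rewrite big_nil.
  exact: in_completion0.
under eq_fun do rewrite big_cons.
under [X in in_completion _ _ _ _ X]eq_fun do rewrite big_cons.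
apply: in_completionD => //; apply: UV; exact: measurable_sfunP.
Qed.

(** Replacing the Euclidean norm by the gauge: their quotient is a bounded
    function of the direction, hence a limit of simple functions. *)
Lemma in_completion_gauge B H H' S : compact_profile H H' S -> measurable B ->
  in_completion K a b (fld (fun x => \1_B (dir x)) (fun x => ln (r x)) H)
    (dfld (fun x => \1_B (dir x)) (fun x => ln (r x)) H').
Proof.
move=> cp mB; have [D D0 HD] := dir_bounded.
pose f (y : 'rV[R]_N) : R := Num.max 0 (ln (r y) + D).
have mf : measurable_fun setT (EFin \o f).
  apply/measurable_EFinP; apply: measurable_maxr => //.
  by apply: measurable_funD => //; exact: measurable_lnr.
have f0 y : (0 <= (EFin \o f) y)%E by rewrite lee_fin le_max lexx.
pose h n := nnsfun_approx measurableT mf n.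
have fD x : x != 0 -> f (dir x) = ln (r (dir x)) + D.
  move=> x0; apply/max_idPr; rewrite -lerBlDr sub0r lerNl.
  by rewrite (le_trans _ (HD x x0))// -normrN ler_norm.
have f2D x : x != 0 -> f (dir x) <= 2 * D.
  move=> x0; rewrite fD// mulr_natl mulr2n lerD2r.
  by rewrite (le_trans (ler_norm _))// HD.
have hle n y : h n y <= f y.
  by rewrite -lee_fin nnsfun_approxE; exact: le_approx.
pose Ln n x := lnorm x + (h n (dir x) - D).
apply: (@in_completion_fld_cvg (fun _ x => \1_B (dir x)) Ln _ _ (fun=> 1) H H' S (2 * D)) => //.
- by move=> n; apply: measurable_comp_dir; exact: measurable_indic_rV.
- move=> n; apply: measurable_funD; first exact: measurable_lnorm.
  by apply: measurable_funB => //; apply: measurable_comp_dir.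
- by apply: measurable_comp_dir; exact: measurable_indic_rV.
- exact: measurable_lnr.
- by move=> x x0; exact: cvg_cst.
- move=> x x0; rewrite normK_dir//; apply: cvgD; first exact: cvg_cst.
  have -> : ln (r (dir x)) = f (dir x) - D by rewrite fD// addrK.
  apply: cvgB; last exact: cvg_cst.
  have := @cvg_nnsfun_approx _ _ _ _ measurableT _ mf (fun x _ => f0 x) (dir x) I.
  by move/fine_cvgP => [].
- by move=> n x _; rewrite indicE; case: (_ \in _); rewrite ?normr1 ?normr0.
- move=> n x x0; rewrite normK_dir// /Ln opprD addrACA subrr add0r.
  have -> : h n (dir x) - D - ln (r (dir x)) = h n (dir x) - f (dir x).
    by rewrite fD//; ring.
  rewrite distrC ger0_norm ?subr_ge0//.
  by rewrite (le_trans _ (f2D x x0))// gerBl.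
- exact: annulus_finite_cst.
- move=> n; apply: (@in_completion_simple (h n)
    (fun y => fld (fun x => \1_B (dir x)) (fun x => lnorm x + (y - D)) H)
    (fun y => dfld (fun x => \1_B (dir x)) (fun x => lnorm x + (y - D)) H')).
  move=> y C mC.
  have := @in_completion_borel (C `&` B) H H' S (y - D) cp (measurableI _ _ mC mB).
  have E A x : A * \1_(C `&` B) x = \1_C x * (\1_B x : R) * A.
    by rewrite indicI mulrC.
  congr in_completion; apply/funext => x; rewrite /fld /dfld; case: eqVneq; rewrite ?mulr0// => _.
    by rewrite indicI -mulrA.
  by rewrite indicI -!mulrA.
Qed.

(** From indicators to square integrable functions of the direction. *)
Lemma in_completion_angular F H H' S : compact_profile H H' S ->
  measurable_fun setT F -> annulus_finite (fun x => `|F (dir x)|) ->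
  in_completion K a b (fld (fun x => F (dir x)) (fun x => ln (r x)) H)
    (dfld (fun x => F (dir x)) (fun x => ln (r x)) H').
Proof.
move=> cp mF Ffin.
have mp : measurable_fun setT (EFin \o (fun x => Num.max (F x) 0)).
  by apply/measurable_EFinP; exact: measurable_maxr.
have mn : measurable_fun setT (EFin \o (fun x => Num.max (- F x) 0)).
  apply/measurable_EFinP; apply: measurable_maxr => //.
  exact: (measurableT_comp (@oppr_measurable R setT)).
pose p n := nnsfun_approx measurableT mp n; pose q n := nnsfun_approx measurableT mn n.
have ple n x : 0 <= p n x <= Num.max (F x) 0.
  rewrite fun_ge0/= -lee_fin nnsfun_approxE; apply: le_approx => // y _.
  by rewrite lee_fin le_max lexx orbT.
have qle n x : 0 <= q n x <= Num.max (- F x) 0.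
  rewrite fun_ge0/= -lee_fin nnsfun_approxE; apply: le_approx => // y _.
  by rewrite lee_fin le_max lexx orbT.
have simple (h : {nnsfun 'rV[R]_N >-> R}) :
   in_completion K a b (fld (fun x => h (dir x)) (fun x => ln (r x)) H)
    (dfld (fun x => h (dir x)) (fun x => ln (r x)) H').
  apply: (@in_completion_simple h (fun y => fld (fun=> y) (fun x => ln (r x)) H)
    (fun y => dfld (fun=> y) (fun x => ln (r x)) H')) => y B mB.
  have := in_completion_fldZ y (in_completion_gauge cp mB).
  congr in_completion; apply/funext => x; rewrite /fld /dfld; case: eqVneq; rewrite ?mulr0// => _.
    by ring.
  by ring.
apply: (@in_completion_fld_cvg (fun n x => p n (dir x) + -1 * q n (dir x))
  (fun _ x => ln (r x)) _ _ _ H H' S 0 _ _ _ _ _ _ _ _ _ Ffin) => //.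
- by move=> n; apply: measurable_funD; [|apply: measurable_funM => //]; exact: measurable_comp_dir.
- by move=> n; exact: measurable_lnr.
- exact: measurable_comp_dir.
- exact: measurable_lnr.
- move=> x x0.
  have -> : F (dir x) = Num.max (F (dir x)) 0 + -1 * Num.max (- F (dir x)) 0.
    have [h|h] := leP 0 (F (dir x)).
      by rewrite (max_idPr _) ?oppr_le0// mulr0 addr0.
    by rewrite (max_idPl _) ?oppr_ge0 ?(ltW h)// add0r mulN1r opprK.
  apply: cvgD; last (apply: cvgM; first exact: cvg_cst).
    have := @cvg_nnsfun_approx _ _ _ _ measurableT _ mp _ (dir x) I.
    move=> /(_ _)/fine_cvgP[|_]; last exact.
    by move=> y _; rewrite lee_fin le_max lexx orbT.
  have := @cvg_nnsfun_approx _ _ _ _ measurableT _ mn _ (dir x) I.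
  move=> /(_ _)/fine_cvgP[|_]; last exact.
  by move=> y _; rewrite lee_fin le_max lexx orbT.
- by move=> x x0; exact: cvg_cst.
- move=> n x x0; have := ple n (dir x); have := qle n (dir x).
  move: (p n (dir x)) (q n (dir x)) (F (dir x)) => P Q f; rewrite mulN1r.
  rewrite ler_norml; have [f0|f0] := leP 0 f.
    by rewrite (max_idPr _) ?oppr_le0// (ger0_norm f0); lra.
  by rewrite (max_idPl _) ?oppr_ge0 ?(ltW f0)// (ltr0_norm f0); lra.
- by move=> n x x0; rewrite subrr normr0.
- by move=> n; apply: in_completion_fldD => //; exact: in_completion_fldZ.
Qed.

End log_polar_fields.

(** * Integration over the half-line *)

Section half_line.
Context {R : realType}.
Local Notation leb := (@lebesgue_measure R).
Implicit Types (f G : R -> R) (l t : R).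

Definition shell (n : nat) : set R := `[n.+1%:R^-1, n.+1%:R]%classic.

Lemma shell_gt0 n t : shell n t -> 0 < t.
Proof.
by rewrite /shell/= in_itv/= => /andP[h _]; apply: lt_le_trans h; rewrite invr_gt0.
Qed.

Lemma nondecreasing_shell : nondecreasing_seq shell.
Proof.
move=> n m nm; apply/subsetPset => t; rewrite /shell/= !in_itv/= => /andP[h1 h2].
have nm' : n.+1%:R <= m.+1%:R :> R by rewrite ler_nat.
apply/andP; split; last exact: le_trans nm'.
by apply: le_trans h1; rewrite lef_pV2 ?posrE.
Qed.

Lemma bigcup_shell : \bigcup_n shell n = `]0, +oo[%classic.
Proof.
apply/seteqP; split => t; first by move=> [n _ /shell_gt0]; rewrite /= in_itv/= andbT.
rewrite /= in_itv/= andbT => t0.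
have [n] : exists n : nat, Num.max t t^-1 < n%:R.
  by exists (Num.truncn (Num.max t t^-1)).+1; exact: truncnS_gt.
rewrite gt_max => /andP[h1 h2]; exists n => //; rewrite /shell/= in_itv/=.
have h (x : R) : x < n%:R -> x <= n.+1%:R.
  by move=> xn; rewrite (le_trans (ltW xn))// ler_nat.
by rewrite h// andbT -[t]invrK lef_pV2 ?posrE ?invr_gt0// h.
Qed.

Lemma ge0_shell_cvg f : measurable_fun setT f -> (forall t, 0 < t -> 0 <= f t) ->
  (\int[leb]_(t in shell n) (f t)%:E @[n --> \oo] --> \int[leb]_(t in `]0%R, +oo[) (f t)%:E)%E.
Proof.
move=> mf f0; rewrite -bigcup_shell; apply: ge0_nondecreasing_set_cvg_integral.
- exact: nondecreasing_shell.
- by move=> n; exact: measurable_itv.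
- by move=> n; apply/measurable_EFinP; exact: measurable_funTS.
- by move=> n t /shell_gt0 t0; rewrite lee_fin f0.
Qed.

(** Integration of [G' = f1 - f2] over the intervals [1 / n, n]. Monotone
    convergence applies to [f1] and to [f2] separately, and both sides may be
    infinite. *)
Lemma half_line_balance G f1 f2 l :
  measurable_fun setT f1 -> measurable_fun setT f2 ->
  (forall t, 0 < t -> 0 <= f1 t) -> (forall t, 0 < t -> 0 <= f2 t) ->
  (forall t, 0 < t -> {for t, continuous f1}) ->
  (forall t, 0 < t -> {for t, continuous f2}) ->
  (forall t, 0 < t -> is_derive t (1 : R) G (f1 t - f2 t)) ->
  G n.+1%:R - G n.+1%:R^-1 @[n --> \oo] --> l ->
  (\int[leb]_(t in `]0%R, +oo[) (f1 t)%:E =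
   \int[leb]_(t in `]0%R, +oo[) (f2 t)%:E + l%:E)%E.
Proof.
move=> mf1 mf2 f10 f20 cf1 cf2 dG cG.
have c1 := ge0_shell_cvg mf1 f10; have c2 := ge0_shell_cvg mf2 f20.
have ishell n f : (forall t, 0 < t -> {for t, continuous f}) ->
    leb.-integrable (shell n) (EFin \o f).
  move=> cf; apply: continuous_compact_integrable; first exact: segment_compact.
  by apply: continuous_in_subspaceT => t; rewrite inE => /shell_gt0; exact: cf.
have step n : (\int[leb]_(t in shell n) (f1 t)%:E =
    \int[leb]_(t in shell n) (f2 t)%:E + (G n.+1%:R - G n.+1%:R^-1)%:E)%E.
  have fin : (\int[leb]_(t in shell n) (f2 t)%:E)%E \is a fin_num.
    apply: integrable_fin_num; first exact: measurable_itv.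
    exact: ishell.
  case: n fin => [|n] fin.
    have E f : (\int[leb]_(t in shell 0) (f t)%:E = 0)%E.
      by rewrite /shell invr1 set_itv1 (@integral_Sset1 _ _ _ 1).
    by rewrite !E invr1 subrr adde0.
  have lt12 : (n.+2%:R^-1 < n.+2%:R :> R).
    by rewrite (@lt_trans _ _ 1)// ?invf_lt1 ?ltr1n.
  have : (\int[leb]_(t in shell n.+1) (f1 t - f2 t)%:E =
      (G n.+2%:R)%:E - (G n.+2%:R^-1)%:E)%E.
    have cG0 t : 0 < t -> {for t, continuous G}.
      move=> t0; apply: differentiable_continuous; apply/derivable1_diffP.
      by have [] := dG t t0.
    have i0 : 0 < n.+2%:R^-1 :> R by rewrite invr_gt0.
    rewrite /shell (@continuous_FTC2 R (fun t => f1 t - f2 t) G)//.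
    - apply: continuous_in_subspaceT => t; rewrite inE => /shell_gt0 t0.
      by apply: cvgB; [exact: cf1|exact: cf2].
    - split.
      + move=> t /[!in_itv]/= /andP[h _]; apply: ex_derive; apply: dG.
        exact: lt_trans h.
      + by apply: cvg_at_right_filter; exact: cG0.
      + by apply: cvg_at_left_filter; exact: cG0.
    - move=> t /[!in_itv]/= /andP[h _]; rewrite derive1E; apply: derive_val.
      by apply: dG; exact: lt_trans h.
  under eq_integral do rewrite EFinB.
  rewrite integralB_EFin//; [|exact: measurable_itv|exact: ishell|exact: ishell].
  rewrite EFinB; move=> <-.
  have f1fin : (\int[leb]_(t in shell n.+1) (f1 t)%:E)%E \is a fin_num.
    apply: integrable_fin_num; first exact: measurable_itv.
    exact: ishell.
  by rewrite addeC subeK.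
have c2' : ((fun n => \int[leb]_(t in shell n) (f2 t)%:E + (G n.+1%:R - G n.+1%:R^-1)%:E) @ \oo
    --> \int[leb]_(t in `]0%R, +oo[) (f2 t)%:E + l%:E)%E.
  apply: cvgeD => //; first by rewrite fin_num_adde_defl.
  by apply: cvg_EFin => //; exact: nearW.
apply: cvg_unique c1 _ => //.
by rewrite (_ : (fun n => _) = (fun n => \int[leb]_(t in shell n) (f2 t)%:E +
  (G n.+1%:R - G n.+1%:R^-1)%:E)%E)//; apply/funext => n; exact: step.
Qed.

(** The antiderivative [atan (ln t)] is bounded. *)
Lemma integral_inv_1ln2_lty :
  (\int[leb]_(t in `]0%R, +oo[) ((1 + ln t ^+ 2)^-1 / t)%:E < +oo)%E.
Proof.
have m1 : measurable_fun setT (fun t : R => (1 + ln t ^+ 2)^-1 / t).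
  apply: measurable_funM; last exact: measurable_inv.
  apply: (measurableT_comp measurable_inv); apply: measurable_funD => //.
  exact: measurable_funX.
have p t : 0 < 1 + ln t ^+ 2 by rewrite ltr_pwDl// sqr_ge0.
have nd : nondecreasing_seq (fun n => atan (ln n.+1%:R) - atan (ln n.+1%:R^-1) : R).
  move=> n m nm; have nm' : n.+1%:R <= m.+1%:R :> R by rewrite ler_nat.
  apply: lerB; apply: le_atan; rewrite ler_ln ?posrE ?invr_gt0//.
  by rewrite lef_pV2 ?posrE.
have : cvgn (fun n => atan (ln n.+1%:R) - atan (ln n.+1%:R^-1) : R).
  apply: nondecreasing_is_cvgn => //; exists pi => _ [n _ <-].
  have := @atan_ltpi2 R (ln n.+1%:R); have := @atan_gtNpi2 R (ln n.+1%:R^-1); lra.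
move=> /cvg_ex[l cl].
have dA t : 0 < t -> is_derive t (1 : R) (fun t => atan (ln t)) ((1 + ln t ^+ 2)^-1 / t - cst 0 t).
  move=> t0; have := @is_derive1_comp R atan (@ln R) t _ _
    (is_derive1_atan (ln t)) (is_derive1_ln t0).
  by rewrite subr0.
have cA t : 0 < t -> {for t, continuous (fun t : R => (1 + ln t ^+ 2)^-1 / t)}.
  move=> t0; apply: cvgM; last by apply: inv_continuous; rewrite gt_eqF.
  apply: (@continuous_comp _ _ _ (fun t : R => 1 + ln t ^+ 2) (fun t : R => t^-1)).
    apply: cvgD; first exact: cvg_cst.
    apply: (@continuous_comp _ _ _ (@ln R) (fun t : R => t ^+ 2)).
      exact: continuous_ln.
    exact: exprn_continuous.
  by apply: inv_continuous; rewrite gt_eqF.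
rewrite (half_line_balance m1 (measurable_cst (0 : R)) _ _ cA _ dA cl).
- by rewrite integral0_eq// add0e ltry.
- by move=> t t0; rewrite divr_ge0 ?invr_ge0 ?ltW.
- by [].
- by move=> t t0; exact: cvg_cst.
Qed.

End half_line.

(** * Weighted norms in polar coordinates *)

Section polar_fields.
Context {R : realType} {N : nat} (K : set 'rV[R]_N) (hK : Kss_o K).
Hypothesis hN : (2 <= N)%N.
Implicit Types (u v f w F : 'rV[R]_N -> R) (x : 'rV[R]_N) (c d S M : R)
  (H : R -> R).
Local Notation leb := (@lebesgue_measure R).
Local Notation lebN := (@lebesgue_rV R N).
Local Notation r := (normK K).

Definition L2_dir (mu : {finite_measure set 'rV[R]_N -> \bar R}) F :=
  measurable_fun setT F /\ (\int[mu]_(s in bdry K) ((F (dir s)) ^+ 2)%:E < +oo)%E.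

(** In polar coordinates the weighted norms of [F(x/|x|) H(ln r)] factorize. *)
Lemma wint_polar (mu : {finite_measure set 'rV[R]_N -> \bar R}) c F H :
  polar_measure K mu -> measurable_fun setT F -> measurable_fun setT H ->
  wint K c (fld (fun x => F (dir x)) (fun x => ln (r x)) H) =
  (\int[mu]_(s in bdry K) ((F (dir s)) ^+ 2)%:E *
   \int[leb]_(t in `]0%R, +oo[) (H (ln t) ^+ 2 * expR ((N%:R - c) * ln t) / t)%:E)%E.
Proof.
move=> hmu mF mH.
have mFd := measurable_comp_dir mF.
set u := fld _ _ _.
have mu_ : measurable_fun setT u.
  apply: (measurable_off_origin hK); apply: measurable_funM => //.
  by apply: (measurableT_comp mH); exact: measurable_lnr.
have wc := weight_pow hK c.
rewrite /wint (polar_measure_rays hK hmu); last 2 first.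
- exact: (measurable_qint wc).
- by move=> x; rewrite lee_fin mulr_ge0 ?sqr_ge0//; case: wc.
set J := (\int[leb]_(t in _) _)%E.
have mJ : measurable_fun setT (fun t => H (ln t) ^+ 2 * expR ((N%:R - c) * ln t) / t).
  apply: measurable_funM; last exact: measurable_inv.
  apply: measurable_funM.
    by apply: measurable_funX; exact: (measurableT_comp mH (@measurable_ln R)).
  apply: (measurableT_comp (@measurable_expR R)).
  by apply: measurable_funM.
have q0 t : 0 < t -> 0 <= H (ln t) ^+ 2 * expR ((N%:R - c) * ln t) / t.
  move=> t0; apply: divr_ge0; last exact: ltW.
  by apply: mulr_ge0; [exact: sqr_ge0|exact: expR_ge0].
have J0 : (0 <= J)%E.
  apply: integral_ge0 => t; rewrite /= in_itv/= andbT => t0.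
  by rewrite lee_fin; exact: q0.
transitivity (\int[mu]_(s in bdry K) (((F (dir s)) ^+ 2)%:E * J))%E; last first.
  rewrite muleC -ge0_integralZl//.
  - by apply: eq_integral => s _; rewrite muleC.
  - exact: measurable_bdry.
  - apply/measurable_EFinP; apply: measurable_funTS.
    by apply: measurable_funX; exact: mFd.
  - by move=> s _; rewrite lee_fin sqr_ge0.
apply: eq_integral => s; rewrite inE => sK; have s1 := (bdryP hK s).1 sK.
have s0 := bdry_neq0 hK sK.
rewrite -ge0_integralZl//; last 3 first.
- by apply/measurable_EFinP; apply: measurable_funTS; exact: mJ.
- move=> t; rewrite /= in_itv/= andbT => t0.
  by rewrite lee_fin; exact: q0.
- by rewrite lee_fin sqr_ge0.
transitivity (\int[leb]_(t in `]0%R, +oo[) (((F (dir s)) ^+ 2)%:E *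
    (H (ln t) ^+ 2 * expR ((N%:R - c) * ln t) / t)%:E))%E; last by [].
rewrite integral_mkcond [RHS]integral_mkcond; apply: eq_integral => t _.
rewrite !patchE !mem_setE !in_itv/= !andbT.
have [t0|t0|t0] := ltgtP 0 t => //; last first.
  by rewrite -t0 expr0n -subn1 subn_eq0 leqNgt hN mule0.
rewrite -!EFinM; congr _%:E.
rewrite /u /fld scaler_eq0 (gt_eqF t0) (negbTE s0)/= dirZ// normKZ ?(ltW t0)// s1 mulr1.
have -> : t ^+ N.-1 = expR (N%:R * ln t) / t.
  have N0 : (0 < N)%N by rewrite (leq_trans _ hN).
  rewrite expRM_natl lnK ?posrE// -{2}(prednK N0) exprSr mulfK//.
  by rewrite gt_eqF.
rewrite /powR (gt_eqF t0) mulrBl expRD -expRN exprMn -mulNr.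
ring.
Qed.

(** In the logarithmic variable the integrand is dominated by [M / (1 + s ^ 2)]. *)
Lemma wint_polar_lty (mu : {finite_measure set 'rV[R]_N -> \bar R}) c F H M :
  polar_measure K mu -> L2_dir mu F -> measurable_fun setT H ->
  (forall s, H s ^+ 2 * expR ((N%:R - c) * s) * (1 + s ^+ 2) <= M) ->
  (wint K c (fld (fun x => F (dir x)) (fun x => ln (r x)) H) < +oo)%E.
Proof.
move=> hmu [mF F2] mH HM; rewrite (wint_polar c hmu mF mH).
have p (s : R) : 0 < 1 + s ^+ 2 by rewrite ltr_pwDl// sqr_ge0.
have F0 : (0 <= \int[mu]_(s in bdry K) ((F (dir s)) ^+ 2)%:E)%E.
  by apply: integral_ge0 => s _; rewrite lee_fin sqr_ge0.
apply: lte_mul_pinfty => //.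
  by rewrite ge0_fin_numE.
have q0 t : 0 < t -> 0 <= H (ln t) ^+ 2 * expR ((N%:R - c) * ln t) / t.
  move=> t0; apply: divr_ge0; last exact: ltW.
  by apply: mulr_ge0; [exact: sqr_ge0|exact: expR_ge0].
have M0 : 0 <= M.
  apply: le_trans (HM 0); apply: mulr_ge0; last exact: ltW.
  by apply: mulr_ge0; [exact: sqr_ge0|exact: expR_ge0].
apply: (@le_lt_trans _ _ (\int[leb]_(t in `]0%R, +oo[) (M%:E * ((1 + ln t ^+ 2)^-1 / t)%:E))%E).
  apply: ge0_le_integral.
  - exact: measurable_itv.
  - move=> t; rewrite /= in_itv/= andbT => t0.
    by rewrite lee_fin; exact: q0.
  - apply/measurable_EFinP; apply: measurable_funTS.
    apply: measurable_funM; last exact: measurable_inv.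
    apply: measurable_funM.
      by apply: measurable_funX; exact: (measurableT_comp mH (@measurable_ln R)).
    apply: (measurableT_comp (@measurable_expR R)).
    by apply: measurable_funM.
  - apply: measurable_funeM; apply/measurable_EFinP; apply: measurable_funTS.
    apply: measurable_funM; last exact: measurable_inv.
    apply: (measurableT_comp measurable_inv); apply: measurable_funD => //.
    exact: measurable_funX.
  - move=> t; rewrite /= in_itv/= andbT => t0.
    rewrite -EFinM lee_fin [M * _]mulrA ler_pM2r ?invr_gt0// ler_pdivlMr//.
rewrite ge0_integralZl_EFin//.
- have := @integral_inv_1ln2_lty R.
  have : (0 <= \int[leb]_(t in `]0%R, +oo[) ((1 + ln t ^+ 2)^-1 / t)%:E)%E.
    apply: integral_ge0 => t; rewrite /= in_itv/= andbT => t0.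
    by rewrite lee_fin divr_ge0 ?invr_ge0 ?(ltW (p _))// ltW.
  by case: (\int[leb]_(t in _) _)%E => // y _ _; rewrite -EFinM ltry.
- move=> t; rewrite /= in_itv/= andbT => t0.
  by rewrite lee_fin divr_ge0 ?invr_ge0 ?(ltW (p _))// ltW.
- apply/measurable_EFinP; apply: measurable_funTS.
  apply: measurable_funM; last exact: measurable_inv.
  apply: (measurableT_comp measurable_inv); apply: measurable_funD => //.
  exact: measurable_funX.
Qed.

Lemma L2_dir_norm (mu : {finite_measure set 'rV[R]_N -> \bar R}) F :
  L2_dir mu F -> L2_dir mu (fun x => `|F x|).
Proof.
move=> [mF F2]; split.
  by apply: (measurableT_comp (@normr_measurable R setT)).
by under eq_integral do rewrite real_normK ?num_real//.
Qed.

Lemma annulus_finite_L2 (mu : {finite_measure set 'rV[R]_N -> \bar R}) F :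
  polar_measure K mu -> L2_dir mu F -> annulus_finite K (fun x => `|F (dir x)|).
Proof.
move=> hmu [mF F2]; split.
  by apply: (measurableT_comp (@normr_measurable R setT)); exact: measurable_comp_dir.
move=> S c.
apply: (wint_polar_lty (M := expR (`|N%:R - c| * S) * (1 + S ^+ 2)) hmu (L2_dir_norm (conj mF F2))).
  exact: measurable_ind.
move=> s; have [sS|sS] := leP `|s| S; last first.
  by rewrite expr0n !mul0r mulr_ge0 ?expR_ge0// addr_ge0// sqr_ge0.
rewrite expr1n mul1r; apply: ler_pM; rewrite ?expR_ge0//.
- by rewrite addr_ge0// sqr_ge0.
- rewrite ler_expR (le_trans (ler_norm _))// normrM ler_wpM2l//.
- by rewrite lerD2l -real_normK ?num_real// lerXn2r ?nnegrE// (le_trans _ sS).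
Qed.

End polar_fields.

(** * Smooth functions of one variable *)

Section smooth_one_variable.
Context {R : realType}.
Implicit Types (f h : R -> R) (s t k d : R).

(** A class of functions closed under differentiation consists of smooth
    functions. *)
Lemma smooth1_class (C : set (R -> R)) :
  (forall f, C f -> exists2 f', C f' & forall t, is_derive t (1 : R) f (f' t)) ->
  forall f, C f -> smooth1 setT f.
Proof.
move=> HC f Cf.
have /choice[D DP] : forall f, exists f', C f ->
    C f' /\ forall t, is_derive t (1 : R) f (f' t).
  move=> f0; have [Cf0|nCf0] := pselect (C f0); last by exists f0.
  by have [f' Cf' df'] := HC _ Cf0; exists f'.
have CD n : C (iter n D f) by elim: n => [//|n IH]; exact: (DP _ IH).1.
exists (fun n => iter n D f); split => // n t _.
exact: (DP _ (CD n)).2.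
Qed.

Lemma smooth1_affine k d f : smooth1 setT f -> smooth1 setT (fun s => f (k * s + d)).
Proof.
move=> [F [F0 dF]].
apply: (@smooth1_class [set g | exists n (c : R), g = fun s => c * F n (k * s + d)]); last first.
  by exists 0%N, 1; apply/funext => s; rewrite mul1r F0.
move=> _ [n [c ->]]; exists (fun s => c * k * F n.+1 (k * s + d)).
  by exists n.+1, (c * k).
move=> t; have da : is_derive t (1 : R) (k \*: id + cst d) k.
  by apply: is_derive_eq; rewrite addr0 [_ *: _]mulr1.
have := is_deriveZ c (@is_derive1_comp R (F n) (k \*: id + cst d) t _ _ (dF n _ I) da).
by move=> /is_derive_eq; apply; rewrite /GRing.scale/=; ring.
Qed.

Lemma smooth1M f h : smooth1 setT f -> smooth1 setT h -> smooth1 setT (fun s => f s * h s).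
Proof.
move=> [F [F0 dF]] [G [G0 dG]].
apply: (@smooth1_class [set g | exists s : seq (nat * nat),
   g = fun t => \sum_(p <- s) F p.1 t * G p.2 t]); last first.
  by exists [:: (0%N, 0%N)]; apply/funext => s; rewrite big_seq1 F0 G0.
move=> _ [s ->]; elim: s => [|p s [g' [s' s'E] dg']].
  exists (fun=> 0); first by exists [::]; apply/funext => t; rewrite big_nil.
  move=> t; rewrite (_ : (fun _ => _) = cst 0); first exact: is_derive_cst.
  by apply/funext => u; rewrite big_nil.
exists (fun t => F p.1.+1 t * G p.2 t + (F p.1 t * G p.2.+1 t + g' t)).
  exists ((p.1.+1, p.2) :: (p.1, p.2.+1) :: s'); apply/funext => t.
  by rewrite !big_cons/= s'E.
move=> t; rewrite (_ : (fun _ => _) = F p.1 * G p.2 + (fun t => \sum_(p <- s) F p.1 t * G p.2 t)).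
  have := is_deriveD (is_deriveM (dF p.1 t I) (dG p.2 t I)) (dg' t).
  by move=> /is_derive_eq; apply; rewrite /GRing.scale/=; ring.
by apply/funext => u; rewrite big_cons.
Qed.

(** Solutions of polynomial differential systems of this shape are smooth. *)
Lemma smooth1_ode (A B : {poly R}) f h :
  (forall t, is_derive t (1 : R) f A.[f t]) ->
  (forall t, is_derive t (1 : R) h (B.[f t] * h t)) -> smooth1 setT h.
Proof.
move=> df dh.
apply: (@smooth1_class [set g | exists P : {poly R}, g = fun t => P.[f t] * h t]); last first.
  by exists 1; apply/funext => t; rewrite hornerC mul1r.
move=> _ [P ->]; exists (fun t => (P^`() * A + P * B).[f t] * h t).
  by exists (P^`() * A + P * B).
move=> t; have dP : is_derive (f t) (1 : R) (horner P) P^`().[f t] by exact: is_derive_poly.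
have := is_deriveM (@is_derive1_comp R (horner P) f t _ _ dP (df t)) (dh t).
move=> /is_derive_eq; apply; rewrite hornerD !hornerM /GRing.scale/=; ring.
Qed.

(** A smooth cutoff, equal to [1] at the origin only, which is enough since it
    will be dilated. *)
Definition cutoff s : R := expR 2 * (smooth_step (1 * s + 1) * smooth_step (- 1 * s + 1)).

Lemma smooth1_cutoff : smooth1 setT cutoff.
Proof.
have sc : smooth1 setT (fun=> expR 2 : R).
  exists (fun n => if n is 0 then fun=> expR 2 else fun=> 0); split => // -[|n] t _;
  exact: is_derive_cst.
by apply: smooth1M sc _; apply: smooth1M; apply: smooth1_affine; exact: smooth1_smooth_step.
Qed.

Lemma cutoff_eq0 s : 1 < `|s| -> cutoff s = 0.
Proof.
move=> s1; rewrite /cutoff !smooth_stepE mul1r mulN1r.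
move: s1; rewrite lter_normr => /orP[s1|s1].
  by rewrite [0 < - s + 1]ltNge (_ : - s + 1 <= 0) ?mulr0//; lra.
by rewrite [0 < s + 1]ltNge (_ : s + 1 <= 0) ?mul0r ?mulr0//; lra.
Qed.

Lemma cutoff0 : cutoff 0 = 1.
Proof.
rewrite /cutoff !mulr0 !add0r smooth_stepE ltr01 invr1 -!expRD.
by rewrite -expR0; congr expR; ring.
Qed.

Lemma cutoff_profile : exists cutoff', compact_profile cutoff cutoff' 1.
Proof.
have [F [F0 dF]] := smooth1_cutoff; exists (F 1%N); split.
- exact: smooth1_cutoff.
- by move=> s; rewrite -F0; exact: dF.
move=> s s1; split; first exact: cutoff_eq0.
have [_ <-] := dF 0%N s I.
have d0 : is_derive s (1 : R) (F 0%N) 0.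
  apply: near_eq_is_derive (is_derive_cst (0 : R) s (1 : R)); rewrite ?oner_neq0// F0.
  have cid : id @ nbhs s --> s by exact: cvg_id.
  near=> t; rewrite cutoff_eq0//; near: t.
  exact: (cvgr_norm_gt _ cid _ s1).
by case: d0.
Unshelve. all: by end_near. Qed.

End smooth_one_variable.

(** * Radial profiles without compact support *)

Section profiles.
Context {R : realType} {N : nat} (K : set 'rV[R]_N) (hK : Kss_o K).
Hypothesis hN : (2 <= N)%N.
Variables a b : R.
Implicit Types (F : 'rV[R]_N -> R) (x : 'rV[R]_N) (H : R -> R) (s M : R).
Local Notation r := (normK K).

(** The cutoff at scale [n] costs an error of order [H / n] on the radial
    derivative, supported in [|s| <= n]: this is at most [H / (1 + |s|)], so that
    the boundedness of [H^2 e^{(N - 2 b - 2) s}] is enough. This covers the case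
    [b = (N - 2) / 2]. *)
Lemma in_completion_profile (mu : {finite_measure set 'rV[R]_N -> \bar R}) F H H' M :
  polar_measure K mu -> L2_dir K mu F -> smooth1 setT H ->
  (forall s, is_derive s (1 : R) H (H' s)) ->
  (forall s, H s ^+ 2 * expR ((N%:R - 2 * a) * s) * (1 + s ^+ 2) <= M) ->
  (forall s, H' s ^+ 2 * expR ((N%:R - 2 * b - 2) * s) * (1 + s ^+ 2) <= M) ->
  (forall s, H s ^+ 2 * expR ((N%:R - 2 * b - 2) * s) <= M) ->
  in_completion K a b (fld (fun x => F (dir x)) (fun x => ln (r x)) H)
    (dfld K (fun x => F (dir x)) (fun x => ln (r x)) H').
Proof.
move=> hmu L2F sH dH Ha Hb Hc; have [mF F2] := L2F.
have cH := smooth1_continuous sH; have cH' := smooth1_derive_continuous sH dH.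
have [chi' [sc dc c0]] := @cutoff_profile R.
have cc := smooth1_continuous sc; have cc' := smooth1_derive_continuous sc dc.
have [C C0 hC] := compact_supp_bounded cc (fun s h => (c0 s h).1).
have [D D0 hD] := compact_supp_bounded cc' (fun s h => (c0 s h).2).
pose k (n : nat) : R := n.+1%:R^-1.
have k0 n : 0 < k n by rewrite invr_gt0.
pose Hn n s := H s * cutoff (k n * s + 0).
pose Hn' n s := H' s * cutoff (k n * s + 0) + H s * (k n * chi' (k n * s + 0)).
have dHn n s : is_derive s (1 : R) (Hn n) (Hn' n s).
  have da : is_derive s (1 : R) (k n \*: id + cst 0) (k n).
    by apply: is_derive_eq; rewrite addr0 [_ *: _]mulr1.
  have := is_deriveM (dH s) (@is_derive1_comp R cutoff (k n \*: id + cst 0) s _ _ (dc _) da).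
  move=> /is_derive_eq; apply; rewrite /Hn' /GRing.scale/=.
  have -> : (k n \*: id + cst 0) s = k n * s + 0 by [].
  by ring.
have pn n : compact_profile (Hn n) (Hn' n) n.+1%:R.
  split => //; first by apply: smooth1M sH _; exact: smooth1_affine.
  move=> s sn; have h : 1 < `|k n * s + 0|.
    by rewrite addr0 normrM gtr0_norm// mulrC ltr_pdivlMr// mul1r.
  by rewrite /Hn /Hn'; have [-> ->] := c0 _ h; rewrite !mulr0 addr0.
have kD n s : `|k n * chi' (k n * s + 0)| <= 2 * D / (1 + `|s|).
  have p1 : 0 < 1 + `|s| by rewrite ltr_pwDl.
  have [h|h] := ltP 1 `|k n * s + 0|.
    by have [_ ->] := c0 _ h; rewrite mulr0 normr0 divr_ge0 ?mulr_ge0// ltW.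
  rewrite normrM gtr0_norm// mulrAC ler_pM//; first exact: ltW.
  move: h; rewrite addr0 normrM gtr0_norm// mulrC ler_pdivrMr// mul1r => h.
  rewrite ler_pdivlMr// mulrC ler_pdivrMr// -natr1 in h *.
  have : 0 <= n%:R :> R by [].
  by lra.
pose U := fld (fun x => `|F (dir x)|) (fun x => ln (r x)) (fun s => (C + 1) * `|H s|).
pose h2 s := ((C + 1) * `|H' s| + 2 * D / (1 + `|s|) * `|H s|) * expR (- s).
pose V := fld (fun x => `|F (dir x)|) (fun x => ln (r x)) h2.
have mnF : measurable_fun setT (fun x => `|F (dir x)|).
  by apply: (measurableT_comp (@normr_measurable R setT)); exact: measurable_comp_dir.
have mH : measurable_fun setT H by exact: continuous_measurable_fun.
have mH' : measurable_fun setT H' by exact: continuous_measurable_fun.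
have mn (f : R -> R) : measurable_fun setT f -> measurable_fun setT (fun s => `|f s|).
  by move=> mf; exact: (measurableT_comp (@normr_measurable R setT)).
have m1 : measurable_fun setT (fun s => (C + 1) * `|H s|).
  by apply: measurable_funM => //; exact: mn.
have m2 : measurable_fun setT h2.
  apply: measurable_funM; last first.
    apply: (measurableT_comp (@measurable_expR R)); exact: oppr_measurable.
  apply: measurable_funD; first by apply: measurable_funM => //; exact: mn.
  apply: measurable_funM; last exact: mn.
  apply: measurable_funM => //; apply: (measurableT_comp measurable_inv).
  by apply: measurable_funD => //; exact: mn.
have mfld (h : R -> R) G : measurable_fun setT G -> measurable_fun setT h ->
    measurable_fun setT (fld G (fun x => ln (r x)) h).
  move=> mG mh; apply: (measurable_off_origin hK); apply: measurable_funM => //.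
  by apply: (measurableT_comp mh); exact: measurable_lnr.
have mFd := measurable_comp_dir mF.
have mL := measurable_lnr hK.
have cn s : cutoff (k n * s + 0) @[n --> \oo] --> (1 : R).
  rewrite -cutoff0; apply: continuous_cvg; first exact: cc.
  rewrite -[X in _ --> X](addr0 0); apply: cvgD; last exact: cvg_cst.
  rewrite -[X in _ --> X](mul0r s); apply: cvgM; last exact: cvg_cst.
  exact: cvg_harmonic.
have cn' s : k n * chi' (k n * s + 0) @[n --> \oo] --> (0 : R).
  rewrite -[X in _ --> X](mul0r (chi' 0)); apply: cvgM; first exact: cvg_harmonic.
  apply: continuous_cvg; first exact: cc'.
  rewrite -[X in _ --> X](addr0 0); apply: cvgD; last exact: cvg_cst.
  rewrite -[X in _ --> X](mul0r s); apply: cvgM; last exact: cvg_cst.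
  exact: cvg_harmonic.
have M0 : 0 <= M by apply: le_trans (Hc 0); rewrite mulr_ge0 ?expR_ge0// sqr_ge0.
apply: (@in_completion_dominated _ _ _ hK a b
  (fun n => fld (fun x => F (dir x)) (fun x => ln (r x)) (Hn n))
  (fun n => dfld K (fun x => F (dir x)) (fun x => ln (r x)) (Hn' n)) _ _ U V).
- by move=> n; apply: in_completion_angular (pn n) mF _ => //; exact: annulus_finite_L2 hmu L2F.
- exact: mfld.
- exact: measurable_dfld.
- exact: mfld.
- exact: mfld.
- move=> x; rewrite /fld; case: eqVneq => [_|x0]; first exact: cvg_cst.
  apply: cvgM; first exact: cvg_cst.
  rewrite -[X in _ --> X]mulr1; apply: cvgM; [exact: cvg_cst|exact: cn].
- move=> x; rewrite /dfld; case: eqVneq => [_|x0]; first exact: cvg_cst.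
  apply: cvgM; last exact: cvg_cst.
  apply: cvgM; first exact: cvg_cst.
  rewrite -[X in _ --> X]addr0; apply: cvgD.
    rewrite -[X in _ --> X]mulr1; apply: cvgM; [exact: cvg_cst|exact: cn].
  rewrite -[X in _ --> X](mulr0 (H (ln (r x)))); apply: cvgM; [exact: cvg_cst|exact: cn'].
- move=> n x; rewrite /U /fld; case: eqVneq => [_|x0]; first by rewrite subrr normr0.
  rewrite -mulrBr normrM ler_wpM2l// /Hn -{2}[H _]mulr1 -mulrBr normrM mulrC.
  rewrite ler_wpM2r// (le_trans (ler_normB _ _))// normr1 lerD2r; exact: hC.
- move=> n x; rewrite /V /fld /dfld; case: eqVneq => [_|x0]; first by rewrite subrr normr0.
  have rx := normK_gt0 hK x0.
  rewrite -mulrBl -mulrBr !normrM -mulrA ler_wpM2l// /h2 expRN lnK ?posrE//.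
  rewrite (@gtr0_norm _ (r x)^-1) ?invr_gt0// ler_wpM2r ?invr_ge0 ?(ltW rx)//.
  rewrite /Hn' addrAC -{2}[H' _]mulr1 -mulrBr (le_trans (ler_normD _ _))// !normrM.
  rewrite lerD//.
    by rewrite mulrC ler_wpM2r// (le_trans (ler_normB _ _))// normr1 lerD2r; exact: hC.
  by rewrite mulrC ler_wpM2r// -normrM; exact: kD.
- apply: (wint_polar_lty hK hN (M := (C + 1) ^+ 2 * M) hmu (L2_dir_norm L2F) m1) => s.
  rewrite exprMn real_normK ?num_real//.
  by have := ler_wpM2l (sqr_ge0 (C + 1)) (Ha s); rewrite !mulrA.
- apply: (wint_polar_lty hK hN (M := 2 * ((C + 1) ^+ 2 * M) + 2 * ((2 * D) ^+ 2 * M))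
    hmu (L2_dir_norm L2F) m2) => s.
  set e := expR ((N%:R - 2 * b - 2) * s).
  have -> : h2 s ^+ 2 * expR ((N%:R - 2 * b) * s) * (1 + s ^+ 2) =
      ((C + 1) * `|H' s| + 2 * D / (1 + `|s|) * `|H s|) ^+ 2 * e * (1 + s ^+ 2).
    have <- : expR (- s) ^+ 2 * expR ((N%:R - 2 * b) * s) = e.
      by rewrite expr2 -!expRD; congr expR; ring.
    by rewrite /h2; ring.
  have e0 : 0 <= e by exact: expR_ge0.
  have s0 : 0 <= 1 + s ^+ 2 by rewrite addr_ge0// sqr_ge0.
  have p1 : 0 < 1 + `|s| by rewrite ltr_pwDl.
  set P := (C + 1) * _; set Q := 2 * D / _ * _.
  apply: (@le_trans _ _ (2 * (P ^+ 2 * e * (1 + s ^+ 2)) + 2 * (Q ^+ 2 * e * (1 + s ^+ 2)))).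
    rewrite -subr_ge0.
    have -> : 2 * (P ^+ 2 * e * (1 + s ^+ 2)) + 2 * (Q ^+ 2 * e * (1 + s ^+ 2)) -
      (P + Q) ^+ 2 * e * (1 + s ^+ 2) = (P - Q) ^+ 2 * e * (1 + s ^+ 2) by ring.
    by rewrite mulr_ge0// mulr_ge0// sqr_ge0.
  apply: lerD; rewrite ler_pM2l//.
    rewrite /P exprMn real_normK ?num_real//.
    by have := ler_wpM2l (sqr_ge0 (C + 1)) (Hb s); rewrite !mulrA.
  rewrite /Q exprMn real_normK ?num_real// expr_div_n.
  have -> : (2 * D) ^+ 2 / (1 + `|s|) ^+ 2 * H s ^+ 2 * e * (1 + s ^+ 2) =
    (2 * D) ^+ 2 * (H s ^+ 2 * e * ((1 + s ^+ 2) / (1 + `|s|) ^+ 2)).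
    by field; rewrite gt_eqF.
  rewrite ler_wpM2l ?sqr_ge0// (le_trans _ (Hc s))// ler_piMr//.
    by rewrite mulr_ge0// sqr_ge0.
  rewrite ler_pdivrMr ?exprn_gt0// mul1r sqrrD expr1n mul1r real_normK ?num_real//.
  by rewrite lerD2r lerDl mulrn_wge0.
Qed.

End profiles.

(** * Exponential bounds *)

Section exponential_bounds.
Context {R : realType}.
Implicit Types (k c s y beta : R).

Lemma one_plus_sqr_le_expR k s : 0 < k -> 1 + s ^+ 2 <= (1 + 4 / k ^+ 2) * expR (k * `|s|).
Proof.
move=> k0; set w := k * `|s|; have w0 : 0 <= w by rewrite mulr_ge0// ltW.
have -> : s ^+ 2 = w ^+ 2 / k ^+ 2.
  by rewrite /w exprMn real_normK ?num_real//; field; rewrite gt_eqF.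
have h : 1 + w ^+ 2 / 4 <= expR w.
  have -> : expR w = expR (w / 2) ^+ 2 by rewrite expr2 -expRD; congr expR; field.
  have : (1 + w / 2) ^+ 2 <= expR (w / 2) ^+ 2.
    by rewrite lerXn2r ?nnegrE ?expR_ge0 ?expR_ge1Dx// addr_ge0// divr_ge0.
  by apply: le_trans; rewrite -subr_ge0 (_ : _ - _ = w) //; field.
have c0 : 0 <= 4 / k ^+ 2 by rewrite divr_ge0// sqr_ge0.
apply: (@le_trans _ _ ((1 + 4 / k ^+ 2) * (1 + w ^+ 2 / 4))).
  rewrite -subr_ge0.
  have -> : (1 + 4 / k ^+ 2) * (1 + w ^+ 2 / 4) - (1 + w ^+ 2 / k ^+ 2) = 4 / k ^+ 2 + w ^+ 2 / 4.
    by field; rewrite gt_eqF.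
  by rewrite addr_ge0// divr_ge0// sqr_ge0.
by rewrite ler_wpM2l// addr_ge0.
Qed.

(** The exponential lies above its tangent of slope [k / c]. *)
Lemma linear_minus_exp k c : 0 < k -> 0 < c ->
  exists M, forall y, k * y - c * expR y <= M.
Proof.
move=> k0 c0; exists (k * (ln (k / c) - 1)) => y.
have kc : 0 < k / c by rewrite divr_gt0.
have : 1 + (y - ln (k / c)) <= expR (y - ln (k / c)) by exact: expR_ge1Dx.
rewrite expRB lnK ?posrE// ler_pdivlMr// => h.
have : c * ((1 + (y - ln (k / c))) * (k / c)) <= c * expR y by rewrite ler_pM2l.
have -> : c * ((1 + (y - ln (k / c))) * (k / c)) = k * (1 + (y - ln (k / c))).
  by field; rewrite gt_eqF.
by move=> h'; rewrite lerBlDr -lerBlDl; apply: le_trans h'; rewrite -subr_ge0 (_ : _ - _ = 0)//; ring.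
Qed.

(** With [y = beta s] and [q = k / beta], the factor [1 + s ^ 2] is absorbed by
    [exp (q |y| / 2)], which leaves the two positive slopes [q / 2] and [3 q / 2]
    to [linear_minus_exp]. *)
Lemma double_exp_decay k c beta : 0 < c -> 0 < k * beta ->
  exists M, forall s, expR (k * s - c * expR (beta * s)) * (1 + s ^+ 2) <= M.
Proof.
move=> c0 kb; have b0 : beta != 0 by apply: contraTneq kb => ->; rewrite mulr0 ltxx.
pose q := k / beta; have q0 : 0 < q.
  rewrite /q (_ : k / beta = k * beta / beta ^+ 2); last by field.
  by rewrite divr_gt0// exprn_even_gt0.
have [M1 h1] := @linear_minus_exp (q / 2) c (divr_gt0 q0 (ltr0Sn _ 1)) c0.
have [M2 h2] := @linear_minus_exp (q + q / 2) c (addr_gt0 q0 (divr_gt0 q0 (ltr0Sn _ 1))) c0.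
pose e := q / 2 * `|beta|; have e0 : 0 < e by rewrite mulr_gt0 ?normr_gt0//; exact: divr_gt0 q0 (ltr0Sn _ 1).
pose D := 1 + 4 / e ^+ 2; have D0 : 0 <= D by rewrite addr_ge0// divr_ge0// sqr_ge0.
exists (D * (expR M1 + expR M2)) => s.
apply: (@le_trans _ _ (expR (k * s - c * expR (beta * s)) * (D * expR (e * `|s|)))).
  by rewrite ler_wpM2l ?expR_ge0//; exact: one_plus_sqr_le_expR.
rewrite mulrCA ler_wpM2l// -expRD.
have E : k * s = q * (beta * s) by rewrite /q; field.
have E' : e * `|s| = q / 2 * `|beta * s| by rewrite normrM mulrA.
rewrite E E'; move: (h1 (beta * s)) (h2 (beta * s)); move: (beta * s) => y g1 g2.
have [y0|y0] := leP 0 y.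
  rewrite ger0_norm// (@le_trans _ _ (expR M2)) ?lerDr ?expR_ge0// ler_expR.
  by apply: le_trans g2; rewrite -subr_ge0 (_ : _ - _ = 0)//; ring.
rewrite ltr0_norm// (@le_trans _ _ (expR M1)) ?lerDl ?expR_ge0// ler_expR.
by apply: le_trans g1; rewrite -subr_ge0 (_ : _ - _ = 0)//; field.
Qed.

(** Integration over the half-line in the logarithmic variable. *)
Lemma log_balance (G g1 g2 : R -> R) (M : R) :
  continuous g1 -> continuous g2 -> (forall s, 0 <= g1 s) -> (forall s, 0 <= g2 s) ->
  (forall s, is_derive s (1 : R) G (g1 s - g2 s)) ->
  (forall s, `|G s| * (1 + s ^+ 2) <= M) ->
  (\int[@lebesgue_measure R]_(t in `]0%R, +oo[) (g1 (ln t) / t)%:E =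
   \int[@lebesgue_measure R]_(t in `]0%R, +oo[) (g2 (ln t) / t)%:E)%E.
Proof.
move=> cg1 cg2 g10 g20 dG GM.
have m (f : R -> R) : continuous f -> measurable_fun setT (fun t : R => f (ln t) / t).
  move=> cf; apply: measurable_funM; last exact: measurable_inv.
  apply: (@measurableT_comp _ _ _ _ _ _ f); last exact: measurable_ln.
  exact: continuous_measurable_fun.
have c (f : R -> R) (t : R) : continuous f -> 0 < t -> {for t, continuous (fun t : R => f (ln t) / t)}.
  move=> cf t0; apply: cvgM; last by apply: inv_continuous; rewrite gt_eqF.
  by apply: continuous_cvg; [exact: cf|exact: continuous_ln].
have d (t : R) : 0 < t -> is_derive t (1 : R) (fun t => G (ln t)) (g1 (ln t) / t - g2 (ln t) / t).
  move=> t0; have := @is_derive1_comp R G (@ln R) t _ _ (dG (ln t)) (is_derive1_ln t0).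
  by move=> /is_derive_eq; apply; ring.
have p0 (f : R -> R) : (forall s, 0 <= f s) -> forall t : R, 0 < t -> 0 <= f (ln t) / t.
  by move=> f0 t t0; rewrite divr_ge0// ltW.
have M0 : 0 <= M by apply: le_trans (GM 0); rewrite mulr_ge0// addr_ge0// sqr_ge0.
have lim : G (ln n.+1%:R) - G (ln n.+1%:R^-1) @[n --> \oo] --> (0 : R).
  apply/cvgr0Pnorm_le => e e0; near=> n.
  have L : 1 + 2 * M / e <= ln n.+1%:R.
    rewrite -[leLHS]expRK ler_ln ?posrE ?expR_gt0//.
    apply: (@le_trans _ _ n%:R); last by rewrite ler_nat.
    by near: n; exact: nbhs_infty_ger.
  move: L; rewrite lnV ?posrE//; move: (ln _) => L hL.
  have q : 0 <= 2 * M / e by rewrite divr_ge0 ?mulr_ge0// ltW.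
  have L1 : 1 <= L by apply: le_trans hL; rewrite lerDl.
  have p1 : 0 < 1 + L ^+ 2 by rewrite ltr_pwDl// sqr_ge0.
  have h1 := GM L; have h2 := GM (- L); rewrite sqrrN in h2.
  rewrite (le_trans (ler_normB _ _))//.
  apply: (@le_trans _ _ (M / (1 + L ^+ 2) + M / (1 + L ^+ 2))).
    by apply: lerD; rewrite ler_pdivlMr.
  rewrite -mulr2n -mulr_natl mulrA ler_pdivrMr//.
  have : 2 * M / e <= 1 + L ^+ 2.
    by rewrite expr2; move: hL L1; move: (2 * M / e) => z; nra.
  by rewrite ler_pdivrMr// [_ * e]mulrC.
by rewrite (half_line_balance (m _ cg1) (m _ cg2) (p0 _ g10) (p0 _ g20)
  (fun t => c _ t cg1) (fun t => c _ t cg2) d lim) adde0.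
Unshelve. all: by end_near. Qed.

End exponential_bounds.

(** * Extremal functions and sharpness *)

Section extremals.
Context {R : realType} {N : nat} (K : set 'rV[R]_N) (hK : Kss_o K).
Hypothesis hN : (2 <= N)%N.
Implicit Types (u v f F Phi : 'rV[R]_N -> R) (x : 'rV[R]_N) (H : R -> R)
  (a b c t p M : R).
Local Notation leb := (@lebesgue_measure R).
Local Notation lebN := (@lebesgue_rV R N).
Local Notation r := (normK K).

Lemma wint_eq_off0 c u v : measurable_fun setT u -> measurable_fun setT v ->
  (forall x, x != 0 -> u x = v x) -> wint K c u = wint K c v.
Proof.
move=> mu mv uv; have wc := weight_pow hK c.
have p w x : (0 <= (w x ^+ 2 / r x `^ c)%:E)%E.
  by rewrite lee_fin mulr_ge0 ?sqr_ge0//; case: wc.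
rewrite /wint (integral_nonzero hK hN (measurable_qint wc mu) (p u)).
rewrite (integral_nonzero hK hN (measurable_qint wc mv) (p v)).
by apply: eq_integral => x; rewrite inE => x0; rewrite uv.
Qed.

Lemma in_completion_eq_off0 a b u v g : measurable_fun setT v ->
  (forall x, x != 0 -> u x = v x) -> in_completion K a b u g -> in_completion K a b v g.
Proof.
move=> mv uv ug; have [mu mg _] := ug.
apply/in_completionP => // e e0.
have [phi tphi phie] := (in_completionP hK a b mu mg).1 ug e e0.
exists phi => //; have mphi := measurable_test_fun tphi.
rewrite /energy (@wint_eq_off0 (2 * a) (phi \- v) (phi \- u))//; try exact: measurable_funB.
by move=> x x0 /=; rewrite uv.
Qed.

(** The extension by [0] makes a density on the boundary measurable on the whole
    space. *)
Definition dir_ext Phi x : R := (Phi \_ (bdry K)) (sigmaK K x).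

Lemma dir_extE Phi x : x != 0 -> dir_ext Phi (dir x) = Phi (sigmaK K x).
Proof.
move=> x0; rewrite /dir_ext /dir sigmaKZ ?expR_gt0//.
by rewrite patchE mem_set//; apply/(bdryP hK); exact: normK_sigmaK.
Qed.

Lemma L2_dir_ext (mu : {finite_measure set 'rV[R]_N -> \bar R}) Phi :
  L2_bdry K mu Phi -> L2_dir K mu (dir_ext Phi).
Proof.
move=> [mPhi Phi2]; split.
  apply: (@measurableT_comp _ _ _ _ _ _ (Phi \_ (bdry K))); last exact: measurable_sigmaK.
  exact: (measurable_restrictT _ (measurable_bdry hK)).1.
rewrite (eq_integral (fun s => ((Phi s) ^+ 2)%:E))// => s; rewrite inE => sK.
by rewrite dir_extE ?(bdry_neq0 hK sK)// sigmaK_bdry.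
Qed.

Lemma bdry_integral_gt0 (mu : {finite_measure set 'rV[R]_N -> \bar R}) Phi :
  L2_bdry K mu Phi -> nonzero_bdry K mu Phi ->
  (0 < \int[mu]_(s in bdry K) ((dir_ext Phi (dir s)) ^+ 2)%:E)%E.
Proof.
move=> L2 nz; have [mF _] := L2_dir_ext L2.
rewrite lt_neqAle integral_ge0 ?andbT; last by move=> s _; rewrite lee_fin sqr_ge0.
apply/negP => /eqP /esym z; apply: nz.
have mB := measurable_bdry hK.
have : (\int[mu]_(s in bdry K) `|((dir_ext Phi (dir s)) ^+ 2)%:E| = 0)%E.
  by rewrite -z; apply: eq_integral => s _; rewrite gee0_abs// lee_fin sqr_ge0.
have m2 : measurable_fun (bdry K) (fun s => ((dir_ext Phi (dir s)) ^+ 2)%:E).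
  apply/measurable_EFinP; apply: measurable_funTS; apply: measurable_funX.
  exact: measurable_comp_dir.
move/(ae_eq_integral_abs mu mB m2).1; apply: filterS => s h sK.
have := h sK; rewrite dir_extE ?(bdry_neq0 hK sK)// sigmaK_bdry// => -[] /eqP.
by rewrite sqrf_eq0 => /eqP.
Qed.

Lemma measurable_eq_off0 u v : measurable_fun setT v ->
  (forall x, x != 0 -> u x = v x) -> measurable_fun setT u.
Proof.
move=> mv uv; rewrite (_ : u = fun x => v x + (u 0 - v 0) * \1_[set 0] x).
  apply: measurable_funD => //; apply: measurable_funM => //.
  by apply: measurable_indic_rV; exact: measurable_origin hK.
apply/funext => x; rewrite indicE; have [->|x0] := eqVneq x 0.
  by rewrite mem_set// mulr1 subrKC.
by rewrite memNset ?mulr0 ?addr0 ?uv//; exact/eqP.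
Qed.

Lemma half_line_integral_gt0 (f : R -> R) : measurable_fun setT f ->
  (forall t, 0 < t -> 0 < f t) -> (0 < \int[leb]_(t in `]0%R, +oo[) (f t)%:E)%E.
Proof.
move=> mf f0; rewrite lt_neqAle integral_ge0 ?andbT; last first.
  by move=> t; rewrite /= in_itv/= andbT => t0; rewrite lee_fin ltW// f0.
apply/negP => /eqP /esym z.
have mI : measurable (`]0, +oo[%classic : set R) by exact: measurable_itv.
have : (\int[leb]_(t in `]0%R, +oo[) `|(f t)%:E| = 0)%E.
  rewrite -z; apply: eq_integral => t; rewrite inE/= in_itv/= andbT => t0.
  by rewrite /= ger0_norm// ltW// f0.
have m2 : measurable_fun (`]0%R, +oo[%classic : set R) (EFin \o f).
  by apply/measurable_EFinP; exact: measurable_funTS.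
move/(ae_eq_integral_abs leb mI m2).1 => -[A [mA A0 sA]].
have : (leb `]0%R, 1%R[ <= leb A)%E.
  apply: le_measure; rewrite ?inE//.
  move=> t; rewrite /= in_itv/= => /andP[t0 _]; apply: sA => /= h.
  have : (f t)%:E = 0%E by apply: h; rewrite /= in_itv/= t0.
  by move=> -[] ft0; have := f0 t t0; rewrite ft0 ltxx.
by rewrite A0 lebesgue_measure_itv/= lte01 oppr0 adde0 leNgt lte01.
Qed.

Lemma dfldE F H' : dfld K F (fun x => ln (r x)) H' =
  fld F (fun x => ln (r x)) (fun s => H' s * expR (- s)).
Proof.
apply/funext => x; rewrite /dfld /fld; case: eqVneq => // x0.
by rewrite expRN lnK ?posrE ?normK_gt0// mulrA.
Qed.

(** In the variable [s = ln r] the profile is [exp (p s + (t / beta) exp (beta s))],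
    a solution of [H' = (p + t exp (beta s)) H]. Along the rays the three squared
    norms are integrals of exponentials [exp (k s + 2 (t / beta) exp (beta s))],
    and integrating the derivatives of such functions gives the two identities
    [G = t ^ 2 M] and [2 |t| M = |m + beta| W] between [G = wint K (2 b) g],
    [M = wint K (2 a) u] and [W = wint K (a + b + 1) u]: this is equality in the
    inequality with the constant [|m + beta| / 2]. *)
Lemma extremal (mu : {finite_measure set 'rV[R]_N -> \bar R}) Phi a b p t u :
  let beta := b + 1 - a in let m := 2 * p + N%:R - 2 - 2 * b in
  polar_measure K mu -> L2_bdry K mu Phi -> nonzero_bdry K mu Phi ->
  t * beta < 0 -> 0 <= m * beta -> p = 0 \/ (m = p /\ 0 < m * beta) ->
  (forall x, x != 0 -> u x = Phi (sigmaK K x) *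
     expR (p * ln (r x) + t / beta * expR (beta * ln (r x)))) ->
  nonzero_fun u /\ exists g, [/\ in_completion K a b u g,
    hup_lhs K a b u g = ((`|m + beta| / 2)%:E * wint K (a + b + 1) u)%E,
    (0 < wint K (a + b + 1) u)%E & (wint K (a + b + 1) u < +oo)%E].
Proof.
move=> beta m hmu L2 nz tb mb hp uE.
have L2F := L2_dir_ext L2; have [mF F2] := L2F.
have b0 : beta != 0 by apply: contraTneq tb => ->; rewrite mulr0 ltxx.
have c0 : 0 < - (2 * (t / beta)).
  rewrite (_ : - _ = 2 * (- (t * beta) / beta ^+ 2)); last by field.
  by rewrite mulr_gt0// divr_gt0 ?oppr_gt0// exprn_even_gt0.
have b2 : 0 < beta * beta by rewrite -expr2 exprn_even_gt0.
have mb1 : 0 < (m + beta) * beta by rewrite mulrDl ltr_wpDl.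
have mb2 : 0 < (m + 2 * beta) * beta by rewrite mulrDl ltr_wpDl// -mulrA mulr_gt0.
pose E k s := expR (k * s + 2 * (t / beta) * expR (beta * s)).
have E0 k s : 0 < E k s by exact: expR_gt0.
pose H s := expR (p * s + t / beta * expR (beta * s)).
pose H' s := (p + t * expR (beta * s)) * H s.
have de s : is_derive s (1 : R) (fun s => expR (beta * s)) (beta * expR (beta * s)).
  have d1 : is_derive s (1 : R) (beta \*: id) beta.
    by apply: is_derive_eq; rewrite [_ *: _]mulr1.
  have := @is_derive1_comp R expR (beta \*: id) s _ _ (is_derive_expR _) d1.
  by move=> /is_derive_eq; apply; rewrite mulrC.
have dexp (k d s : R) : is_derive s (1 : R) (fun s => expR (k * s + d * expR (beta * s)))
    ((k + d * beta * expR (beta * s)) * expR (k * s + d * expR (beta * s))).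
  have d1 : is_derive s (1 : R) (k \*: id + d \*: (fun s => expR (beta * s)))
      (k + d * beta * expR (beta * s)).
    have := is_deriveD (is_deriveZ k (is_derive_id s (1 : R))) (is_deriveZ d (de s)).
    by move=> /is_derive_eq; apply; rewrite /GRing.scale/=; ring.
  have := @is_derive1_comp R expR _ s _ _ (is_derive_expR _) d1.
  by move=> /is_derive_eq; apply; rewrite mulrC.
have dH s : is_derive s (1 : R) H (H' s).
  have := dexp p (t / beta) s; move=> /is_derive_eq; apply.
  by rewrite /H' divfK.
have dE k s : is_derive s (1 : R) (E k) ((k + 2 * t * expR (beta * s)) * E k s).
  have := dexp k (2 * (t / beta)) s; move=> /is_derive_eq; apply.
  by rewrite /E -[2 * (t / beta) * beta]mulrA divfK.
have sH : smooth1 setT H.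
  have dA s : is_derive s (1 : R) (fun s => expR (beta * s)) (beta *: 'X).[expR (beta * s)].
    by rewrite hornerZ hornerX; exact: de.
  have dB s : is_derive s (1 : R) H ((p%:P + t *: 'X).[expR (beta * s)] * H s).
    by rewrite hornerD hornerC hornerZ hornerX; exact: dH.
  exact: smooth1_ode dA dB.
have cE k : continuous (E k).
  move=> s; apply: differentiable_continuous; apply/derivable1_diffP.
  by have [] := dE k s.
have ce : continuous (fun s => expR (beta * s)).
  move=> s; apply: differentiable_continuous; apply/derivable1_diffP.
  by have [] := de s.
have Edecay k : 0 < k * beta -> exists M, forall s, E k s * (1 + s ^+ 2) <= M.
  move=> kb; have [M hM] := double_exp_decay c0 kb; exists M => s.
  by have := hM s; rewrite mulNr opprK.
have E_add k s : E (k + beta) s = expR (beta * s) * E k s.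
  by rewrite /E -expRD; congr expR; ring.
have H2 k s : H s ^+ 2 * expR (k * s) = E (2 * p + k) s.
  by rewrite /E /H expr2 -!expRD; congr expR; ring.
have [M1 hM1] := Edecay _ mb1; have [M2 hM2] := Edecay _ mb2.
have [Mp hMp] : exists M, forall s, p ^+ 2 * E m s * (1 + s ^+ 2) <= M.
  case: hp => [->|[_ mb0]].
    by exists 0 => s; rewrite expr0n !mul0r.
  have [M hM] := Edecay _ mb0; exists (p ^+ 2 * M) => s.
  by rewrite -mulrA ler_wpM2l ?sqr_ge0.
have [Mm hMm] : exists M, forall s, E m s <= M.
  have [m0|m0] := eqVneq m 0.
    exists 1 => s; rewrite /E m0 mul0r add0r -[leRHS]expR0 ler_expR.
    rewrite -oppr_ge0 -mulNr; apply: mulr_ge0; last exact: expR_ge0.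
    exact: ltW.
  have mb0 : 0 < m * beta by rewrite lt_neqAle mb andbT eq_sym mulf_neq0.
  have [M hM] := Edecay _ mb0; exists M => s.
  by apply: le_trans (hM s); rewrite ler_peMr ?(ltW (E0 _ _))// lerDl sqr_ge0.
pose M := Num.max M2 (Num.max (2 * Mp + 2 * (t ^+ 2 * M2)) Mm).
have Ma s : H s ^+ 2 * expR ((N%:R - 2 * a) * s) * (1 + s ^+ 2) <= M.
  rewrite H2 (_ : 2 * p + _ = m + 2 * beta); last by rewrite /m /beta; ring.
  by rewrite (le_trans (hM2 s))// /M le_max lexx.
have Mc s : H s ^+ 2 * expR ((N%:R - 2 * b - 2) * s) <= M.
  rewrite H2 (_ : 2 * p + _ = m); last by rewrite /m; ring.
  by rewrite (le_trans (hMm s))// /M !le_max lexx !orbT.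
have Hp2 s : H' s ^+ 2 * expR ((N%:R - 2 * b - 2) * s) = (p + t * expR (beta * s)) ^+ 2 * E m s.
  by rewrite /H' exprMn -mulrA H2 (_ : 2 * p + _ = m)//; rewrite /m; ring.
have E2 s : E (m + 2 * beta) s = expR (beta * s) ^+ 2 * E m s.
  by rewrite (_ : m + 2 * beta = m + beta + beta) ?E_add; ring.
have Mb s : H' s ^+ 2 * expR ((N%:R - 2 * b - 2) * s) * (1 + s ^+ 2) <= M.
  rewrite Hp2 /M; apply: le_trans (_ : 2 * Mp + 2 * (t ^+ 2 * M2) <= _); last first.
    by rewrite !le_max lexx orbT.
  have s0 : 0 <= 1 + s ^+ 2 by rewrite addr_ge0// sqr_ge0.
  apply: (@le_trans _ _ (2 * (p ^+ 2 * E m s * (1 + s ^+ 2)) +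
      2 * (t ^+ 2 * (E (m + 2 * beta) s * (1 + s ^+ 2))))).
    rewrite E2 -subr_ge0; set e := expR _.
    rewrite (_ : _ - _ = (p - t * e) ^+ 2 * E m s * (1 + s ^+ 2)); last by ring.
    by rewrite mulr_ge0// mulr_ge0 ?sqr_ge0// ltW.
  by apply: lerD; rewrite ler_pM2l// ler_wpM2l ?sqr_ge0.
pose F x := dir_ext Phi x.
have uf x : x != 0 -> u x = fld (fun x => F (dir x)) (fun x => ln (r x)) H x.
  by move=> x0; rewrite uE// /fld (negbTE x0) /F dir_extE.
have inf := in_completion_profile hK hN hmu L2F sH dH Ma Mb Mc.
have mf := let: And3 h _ _ := inf in h; have mg := let: And3 _ h _ := inf in h.
have mu_ : measurable_fun setT u by exact: measurable_eq_off0 mf uf.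
have inu : in_completion K a b u (dfld K (fun x => F (dir x)) (fun x => ln (r x)) H').
  by apply: in_completion_eq_off0 inf => // x x0; rewrite uf.
have mH : measurable_fun setT H.
  by apply: continuous_measurable_fun; exact: smooth1_continuous.
have cH' := smooth1_derive_continuous sH dH.
set f2 := (\int[mu]_(s in bdry K) (F (dir s) ^+ 2)%:E)%E in F2.
have f20 : (0 < f2)%E by exact: bdry_integral_gt0.
pose I k := (\int[leb]_(t in `]0%R, +oo[) (E k (ln t) / t)%:E)%E.
have W c k : k = 2 * p + (N%:R - c) -> wint K c u = (f2 * I k)%E.
  move=> ->; rewrite (wint_eq_off0 c mu_ mf uf) (wint_polar hK hN c hmu mF mH).
  by congr (_ * _)%E; apply: eq_integral => y _; rewrite H2.
have WG : wint K (2 * b) (dfld K (fun x => F (dir x)) (fun x => ln (r x)) H') =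
    (f2 * \int[leb]_(y in `]0%R, +oo[) ((p + t * expR (beta * ln y)) ^+ 2 * E m (ln y) / y)%:E)%E.
  rewrite dfldE (wint_polar hK hN (2 * b) hmu mF); last first.
    apply: continuous_measurable_fun => s; apply: cvgM; first exact: cH'.
    apply: (@continuous_comp _ _ _ (@GRing.opp R) (@expR R)); first exact: opp_continuous.
    exact: continuous_expR.
  congr (_ * _)%E; apply: eq_integral => y _; rewrite -Hp2 exprMn.
  rewrite (_ : expR ((N%:R - 2 * b - 2) * ln y) = expR (- ln y) ^+ 2 * expR ((N%:R - 2 * b) * ln y)).
    by rewrite mulrA.
  by rewrite expr2 -!expRD; congr expR; ring.
have mE k : measurable_fun setT (fun y => E k (ln y) / y).
  apply: measurable_funM; last exact: measurable_inv.
  apply: (@measurableT_comp _ _ _ _ _ _ (E k)); last exact: measurable_ln.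
  exact: continuous_measurable_fun.
have mEI k : measurable_fun (`]0%R, +oo[%classic : set R) (fun y => (E k (ln y) / y)%:E).
  by apply/measurable_EFinP; exact: (measurable_funTS (mE k)).
have B1 : (\int[leb]_(y in `]0%R, +oo[) ((p + t * expR (beta * ln y)) ^+ 2 * E m (ln y) / y)%:E =
    (t ^+ 2)%:E * I (m + 2 * beta)%R)%E.
  have sq0 s : 0 <= (p + t * expR (beta * s)) ^+ 2 * E m s.
    by rewrite mulr_ge0 ?sqr_ge0// ltW.
  have te0 s : 0 <= t ^+ 2 * E (m + 2 * beta) s by rewrite mulr_ge0 ?sqr_ge0// ltW.
  have dG s : is_derive s (1 : R) (fun s => p * E m s)
      ((p + t * expR (beta * s)) ^+ 2 * E m s - t ^+ 2 * E (m + 2 * beta) s).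
    have := is_deriveZ p (dE m s) => /is_derive_eq; apply.
    rewrite E2 /GRing.scale/=; set e := expR _; set w := E m s.
    case: hp => [->|[-> _]]; ring.
  have [Mq hMq] : exists M, forall s, `|p * E m s| * (1 + s ^+ 2) <= M.
    case: hp => [->|[_ mb0]]; first by exists 0 => s; rewrite mul0r normr0 mul0r.
    have [M' hM'] := Edecay _ mb0; exists (`|p| * M') => s.
    by rewrite normrM (gtr0_norm (E0 _ _)) -mulrA ler_wpM2l.
  rewrite (log_balance _ _ sq0 te0 dG hMq).
  - rewrite /I -ge0_integralZl_EFin//.
    + by apply: eq_integral => y _; rewrite -EFinM mulrA.
    + by move=> y; rewrite /= in_itv/= andbT => y0; rewrite lee_fin ltW// divr_gt0.
    + exact: mEI.
    + exact: sqr_ge0.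
  - move=> s; apply: cvgM; last exact: cE.
    apply: (@continuous_comp _ _ _ (fun s => p + t * expR (beta * s)) (fun z : R => z ^+ 2)).
      by apply: cvgD; [exact: cvg_cst|apply: cvgM; [exact: cvg_cst|exact: ce]].
    exact: exprn_continuous.
  - by move=> s; apply: cvgM; [exact: cvg_cst|exact: cE].
have B2 : ((2 * `|t|)%:E * I (m + 2 * beta)%R = `|m + beta|%:E * I (m + beta)%R)%E.
  (* [sg] is the sign of [beta], of [m + beta] and of [- t]. *)
  pose sg := beta / `|beta|; have nb : 0 < `|beta| by rewrite normr_gt0.
  have sgb y : 0 < y * beta -> sg * y = `|y|.
    move=> yb; rewrite /sg; move: yb nb; have [b1|b1|b1] := ltgtP beta 0.
    - rewrite nmulr_lgt0// => y0; rewrite (ltr0_norm b1) (ltr0_norm y0) => _.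
      by field; rewrite lt_eqF.
    - by rewrite pmulr_lgt0// => y0 _; rewrite (gtr0_norm b1) (gtr0_norm y0) divff ?mul1r ?gt_eqF.
    - by rewrite b1 eqxx in b0.
  have sgt : sg * t = - `|t|.
    by rewrite -normrN -sgb ?mulrN ?opprK// mulNr oppr_gt0.
  have g10 s : 0 <= 2 * `|t| * E (m + 2 * beta) s.
    by rewrite mulr_ge0 ?mulr_ge0// ltW.
  have g20 s : 0 <= `|m + beta| * E (m + beta) s by rewrite mulr_ge0// ltW.
  have dG s : is_derive s (1 : R) (fun s => - sg * E (m + beta) s)
      (2 * `|t| * E (m + 2 * beta) s - `|m + beta| * E (m + beta) s).
    have := is_deriveZ (- sg) (dE (m + beta) s) => /is_derive_eq; apply.
    rewrite -(sgb _ mb1) (_ : `|t| = - (sg * t)); last by rewrite sgt opprK.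
    rewrite (_ : m + 2 * beta = m + beta + beta) ?E_add; last by ring.
    by rewrite /GRing.scale/=; ring.
  have hG s : `|- sg * E (m + beta) s| * (1 + s ^+ 2) <= `|- sg| * M1.
    by rewrite normrM (gtr0_norm (E0 _ _)) -mulrA ler_wpM2l.
  have sc k d : 0 <= d -> (\int[leb]_(y in `]0%R, +oo[) (d * E k (ln y) / y)%:E = d%:E * I k)%E.
    move=> d0; rewrite /I -ge0_integralZl_EFin//.
    + by apply: eq_integral => y _; rewrite -EFinM mulrA.
    + by move=> y; rewrite /= in_itv/= andbT => y0; rewrite lee_fin ltW// divr_gt0.
    + exact: mEI.
  have := log_balance _ _ g10 g20 dG hG; rewrite !sc ?mulr_ge0//; apply.
  - by move=> s; apply: cvgM; [exact: cvg_cst|exact: cE].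
  - by move=> s; apply: cvgM; [exact: cvg_cst|exact: cE].
have Igt0 k : (0 < I k)%E.
  by apply: half_line_integral_gt0 => // y y0; rewrite divr_gt0.
have Wa : wint K (2 * a) u = (f2 * I (m + 2 * beta)%R)%E.
  by apply: W; rewrite /m /beta; ring.
have Wab : wint K (a + b + 1) u = (f2 * I (m + beta)%R)%E.
  by apply: W; rewrite /m /beta; ring.
have Wafin : (wint K (2 * a) u < +oo)%E.
  rewrite (wint_eq_off0 _ mu_ mf uf).
  exact: (wint_polar_lty hK hN hmu L2F mH Ma).
have [f [f_gt0 f2E]] : exists f : R, 0 < f /\ f2 = f%:E.
  have fin (z : \bar R) : (0 < z)%E -> (z < +oo)%E -> exists f : R, 0 < f /\ z = f%:E.
    by case: z => // f; rewrite lte_fin => f_gt0 _; exists f.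
  exact: fin f20 F2.
have [j [j_gt0 jE]] : exists j : R, 0 < j /\ I (m + 2 * beta) = j%:E.
  move: Wafin (Igt0 (m + 2 * beta)); rewrite Wa f2E; case: (I _) => [j| |]//.
    by rewrite lte_fin => _ j_gt0; exists j.
  by rewrite gt0_muley ?ltxx// lte_fin.
have mb_neq0 : 0 < `|m + beta|.
  by rewrite normr_gt0; apply: contraTneq mb1 => ->; rewrite mul0r ltxx.
have t_neq0 : 0 < `|t| by rewrite normr_gt0; apply: contraTneq tb => ->; rewrite mul0r ltxx.
have [i [i_gt0 iE]] : exists i : R, 0 < i /\ I (m + beta) = i%:E.
  move: B2 (Igt0 (m + beta)); rewrite jE; case: (I (m + beta)) => [i| |]//.
    by rewrite lte_fin => _ i_gt0; exists i.
  by rewrite gt0_muley// lte_fin.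
have ji : 2 * `|t| * j = `|m + beta| * i.
  by move: B2; rewrite jE iE -!EFinM => -[].
rewrite jE -EFinM in B1; rewrite B1 f2E -EFinM in WG.
rewrite jE f2E -EFinM in Wa; rewrite iE f2E -EFinM in Wab.
split.
  move=> u0; suff : wint K (2 * a) u = 0%E.
    by rewrite Wa => -[] /eqP; rewrite mulf_eq0 !gt_eqF.
  rewrite /wint (ae_eq_integral (cst 0%E)) ?integral0//.
  - exact: (measurable_qint (weight_pow hK (2 * a)) mu_).
  - by apply: filterS u0 => x -> _; rewrite expr0n mul0r.
exists (dfld K (fun x => F (dir x)) (fun x => ln (r x)) H'); split => //.
- rewrite /hup_lhs Wa Wab WG !poweR_EFin -!EFinM; congr _%:E.
  have fj0 : 0 <= f * j by rewrite ltW// mulr_gt0.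
  have ftj0 : 0 <= f * (t ^+ 2 * j).
    by apply: mulr_ge0 (ltW f_gt0) (mulr_ge0 (sqr_ge0 t) (ltW j_gt0)).
  rewrite (powR12_sqrt ftj0) (powR12_sqrt fj0) -sqrtrM//.
  have -> : f * (t ^+ 2 * j) * (f * j) = (`|t| * (f * j)) ^+ 2.
    by rewrite exprMn real_normK ?num_real//; ring.
  rewrite sqrtr_sqr ger0_norm; last exact: mulr_ge0.
  have -> : `|m + beta| / 2 * (f * i) = f * (`|m + beta| * i) / 2 by field.
  by rewrite -ji; field.
- by rewrite Wab lte_fin mulr_gt0.
- by rewrite Wab ltry.
Qed.

(** A polar measure does not vanish, since Lebesgue measure does not. *)
Lemma polar_measure_cst1 (mu : {finite_measure set 'rV[R]_N -> \bar R}) :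
  polar_measure K mu -> L2_bdry K mu (fun=> 1) /\ nonzero_bdry K mu (fun=> 1).
Proof.
move=> hmu; have mB := measurable_bdry hK; split.
  split => //; rewrite (eq_integral (cst 1%E)); last by move=> s _; rewrite expr1n.
  by rewrite integral_cst// mul1e -ge0_fin_numE//; exact: fin_num_measure.
move=> [A [mA A0 sA]].
have : (\int[lebN]_x (cst 1 x) = 0)%E.
  have mB0 : mu (bdry K) = 0%E.
    apply/eqP; rewrite eq_le measure_ge0 andbT -A0; apply: le_measure; rewrite ?inE//.
    by move=> s sK; apply: sA => /= /(_ sK) /eqP; rewrite oner_eq0.
  rewrite hmu.2//; apply: integral0_eq => y _.
  rewrite (eq_integral (cst (y ^+ N.-1)%:E)); last by move=> s _; rewrite mul1e.
  transitivity ((y ^+ N.-1)%:E * mu (bdry K))%E; first exact: integral_cst.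
  by rewrite mB0 mule0.
rewrite integral_cst// mul1e => z; have := @lebesgue_rVT_gt0 R N.
by rewrite z ltxx.
Qed.

Lemma sharp_constant_achieved a b (C : R) u g : 0 <= C -> hup_inequality K a b C ->
  in_completion K a b u g -> hup_lhs K a b u g = (C%:E * wint K (a + b + 1) u)%E ->
  (0 < wint K (a + b + 1) u)%E -> (wint K (a + b + 1) u < +oo)%E ->
  sharp_constant K a b C.
Proof.
move=> C0 HC ug uE W0 Wfin; split=> // C' HC'; have [mu mg _] := ug.
have [C'0|C'0] := leP C' 0; first exact: le_trans C0.
have := hup_approximable hK hN (ltW C'0) HC' mu mg ((in_completionP hK a b mu mg).1 ug).
rewrite uE; move: W0 Wfin; case: (wint _ _ _) => // W; rewrite lte_fin => W0 _.
by rewrite -!EFinM lee_fin ler_pM2r.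
Qed.

(** The function [r ^ - d0], with [d0 = (N - 2 b - 2) / 2], would give equality but
    has infinite norms. In the variable [s = ln r] it is multiplied by
    [(f (1 - f)) ^ e], where [f] is a logistic function: this decays like
    [exp (- e |s|)] and its logarithmic derivative [e (2 f - 1)] is at most [e]. *)
Lemma hardy_sharp b (C : R) : hup_inequality K (b + 1) b C ->
  C <= `|N%:R - 2 * (b + 1)| / 2.
Proof.
move=> HC; have [C0|C0] := leP C 0; first by rewrite (le_trans C0)// divr_ge0.
set c0 := `|_| / 2; pose d0 := (N%:R - 2 * (b + 1)) / 2.
have c0E : c0 = `|d0| by rewrite /d0 normrM (@gtr0_norm _ 2^-1)// invr_gt0.
apply/ler_addgt0Pl => e e0.
have [mu hmu] := polar_measure_exists hK hN.
have [L2 nz] := polar_measure_cst1 hmu.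
have L2F := L2_dir_ext L2; have [mF F2] := L2F.
pose f (s : R) : R := (1 + expR s)^-1.
pose H (s : R) := expR ((e - d0) * s - 2 * e * ln (1 + expR s)).
pose H' s := (- d0 - e + 2 * e * f s) * H s.
have p1 (s : R) : 0 < 1 + expR s by rewrite addr_gt0// expR_gt0.
have d1 (s : R) : is_derive s (1 : R) (cst (1 : R) + @expR R) (expR s).
  by apply: is_derive_eq; rewrite add0r.
have df s : is_derive s (1 : R) f ('X^2 - 'X : {poly R}).[f s].
  have := @is_deriveV R (cst (1 : R) + @expR R) s (expR s) 1 (lt0r_neq0 (p1 s)) (d1 s).
  move=> /is_derive_eq; apply; rewrite !hornerE /f.
  have -> : (cst (1 : R) + @expR R) s = 1 + expR s by [].
  by rewrite /GRing.scale/=; field; rewrite gt_eqF.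
have dH s : is_derive s (1 : R) H (H' s).
  have dl : is_derive s (1 : R) (fun s => ln (1 + expR s)) ((1 + expR s)^-1 * expR s).
    exact: (@is_derive1_comp R (@ln R) (cst (1 : R) + @expR R) s _ _ (is_derive1_ln (p1 s)) (d1 s)).
  have dd : is_derive s (1 : R) ((e - d0) \*: id + (- (2 * e)) \*: (fun s => ln (1 + expR s)))
      (- d0 - e + 2 * e * f s).
    have := is_deriveD (is_deriveZ (e - d0) (is_derive_id s (1 : R))) (is_deriveZ (- (2 * e)) dl).
    by move=> /is_derive_eq; apply; rewrite /f /GRing.scale/=; field; rewrite gt_eqF.
  have HE : H = expR \o ((e - d0) \*: id + (- (2 * e)) \*: (fun s => ln (1 + expR s))).
    apply/funext => y.
    transitivity (expR ((e - d0) * y + - (2 * e) * ln (1 + expR y))); last by [].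
    by rewrite /H mulNr.
  have := @is_derive1_comp R expR _ s _ _ (is_derive_expR _) dd; rewrite -HE.
  by move=> /is_derive_eq; apply; rewrite mulrC /H' HE.
have sH : smooth1 setT H.
  have dB s : is_derive s (1 : R) H (((- d0 - e)%:P + (2 * e) *: 'X).[f s] * H s).
    by rewrite hornerD hornerC hornerZ hornerX; exact: dH.
  exact: smooth1_ode df dB.
have f01 s : 0 <= f s <= 1.
  by rewrite invr_ge0 (ltW (p1 s)) invf_le1// lerDl expR_ge0.
have H'H s : `|H' s| <= (c0 + e) * `|H s|.
  rewrite normrM ler_wpM2r// c0E -addrA (le_trans (ler_normD _ _))// normrN lerD2l.
  have /andP[h0 h1] := f01 s; rewrite ler_norml.
  by apply/andP; split; nra.
have ce0 : 0 <= c0 + e by rewrite addr_ge0 ?(ltW e0)// c0E.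
have H'2 s : H' s ^+ 2 <= (c0 + e) ^+ 2 * H s ^+ 2.
  rewrite -exprMn -[leLHS]real_normK ?num_real// -[leRHS]real_normK ?num_real//.
  by rewrite lerXn2r ?nnegrE// [leRHS]normrM (ger0_norm ce0); exact: H'H.
have H2 s : H s ^+ 2 * expR (2 * d0 * s) <= expR (- (2 * e * `|s|)).
  rewrite /H expr2 -!expRD ler_expR.
  have l0 : 0 <= ln (1 + expR s) by rewrite ln_ge0// lerDl expR_ge0.
  have l1 : s <= ln (1 + expR s).
    by rewrite -{1}[s]expRK ler_ln ?posrE ?expR_gt0// lerDr.
  have [s0|s0] := leP 0 s; [rewrite ger0_norm//|rewrite ltr0_norm//]; nra.
have e20 : 0 < 2 * e by rewrite mulr_gt0.
pose D := 1 + 4 / (2 * e) ^+ 2.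
have D1 : 1 <= D by rewrite lerDl divr_ge0// sqr_ge0.
have HD s : H s ^+ 2 * expR (2 * d0 * s) * (1 + s ^+ 2) <= D.
  have s0 : 0 <= 1 + s ^+ 2 by rewrite addr_ge0// sqr_ge0.
  rewrite (le_trans (ler_wpM2r s0 (H2 s)))// expRN mulrC ler_pdivrMr ?expR_gt0//.
  exact: one_plus_sqr_le_expR.
pose M := Num.max D ((c0 + e) ^+ 2 * D).
have Ea : N%:R - 2 * (b + 1) = 2 * d0 by rewrite /d0; field.
have Eb : N%:R - 2 * b - 2 = 2 * d0 by rewrite /d0; field.
have Ma s : H s ^+ 2 * expR ((N%:R - 2 * (b + 1)) * s) * (1 + s ^+ 2) <= M.
  by rewrite Ea (le_trans (HD s))// /M le_max lexx.
have Mc s : H s ^+ 2 * expR ((N%:R - 2 * b - 2) * s) <= M.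
  rewrite Eb (le_trans (H2 s))// (@le_trans _ _ 1)//; last first.
    by rewrite (le_trans D1)// /M le_max lexx.
  by rewrite -[leRHS]expR0 ler_expR oppr_le0 mulr_ge0// ltW.
have Mb s : H' s ^+ 2 * expR ((N%:R - 2 * b - 2) * s) * (1 + s ^+ 2) <= M.
  rewrite Eb; apply: (@le_trans _ _ ((c0 + e) ^+ 2 * D)); last by rewrite /M le_max lexx orbT.
  apply: le_trans (ler_wpM2l (sqr_ge0 (c0 + e)) (HD s)).
  have s0 : 0 <= 1 + s ^+ 2 by rewrite addr_ge0// sqr_ge0.
  by rewrite [leRHS]mulrA ler_wpM2r// [leRHS]mulrA ler_wpM2r ?expR_ge0.
have ug := in_completion_profile hK hN hmu L2F sH dH Ma Mb Mc.
set u := fld _ _ _ in ug; set g := dfld _ _ _ _ in ug.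
have [mu_ mg _] := ug.
have mH : measurable_fun setT H.
  by apply: continuous_measurable_fun; exact: smooth1_continuous.
have := hup_approximable hK hN (ltW C0) HC mu_ mg ((in_completionP hK _ b mu_ mg).1 ug).
rewrite /hup_lhs (_ : b + 1 + b + 1 = 2 * (b + 1)); last by ring.
have Wfin : (wint K (2 * (b + 1)) u < +oo)%E := wint_polar_lty hK hN hmu L2F mH Ma.
have W0 : (0 < wint K (2 * (b + 1)) u)%E.
  rewrite /u (wint_polar hK hN _ hmu mF mH) mule_gt0//; first exact: bdry_integral_gt0.
  apply: half_line_integral_gt0.
    apply: measurable_funM; last exact: measurable_inv.
    apply: measurable_funM.
      by apply: measurable_funX; exact: (measurableT_comp mH (@measurable_ln R)).
    by apply: (measurableT_comp (@measurable_expR R)); exact: measurable_funM.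
  by move=> y y0; rewrite divr_gt0// mulr_gt0 ?exprn_gt0 ?expR_gt0.
have gu : (wint K (2 * b) g <= ((c0 + e) ^+ 2)%:E * wint K (2 * (b + 1)) u)%E.
  have wb := weight_pow hK (2 * b); have wb1 := weight_pow hK (2 * (b + 1)).
  have : (wint K (2 * b) g <= ((c0 + e) ^+ 2)%:E * wint K (2 * (b + 1)) u +
      0%:E * wint K (2 * (b + 1)) u)%E.
    apply: (qint_comb wb wb1 wb1) => //; first exact: sqr_ge0.
    move=> x; rewrite mul0r addr0 /g /u /dfld /fld; case: eqVneq => [_|x0].
      by rewrite expr0n !mul0r mulr0.
    have rx := normK_gt0 hK x0.
    rewrite (_ : 2 * (b + 1) = 2 * b + 2); last by ring.
    rewrite (_ : r x `^ (2 * b + 2) = r x `^ (2 * b) * r x ^+ 2); last first.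
      by rewrite powRD ?(gt_eqF rx) ?implybT// (powR_mulrn 2 (ltW rx)).
    set h := H' _; set F1 := dir_ext _ _; rewrite -subr_ge0.
    have -> : (c0 + e) ^+ 2 * ((F1 * H (ln (r x))) ^+ 2 / (r x `^ (2 * b) * r x ^+ 2)) -
        (F1 * h / r x) ^+ 2 / r x `^ (2 * b) =
        ((c0 + e) ^+ 2 * H (ln (r x)) ^+ 2 - h ^+ 2) * (F1 ^+ 2 / (r x `^ (2 * b) * r x ^+ 2)).
      by field; rewrite !gt_eqF// powR_gt0.
    rewrite mulr_ge0 ?subr_ge0//; first exact: H'2.
    by rewrite divr_ge0 ?sqr_ge0// mulr_ge0 ?powR_ge0// sqr_ge0.
  by rewrite mul0e adde0.
move: W0 Wfin gu (wint_ge0 hK (2 * b) g); case: (wint K (2 * (b + 1)) u) => // W.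
rewrite lte_fin => W0 _; rewrite -EFinM.
case: (wint K (2 * b) g) => // G; rewrite !lee_fin => GW G0.
rewrite /= !powR12_sqrt ?(ltW W0)// -sqrtrM// => h.
rewrite -(ler_pM2r W0); apply: le_trans h _.
rewrite addrC -[leRHS]ger0_norm ?mulr_ge0 ?(ltW W0)// -sqrtr_sqr ler_wsqrtr//.
by rewrite exprMn [W ^+ 2]expr2 mulrA ler_pM2r.
Qed.

End extremals.

Theorem theorem5p1 (R : realType) (N : nat) (K : set 'rV[R]_N) (a b : R)
    (hN : (2 <= N)%N) (hK : Kss_o K) :
  [/\ (regionA1 N a b || regionA2 N a b ->
        let C : R := `|(N%:R - a - b - 1) / 2| in
        sharp_constant K a b C /\
        forall (mu : {finite_measure set 'rV[R]_N -> \bar R})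
          (Phi : 'rV[R]_N -> R) (t : R),
          polar_measure K mu -> L2_bdry K mu Phi -> nonzero_bdry K mu Phi ->
          (regionA1 N a b -> t < 0) -> (regionA2 N a b -> 0 < t) ->
          let u := fun x : 'rV[R]_N => Phi (sigmaK K x) *
            expR (t / (b + 1 - a) * normK K x `^ (b + 1 - a)) in
          nonzero_fun u /\ achieved_by K a b C u),
      (regionB1 N a b || regionB2 N a b ->
        let C : R := `|(N%:R - 3 * b + a - 3) / 2| in
        sharp_constant K a b C /\
        forall (mu : {finite_measure set 'rV[R]_N -> \bar R})
          (Phi : 'rV[R]_N -> R) (t : R),
          polar_measure K mu -> L2_bdry K mu Phi -> nonzero_bdry K mu Phi ->
          (regionB1 N a b -> 0 < t) -> (regionB2 N a b -> t < 0) ->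
          let u := fun x : 'rV[R]_N => Phi (sigmaK K x) *
            normK K x `^ (2 * b + 2 - N%:R) *
            expR (t / (b + 1 - a) * normK K x `^ (b + 1 - a)) in
          nonzero_fun u /\ achieved_by K a b C u) &
      (a = b + 1 ->
        let C : R := `|N%:R - 2 * (b + 1)| / 2 in
        sharp_constant K a b C /\
        forall u : 'rV[R]_N -> R, nonzero_fun u -> ~ achieved_by K a b C u)].
Proof.
have powE x c : x != 0 -> normK K x `^ c = expR (c * ln (normK K x)).
  by move=> x0; rewrite /powR gt_eqF// normK_gt0.
(* A constant attained by one nonzero function is sharp; here the extremal with
   constant density and [t = - beta] is used. *)
have sharp (p C : R) : let beta := b + 1 - a in let m := 2 * p + N%:R - 2 - 2 * b in
    beta != 0 -> 0 <= m * beta -> p = 0 \/ (m = p /\ 0 < m * beta) ->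
    C = `|m + beta| / 2 -> hup_inequality K a b C -> sharp_constant K a b C.
  move=> beta m b0 mb hp CE HC.
  have [mu hmu] := polar_measure_exists hK hN.
  have [L2 nz] := polar_measure_cst1 hK hmu.
  have tb : - beta * beta < 0 by rewrite mulNr oppr_lt0 -expr2 exprn_even_gt0.
  pose u x := if x == 0 then 0 else
    1 * expR (p * ln (normK K x) + - beta / beta * expR (beta * ln (normK K x))).
  have [|_ [g [ug uE W0 Wfin]]] := @extremal R N K hK hN mu (fun=> 1) a b p (- beta) u hmu L2 nz tb mb hp.
    by move=> x x0; rewrite /u (negbTE x0).
  apply: (sharp_constant_achieved hK hN _ HC ug _ W0 Wfin).
    by rewrite CE divr_ge0.
  by rewrite CE.
split.
- move=> reg C.
  have rb : b + 1 - a != 0 /\ 0 <= (2 * 0 + N%:R - 2 - 2 * b) * (b + 1 - a).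
    case/orP: reg => /andP[h1 h2]; split; try (apply/eqP; lra).
      by rewrite mulr_ge0//; lra.
    by rewrite mulr_le0//; lra.
  have [b0 mb] := rb.
  have CE : C = `|2 * 0 + N%:R - 2 - 2 * b + (b + 1 - a)| / 2.
    rewrite /C normrM (@gtr0_norm _ 2^-1) ?invr_gt0//; congr (`|_| / _); ring.
  split.
    by apply: (@sharp 0) => //; [left|exact: hup_inequality1].
  move=> mu Phi t hmu L2 nz t1 t2 u.
  have tb : t * (b + 1 - a) < 0.
    case/orP: reg => reg.
      have := t1 reg; case/andP: reg => h1 _ t0; rewrite nmulr_rlt0//; lra.
    have := t2 reg; case/andP: reg => h1 _ t0; rewrite pmulr_rlt0//; lra.
  have [|nzu [g [ug uE _ _]]] := @extremal R N K hK hN mu Phi a b 0 t u hmu L2 nz tb mb (or_introl erefl).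
    by move=> x x0; rewrite /u powE// mul0r add0r.
  by split=> //; exists g => //; rewrite CE.
- move=> reg C; pose p : R := 2 * b + 2 - N%:R.
  have mp : 2 * p + N%:R - 2 - 2 * b = p by rewrite /p; ring.
  have [b0 mb] : b + 1 - a != 0 /\ 0 < p * (b + 1 - a).
    rewrite /p; case/orP: reg => /andP[h1 h2]; split; try (apply/eqP; lra).
      by rewrite nmulr_rgt0; lra.
    by rewrite mulr_gt0//; lra.
  have CE : C = `|2 * p + N%:R - 2 - 2 * b + (b + 1 - a)| / 2.
    rewrite mp /p /C normrM (@gtr0_norm _ 2^-1) ?invr_gt0// -normrN; congr (`|_| / _); ring.
  have hp : p = 0 \/ (2 * p + N%:R - 2 - 2 * b = p /\
      0 < (2 * p + N%:R - 2 - 2 * b) * (b + 1 - a)) by right; rewrite mp.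
  have mb' : 0 <= (2 * p + N%:R - 2 - 2 * b) * (b + 1 - a) by rewrite mp ltW.
  split.
    by apply: (@sharp p) => //; exact: hup_inequality2.
  move=> mu Phi t hmu L2 nz t1 t2 u.
  have tb : t * (b + 1 - a) < 0.
    case/orP: reg => reg.
      have := t1 reg; case/andP: reg => h1 _ t0; rewrite pmulr_rlt0//; lra.
    have := t2 reg; case/andP: reg => h1 _ t0; rewrite nmulr_rlt0//; lra.
  have [|nzu [g [ug uE _ _]]] := @extremal R N K hK hN mu Phi a b p t u hmu L2 nz tb mb' hp.
    by move=> x x0; rewrite /u !powE// expRD mulrA.
  by split=> //; exists g => //; rewrite CE.
- move=> aE C; rewrite aE.
  have CE : C = `|(N%:R - (b + 1) - b - 1) / 2|.
    rewrite /C normrM (@gtr0_norm _ 2^-1) ?invr_gt0//; congr (`|_| / _); ring.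
  split.
    split; first by rewrite CE; exact: hup_inequality1.
    by move=> C'; exact: hardy_sharp.
  move=> u nzu [g ug uE]; have [mu mg _] := ug.
  have ap := (in_completionP hK _ b mu mg).1 ug.
  have [M [G [ME GE M0 G0 _]]] := approximable_test hK mu mg ap.
  apply: (hardy_not_achieved hK hN mu mg ap ME) nzu.
  move: uE; rewrite /hup_lhs (_ : b + 1 + b + 1 = 2 * (b + 1)); last by ring.
  rewrite ME GE !poweR_EFin -!EFinM !powR12_sqrt// -sqrtrM// => -[] E.
  congr _%:E; rewrite -(sqr_sqrtr (mulr_ge0 G0 M0)) E exprMn CE real_normK ?num_real//.
  by congr (_ * _); field.
Qed.
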